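(* Assume the standing setup, either Setting A or Setting B, the Gibbs-measure and observable conventions and complex-perturbation quantities below, and the following: (a) $\operatorname{ess\,sup}_\omega E_\omega<\infty$; (b) in Setting A, additionally $\tilde H_\omega\le\gamma_{\theta\omega}^\alpha-1$ $\mathbb P$-a.s.; (c) for some $p>16$, $\bar D_\omega\in L^{2p}(\mathbb P)$ and $K_\omega$, $M_\omega$, $\sup|\tilde u_\omega|$ belong to $L^p(\mathbb P)$; (d) there is a constant $\sigma>0$ with $\sigma^2=\lim_n\frac1n\sigma^2_{\omega,n}$ for $\mathbb P$-a.e. $\omega$. Then for $\mathbb P$-a.e. $\omega$, $$\sup_{t\in\mathbb R}\big|\mu_\omega(S^\omega_n\tilde u\le t\sigma_{\omega,n})-\Phi(t)\big|=O\big(n^{-(1/2-8/p)}\big),$$ where $\Phi$ is the standard normal distribution function and $S^\omega_n\tilde u=\sum_{j=0}^{n-1}\tilde u_{\theta^j\omega}\circ T^j_\omega$.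
   Context: Standing setup. $(\Omega,\mathcal F,\mathbb P)$ is a probability space and $\theta:\Omega\to\Omega$ is invertible, measurable, $\mathbb P$-preserving and ergodic. $(\mathcal X,d)$ is a compact metric space with $\operatorname{diam}\mathcal X\le1$; $\mathcal E\subset\Omega\times\mathcal X$ is $\mathcal F\otimes\mathcal B(\mathcal X)$-measurable with compact fibres $\mathcal E_\omega=\{x:(\omega,x)\in\mathcal E\}$; $T_\omega:\mathcal E_\omega\to\mathcal E_{\theta\omega}$ are maps with $(\omega,x)\mapsto T_\omega x$ measurable, and $T^n_\omega=T_{\theta^{n-1}\omega}\circ\cdots\circ T_\omega$. ''Random variable'' means a measurable function of $\omega$. An exponent $\alpha\in(0,1]$ is fixed. For $g:\mathcal E_\omega\to\mathbb C$ let $v(g)=\sup_{x\ne x'}|g(x)-g(x')|/d(x,x')^\alpha$ and $\|g\|=\sup|g|+v(g)$; $\mathcal H_\omega$ is the space of real functions $g$ on $\mathcal E_\omega$ with $\|g\|<\infty$, and $\mathbf 1$ is the constant function $1$. A measurable potential $\phi:\mathcal E\to\mathbb R$ is given with $\phi_\omega=\phi(\omega,\cdot)$ bounded. The transfer operator is $\mathcal L_\omega g(x)=\sum_{y\in T_\omega^{-1}\{x\}}e^{\phi_\omega(y)}g(y)$, $x\in\mathcal E_{\theta\omega}$, and $\mathcal L^n_\omega=\mathcal L_{\theta^{n-1}\omega}\circ\cdots\circ\mathcal L_\omega$. Write $\rho_{\omega,n}=\prod_{j=0}^{n-1}\rho(\theta^j\omega)$ and $\lambda_{\omega,n}=\prod_{j=0}^{n-1}\lambda_{\theta^j\omega}$.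 Setting A (properly expanding maps). There are random variables $\gamma_\omega>1$, $H_\omega\ge0$, $D_\omega<\infty$ such that $\mathbb P$-a.s.: for every $x\in\mathcal E_{\theta\omega}$ the preimages are listed as $T_\omega^{-1}\{x\}=\{y_{i,\omega}(x):i\in I_\omega\}$ (index set $I_\omega$ finite or countable, independent of $x$, $i\mapsto y_{i,\omega}(x)$ bijective), and for all $x,x'\in\mathcal E_{\theta\omega}$ and $i\in I_\omega$: $d(y_{i,\omega}(x),y_{i,\omega}(x'))\le\gamma_\omega^{-1}d(x,x')$ and $|\phi_\omega(y_{i,\omega}(x))-\phi_\omega(y_{i,\omega}(x'))|\le H_\omega d(x,x')^\alpha$; moreover $H_\omega\le\gamma_{\theta\omega}^\alpha-1$ and $\sup_{x\in\mathcal E_{\theta\omega}}\sum_{y\in T_\omega^{-1}\{x\}}e^{\phi_\omega(y)}\le D_\omega$. In Setting A put $q(\omega)=(H_\omega+1)\gamma_{\theta\omega}^{-\alpha}$, $D(\omega)=\gamma_{\theta\omega}^\alpha+2\ln\frac{1+q(\omega)}{1-q(\omega)}$, $\rho(\omega)=\tanh(D(\omega)/4)$ (with $\rho(\omega)=1$ if $q(\omega)=1$), $B_\omega=24e^{4\gamma_\omega^\alpha}(1+\gamma_\omega^\alpha)^2$, $B_{\omega,1}=e^{\gamma_\omega^\alpha}$, $K_\omega=(1+\gamma_\omega^\alpha)e^{\gamma_\omega^\alpha}$, $M_\omega=8(1-e^{-\gamma_\omega^\alpha})^{-2}$, and $\mathcal C_\omega=\{g\in\mathcal H_\omega:g\ge0,\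 g(x)\le e^{\gamma_\omega^\alpha d(x,x')^\alpha}g(x')\ \forall x,x'\in\mathcal E_\omega\}$. Setting B (partially expanding maps). There are random variables $l_\omega\ge1$, $\sigma_\omega>1$ and positive integer valued $q_\omega<d_\omega$ such that $\mathbb P$-a.s. every $x\in\mathcal E_{\theta\omega}$ has exactly $d_\omega$ preimages, listed as $T_\omega^{-1}\{x\}=\{y_{1,\omega}(x),\dots,y_{d_\omega,\omega}(x)\}$, and for all $x,x'\in\mathcal E_{\theta\omega}$: $d(y_{i,\omega}(x),y_{i,\omega}(x'))\le l_\omega d(x,x')$ for $i\le q_\omega$ and $d(y_{i,\omega}(x),y_{i,\omega}(x'))\le\sigma_\omega^{-1}d(x,x')$ for $q_\omega<i\le d_\omega$. Let $a_\omega=(q_\omega l_\omega^\alpha+(d_\omega-q_\omega)\sigma_\omega^{-\alpha})/d_\omega$, $\varepsilon_\omega=\sup\phi_\omega-\inf\phi_\omega$, $H_\omega=\max_{i\le d_\omega}v(\phi_\omega\circ y_{i,\omega})$ (assumed finite), and assume $s_\omega:=e^{\varepsilon_\omega}a_\omega<1$ and $e^{\varepsilon_\omega}H_\omega\le(s_{\theta\omega}^{-1}-1)/(1+s_\omega^{-1})$. In Setting B put $\zeta_\omega=s_{\theta\omega}\big(1+(1+s_\omega^{-1})e^{\varepsilon_\omega}H_\omega\big)$, $D(\omega)=2\ln\frac{1+\zeta_\omega}{1-\zeta_\omega}+2\ln(1+\zeta_\omega s_\omega^{-1})$, $\rho(\omega)=\tanh(D(\omega)/4)$ (with $\rho(\omega)=1$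 if $\zeta_\omega=1$), $B_\omega=12(1+2s_\omega^{-1})^4$, $B_{\omega,1}=1+s_\omega^{-1}$, $K_\omega=1+2s_\omega^{-1}$, $M_\omega=6s_\omega^{-1}$, $D_\omega=d_\omega e^{\sup|\phi_\omega|}$, and $\mathcal C_\omega=\{g\in\mathcal H_\omega:g>0,\ v(g)\le s_\omega^{-1}\inf g\}$. Gibbs measures. In either setting, $\mathbb P$-a.s. the limits $\nu_\omega(g)=\lim_n\mathcal L^n_\omega g(x_n)/\mathcal L^n_\omega\mathbf 1(x_n)$ ($g\in\mathcal H_\omega$, any $x_n\in\mathcal E_{\theta^n\omega}$), $\lambda_\omega=\nu_{\theta\omega}(\mathcal L_\omega\mathbf 1)$ and $h_\omega=\lim_n\mathcal L^n_{\theta^{-n}\omega}\mathbf 1/\lambda_{\theta^{-n}\omega,n}$ exist, $\nu_\omega$ is a Borel probability measure, and $\mu_\omega:=h_\omega\nu_\omega$ is the random Gibbs measure; it satisfies $(T_\omega)_*\mu_\omega=\mu_{\theta\omega}$. Observables. $u:\mathcal E\to\mathbb R$ is measurable with $u_\omega=u(\omega,\cdot)\in\mathcal H_\omega$; $\tilde u_\omega=u_\omega-\mu_\omega(u_\omega)$; $S^\omega_nu=\sum_{j=0}^{n-1}u_{\theta^j\omega}\circ T^j_\omega$, viewed as a random variable on $(\mathcal E_\omega,\mu_\omega)$; $\sigma^2_{\omega,n}=\mathrm{Var}_{\mu_\omega}(S^\omega_nu)$. Complex-perturbation quantities. In Setting A: $\tilde H_\omega=\gamma_\omega^{-\alpha}v(u_\omega)+H_\omega$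 and $c_0(\omega)=3\sup|\tilde u_\omega|+\tilde H_\omega/(\gamma_{\theta\omega}^\alpha-1-\tilde H_\omega)$. In Setting B: $\tilde H_\omega=H_\omega$ and $c_0(\omega)=32s_{\theta\omega}(1+2s_\omega^{-1})e^{\sup|\tilde u_\omega|+2\sup|\phi_\omega|}\|\tilde u_\omega\|(1+H_\omega)/(1-\zeta_\omega)$. In both settings: $E_\omega=c_0(\omega)\big(1+\cosh(7D(\omega)/2)\big)$ and $\bar D_\omega=16e^{\sup|\tilde u_\omega|}(1+v(u_\omega))(1+\tilde H_\omega)D_\omega$. *)

(* Defs.v *)
From HB Require Import structures.
From mathcomp Require Export all_boot all_order all_algebra.
From mathcomp Require Export all_classical all_reals all_analysis.
Set Implicit Arguments.
Unset Strict Implicit.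
Unset Printing Implicit Defensive.
Import Order.TTheory GRing.Theory Num.Theory.
Import numFieldNormedType.Exports.
Local Open Scope classical_set_scope.
Local Open Scope ring_scope.

Section RDS.
Context {R : realType}.

Section Metric.
Context {X : Type}.
Variable dist : X -> X -> R.

Definition is_metric :=
  [/\ (forall x y, 0 <= dist x y), (forall x y, dist x y = 0 <-> x = y),
      (forall x y, dist x y = dist y x) &
      (forall x y z, dist x z <= dist x y + dist y z)].

Definition dopen (A : set X) :=
  forall x, A x -> exists2 r : R, 0 < r & forall y, dist x y < r -> A y.

Definition dcompact (K : set X) :=
  forall (I : Type) (U : I -> set X), (forall i, dopen (U i)) ->
    K `<=` \bigcup_(i in setT) U i ->
    exists F : set I, finite_set F /\ K `<=` \bigcup_(i in F) U i.

(* Hoelder seminorm v(g) of g restricted to A (value in \bar R, 0 on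
   sets with at most one point) *)
Definition holv (alpha : R) (A : set X) (g : X -> R) : \bar R :=
  ereal_sup ([set 0%E] `|`
    [set z | exists x y, [/\ A x, A y, x <> y &
                z = ((`|g x - g y| / (dist x y `^ alpha))%:E)]]).
End Metric.

Definition supabs {X : Type} (A : set X) (g : X -> R) : R :=
  sup [set `|g x| | x in A].
Definition supE {X : Type} (A : set X) (g : X -> R) : R := sup (g @` A).
Definition infE {X : Type} (A : set X) (g : X -> R) : R := inf (g @` A).

Definition bounded_on {X : Type} (A : set X) (g : X -> R) :=
  exists M : R, forall x, A x -> `|g x| <= M.

Definition in_holder {X : Type} (dist : X -> X -> R) (alpha : R)
  (A : set X) (g : X -> R) :=
  bounded_on A g /\ (holv dist alpha A g < +oo)%E.

Definition rsum {X : choiceType} (S : set X) (f : X -> R) : R :=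
  fine (esum S (fun y => (Num.max (f y) 0)%:E)) -
  fine (esum S (fun y => (Num.max (- f y) 0)%:E)).

Definition cosh (x : R) : R := (expR x + expR (- x)) / 2.

(* a / b in \bar R, equal to +oo when b <= 0 (used with a >= 0, b >= 0) *)
Definition ediv (a b : R) : \bar R := if 0 < b then (a / b)%:E else +oo%E.

Definition Edef (c0 D : \bar R) : \bar R :=
  match D with
  | EFin d => (c0 * (1 + cosh (7 * d / 2))%:E)%E
  | _ => +oo%E
  end.

Definition Phi (t : R) : R := fine (normal_prob (0 : R) 1 `]-oo, t]).

Section Base.
Context {dO : measure_display} {Omega : measurableType dO}.
Variable P : probability Omega R.

Definition inLp (p : R) (f : Omega -> R) :=
  measurable_fun setT f /\ (\int[P]_w ((`|f w| `^ p)%:E) < +oo)%E.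

Definition ess_bounded (f : Omega -> \bar R) :=
  exists C : R, {ae P, forall w, (f w <= C%:E)%E}.

Definition invertible_mpt_ergodic (theta thinv : Omega -> Omega) :=
  [/\ measurable_fun setT theta /\ measurable_fun setT thinv,
      cancel theta thinv, cancel thinv theta,
      (forall A, measurable A -> P (theta @^-1` A) = P A) &
      (forall A, measurable A -> theta @^-1` A = A -> P A = 0%E \/ P A = 1%E)].
End Base.

Section Dyn.
Context {dO : measure_display} {Omega : measurableType dO}.
Context {dX : measure_display} {X : measurableType dX}.
Variable theta thinv : Omega -> Omega.
Variable E : set (Omega * X).
Variable T : Omega -> X -> X.
Variable phi : Omega -> X -> R.

Definition Fib (w : Omega) : set X := [set x | E (w, x)].

Definition preim (w : Omega) (x : X) : set X := [set y | E (w, y) /\ T w y = x].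

Definition Lop (w : Omega) (g : X -> R) (x : X) : R :=
  rsum (preim w x) (fun y => expR (phi w y) * g y).

Fixpoint Lopn (n : nat) (w : Omega) (g : X -> R) : X -> R :=
  match n with
  | 0 => g
  | n'.+1 => Lop (iter n' theta w) (Lopn n' w g)
  end.

Fixpoint Tn (n : nat) (w : Omega) (x : X) : X :=
  match n with
  | 0 => x
  | n'.+1 => T (iter n' theta w) (Tn n' w x)
  end.

Definition one : X -> R := fun _ => 1.

Section Gibbs.
Variable nu : Omega -> probability X R.
Variable h : Omega -> X -> R.

Definition integ (w : Omega) (A : set X) (f : X -> R) : R :=
  fine (\int[nu w]_(x in A) (f x)%:E)%E.

Definition lam (w : Omega) : R := integ (theta w) (Fib (theta w)) (Lop w one).
Definition lamn (w : Omega) (n : nat) : R := \prod_(j < n) lam (iter j theta w).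

Definition mu (w : Omega) (A : set X) : R := integ w (A `&` Fib w) (h w).
Definition muf (w : Omega) (f : X -> R) : R := integ w (Fib w) (fun x => h w x * f x).

Variable dist : X -> X -> R.
Variable alpha : R.

(* nu is the conformal measure characterised by the limit in the paper,
   and h the density defined by the limit in the paper *)
Definition gibbs_char (w : Omega) :=
  (forall g : X -> R, in_holder dist alpha (Fib w) g ->
     forall xs : nat -> X, (forall n, Fib (iter n theta w) (xs n)) ->
       (fun n => Lopn n w g (xs n) / Lopn n w one (xs n)) @ \oo
         --> integ w (Fib w) g) /\
  (forall x, Fib w x ->
     (fun n => Lopn n (iter n thinv w) one x / lamn (iter n thinv w) n) @ \oo
       --> h w x).

Variable u : Omega -> X -> R.

Definition ut (w : Omega) (x : X) : R := u w x - muf w (u w).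
Definition Snu (w : Omega) (n : nat) (x : X) : R :=
  \sum_(j < n) u (iter j theta w) (Tn j w x).
Definition Snut (w : Omega) (n : nat) (x : X) : R :=
  \sum_(j < n) ut (iter j theta w) (Tn j w x).
Definition sig2 (w : Omega) (n : nat) : R :=
  muf w (fun x => (Snu w n x - muf w (Snu w n)) ^+ 2).

Definition suput (w : Omega) : R := supabs (Fib w) (ut w).
Definition vu (w : Omega) : R := fine (holv dist alpha (Fib w) (u w)).

Section SettingA.
Variable P : probability Omega R.
Variables gamma H D : Omega -> R.

Definition settingA :=
  [/\ measurable_fun setT gamma, measurable_fun setT H,
      measurable_fun setT D &
  {ae P, forall w,
    [/\ 1 < gamma w, 0 <= H w,
        H w <= gamma (theta w) `^ alpha - 1,
        (forall x, Fib (theta w) x ->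
           (esum (preim w x) (fun y => (expR (phi w y))%:E) <= (D w)%:E)%E) &
        exists (I : set nat) (y : nat -> X -> X),
          (forall x, Fib (theta w) x ->
             [/\ (forall i, I i -> preim w x (y i x)),
                 (forall i j, I i -> I j -> y i x = y j x -> i = j) &
                 (forall z, preim w x z -> exists2 i, I i & z = y i x)]) /\
          (forall x x' i, Fib (theta w) x -> Fib (theta w) x' -> I i ->
             dist (y i x) (y i x') <= (gamma w)^-1 * dist x x' /\
             `|phi w (y i x) - phi w (y i x')| <= H w * dist x x' `^ alpha)]}].

Definition gA (w : Omega) : R := gamma w `^ alpha.
Definition qA (w : Omega) : R := (H w + 1) * (gA (theta w))^-1.
Definition DA (w : Omega) : \bar R :=
  if qA w < 1 then (gA (theta w) + 2 * ln ((1 + qA w) / (1 - qA w)))%:E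
  else +oo%E.
Definition HtA (w : Omega) : R := (gA w)^-1 * vu w + H w.
Definition c0A (w : Omega) : \bar R :=
  ((3 * suput w)%:E + ediv (HtA w) (gA (theta w) - 1 - HtA w))%E.
Definition EA (w : Omega) : \bar R := Edef (c0A w) (DA w).
Definition KA (w : Omega) : R := (1 + gA w) * expR (gA w).
Definition MA (w : Omega) : R := 8 * ((1 - expR (- gA w)) ^+ 2)^-1.
Definition DbarA (w : Omega) : R :=
  16 * expR (suput w) * (1 + vu w) * (1 + HtA w) * D w.

Definition hypsA (p : R) :=
  [/\ ess_bounded P EA,
      {ae P, forall w, HtA w <= gA (theta w) - 1},
      inLp P (2 * p) DbarA, inLp P p KA &
      inLp P p MA /\ inLp P p suput].
End SettingA.

Section SettingB.
Variable P : probability Omega R.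
Variables l sg : Omega -> R.
Variables q d : Omega -> nat.
Variable y : Omega -> nat -> X -> X.   (* listing y_{i,omega}, i = 1..d_omega *)

Definition aB (w : Omega) : R :=
  ((q w)%:R * l w `^ alpha + ((d w - q w)%N)%:R * (sg w `^ alpha)^-1) / (d w)%:R.
Definition epsB (w : Omega) : R := supE (Fib w) (phi w) - infE (Fib w) (phi w).
Definition HB (w : Omega) : R :=
  \big[Num.max/0]_(1 <= i < (d w).+1)
     fine (holv dist alpha (Fib (theta w)) (fun x => phi w (y w i x))).
Definition sB (w : Omega) : R := expR (epsB w) * aB w.

Definition settingB :=
  [/\ measurable_fun setT l, measurable_fun setT sg,
      measurable_fun setT (fun w => (q w)%:R : R),
      measurable_fun setT (fun w => (d w)%:R : R) &
  {ae P, forall w,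
    [/\ 1 <= l w /\ 1 < sg w, (0 < q w)%N /\ (q w < d w)%N,
        (forall x, Fib (theta w) x ->
           [/\ (forall i, (1 <= i <= d w)%N -> preim w x (y w i x)),
               (forall i j, (1 <= i <= d w)%N -> (1 <= j <= d w)%N ->
                  y w i x = y w j x -> i = j) &
               (forall z, preim w x z ->
                  exists2 i, (1 <= i <= d w)%N & z = y w i x)]),
        (forall x x', Fib (theta w) x -> Fib (theta w) x' ->
           (forall i, (1 <= i <= q w)%N ->
              dist (y w i x) (y w i x') <= l w * dist x x') /\
           (forall i, (q w < i <= d w)%N ->
              dist (y w i x) (y w i x') <= (sg w)^-1 * dist x x')) &
        [/\ (forall i, (1 <= i <= d w)%N ->
               (holv dist alpha (Fib (theta w)) (fun x => phi w (y w i x)) < +oo)%E),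
            sB w < 1 &
            expR (epsB w) * HB w <= ((sB (theta w))^-1 - 1) / (1 + (sB w)^-1)]]}].

Definition zetaB (w : Omega) : R :=
  sB (theta w) * (1 + (1 + (sB w)^-1) * expR (epsB w) * HB w).
Definition DB (w : Omega) : \bar R :=
  if zetaB w < 1 then
    (2 * ln ((1 + zetaB w) / (1 - zetaB w)) + 2 * ln (1 + zetaB w * (sB w)^-1))%:E
  else +oo%E.
Definition normut (w : Omega) : R :=
  suput w + fine (holv dist alpha (Fib w) (ut w)).
Definition c0B (w : Omega) : \bar R :=
  ediv (32 * sB (theta w) * (1 + 2 * (sB w)^-1)
          * expR (suput w + 2 * supabs (Fib w) (phi w))
          * normut w * (1 + HB w))
       (1 - zetaB w).
Definition EB (w : Omega) : \bar R := Edef (c0B w) (DB w).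
Definition KB (w : Omega) : R := 1 + 2 * (sB w)^-1.
Definition MB (w : Omega) : R := 6 * (sB w)^-1.
Definition DBd (w : Omega) : R := (d w)%:R * expR (supabs (Fib w) (phi w)).
Definition DbarB (w : Omega) : R :=
  16 * expR (suput w) * (1 + vu w) * (1 + HB w) * DBd w.

Definition hypsB (p : R) :=
  [/\ ess_bounded P EB, inLp P (2 * p) DbarB, inLp P p KB,
      inLp P p MB & inLp P p suput].
End SettingB.

End Gibbs.
End Dyn.
End RDS.

(* Main.v *)
Require Import Defs.
From mathcomp Require Import measurable_realfun.
From mathcomp Require Import ring lra.
Set Implicit Arguments.
Unset Strict Implicit.
Unset Printing Implicit Defensive.
Import Order.TTheory GRing.Theory Num.Theory.
Import numFieldNormedType.Exports.
Local Open Scope classical_set_scope.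
Local Open Scope ring_scope.

(** The characteristic function of the Birkhoff sum is computed by real
  perturbation of the transfer operators.  Write P_j = L_j / lam_j along an orbit,
  u_j for the centred observable, and propagate
    F^x_0 = cos x . h_0,   F^x_{j+1} = P_j (cos (t u_j) F^x_j + sin (t u_j) F^{x - pi/2}_j),
  so that N_j F^x_j = E cos (t S_j - x).  P_j maps a cone C_j of positive functions
  into C_{j+1} and gains a factor: P_j f - kappa_j N_j(f) h_{j+1} stays in C_{j+1}, hence
  P_j contracts by 1 - kappa_j the functions of zero integral that are dominated by h_j;
  multiplication by u_j costs a factor c_j.  The assumption on E_omega bounds c_j / kappa_j
  (in setting B only up to O(n^(3/p)), by the moment assumptions), so F^x_j differs from
  E cos (t S_j - x) h_j by O(t), and from its first order expansion in t by O(t^2).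
  Inserting this in the recursion gives
    E cos (t S_{j+1} - x) = (1 - t^2 v_j / 2) E cos (t S_j - x) + O(|t|^3),
  where the v_j sum up to Var S_n.  The error relative to the Gaussian is therefore
  exp (- t^2 sigma_n^2 / 2) ((1 + O(|t|^3))^n - 1), and smoothing with a Gaussian kernel
  turns this into the rate. *)

(** No lower bound on kappa_j is available, hence no uniform spectral gap: only c_j / kappa_j is
    controlled, and the contraction of a step has to pay for the errors made in that same step. The
    errors must also stay relative to the Gaussian. All bounds are therefore multiples of b_j = (1 +
    e)^j exp (- t^2 Var S_j / 2), which may decrease in j. The induction closes because (1 - kappa_j
    / 2) b_j <= b_{j+1}: one half of kappa_j covers the decrease of b_j, the other half the new
    errors. The exponent of the rate comes from |u_j| <= s = O(n^(1/p)) and c_j / kappa_j <= A =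
    O(n^(3/p)). A step costs |t|^3 s A^2 relative to the Gaussian; with t = r / sigma_n, n steps
    cost r^3 n^(7/p - 1/2), which is tolerable for r up to T of order n^(1/2 - 7/p). Smoothing loses
    one more factor n^(1/p), whence 8/p. *)

Lemma ler_normD_le {R : realType} (x y a b : R) :
  `|x| <= a -> `|y| <= b -> `|x + y| <= a + b.
Proof. by move=> xa yb; rewrite (le_trans (ler_normD _ _))// lerD. Qed.

Lemma fct_pointwise {R : realType} {X : Type} :
  ((forall (f g : X -> R) x, ((f + g) x = f x + g x)%R) *
  (forall (f : X -> R) x, ((- f) x = - f x)%R) *
  (forall (k : R) (f : X -> R) x, ((k *: f) x = k * f x)%R) *
  (forall (f g : X -> R) x, ((f * g) x = f x * g x)%R) *
  (forall x, ((0 : X -> R) x = 0)%R))%type.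
Proof. by []. Qed.

(** * Perturbation of positive operators along an orbit *)

Section ElementaryBounds.
Context {R : realType}.
Implicit Types (f df : R -> R) (x y z m K : R).

(** With [y = 0] and [m = |x|] this raises the order of a Taylor estimate by one. The bounds below
    on [cos], [sin] and [expR] iterate it, with constants that are not sharp. *)
Lemma lipschitz_of_derive f df m K :
  (forall x, is_derive x (1 : R) f (df x)) ->
  (forall x, `|x| <= m -> `|df x| <= K) ->
  forall x y, `|x| <= m -> `|y| <= m -> `|f x - f y| <= K * `|x - y|.
Proof.
move=> dfE dfK x y; wlog xy : x y / x <= y.
  move=> H xm ym; have [xy|/ltW yx] := leP x y; first exact: H.
  by rewrite distrC (distrC x); exact: H.
move=> xm ym.
have cf : {within `[x, y], continuous f}.
  by apply: derivable_within_continuous => z _; exact: ex_derive.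
have [c] := MVT_segment xy (fun z _ => dfE z) cf.
rewrite in_itv/= => /andP[xc cy] fxy.
rewrite distrC fxy normrM (distrC x) ler_wpM2r// dfK//.
by move: xm ym; rewrite !ler_norml; lra.
Qed.

Lemma cos_lipschitz x y : `|cos x - cos y| <= `|x - y|.
Proof.
rewrite -[leRHS]mul1r.
apply: (@lipschitz_of_derive cos (fun x => - sin x) (Num.max `|x| `|y|)).
- by move=> z _; rewrite normrN sin_max.
- by rewrite le_max lexx.
- by rewrite le_max lexx orbT.
Qed.

Lemma sin_lipschitz x y : `|sin x - sin y| <= `|x - y|.
Proof.
rewrite -[leRHS]mul1r.
apply: (@lipschitz_of_derive sin cos (Num.max `|x| `|y|)).
- by move=> z _; rewrite cos_max.
- by rewrite le_max lexx.
- by rewrite le_max lexx orbT.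
Qed.

Lemma sin_norm_le x : `|sin x| <= `|x|.
Proof. by have := sin_lipschitz x 0; rewrite sin0 !subr0. Qed.

Lemma cosB1_norm_le x : `|cos x - 1| <= `|x|.
Proof. by have := cos_lipschitz x 0; rewrite cos0 subr0. Qed.

Lemma cos_lipschitz_small m x y : `|x| <= m -> `|y| <= m ->
  `|cos x - cos y| <= m * `|x - y|.
Proof.
apply: (@lipschitz_of_derive cos (fun x => - sin x)) => z zm.
by rewrite normrN (le_trans (sin_norm_le z)).
Qed.

Lemma cosB1_norm_le_sqr x : `|cos x - 1| <= `|x| ^+ 2.
Proof.
have := @cos_lipschitz_small `|x| x 0; rewrite cos0 subr0 normr0.
by rewrite expr2; apply.
Qed.

Lemma sinB_lipschitz_small m x y : `|x| <= m -> `|y| <= m ->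
  `|(sin x - x) - (sin y - y)| <= m * `|x - y|.
Proof.
apply: (@lipschitz_of_derive (fun z => sin z - z) (fun z => cos z - 1)) => z zm.
by rewrite (le_trans (cosB1_norm_le z)).
Qed.

Lemma sinB_norm_le_sqr x : `|sin x - x| <= `|x| ^+ 2.
Proof.
have := @sinB_lipschitz_small `|x| x 0; rewrite sin0 !subr0 normr0.
by rewrite expr2; apply.
Qed.

Lemma sinB_norm_le_cube x : `|sin x - x| <= `|x| ^+ 3.
Proof.
have := @lipschitz_of_derive (fun z => sin z - z) (fun z => cos z - 1) `|x| (`|x| ^+ 2) _ _ x 0.
rewrite sin0 !subr0 normr0 -exprSr; apply => //.
- by move=> z zx; rewrite (le_trans (cosB1_norm_le_sqr z))// lerXn2r// nnegrE.
Qed.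

Lemma cos_taylor2_norm_le_cube x : `|cos x - 1 + x ^+ 2 / 2| <= `|x| ^+ 3.
Proof.
have := @lipschitz_of_derive (fun z => cos z - 1 + z ^+ 2 / 2) (fun z => - (sin z - z)) `|x| (`|x| ^+ 2) _ _ x 0.
rewrite cos0 expr0n/= mul0r subrr addr0 !subr0 normr0 -exprSr; apply => //.
- move=> z; rewrite opprB addrC.
  apply: is_deriveD.
    by rewrite -[- sin z]subr0; apply: is_deriveB; exact: is_derive_cos.
  rewrite [X in is_derive _ _ _ X](_ : z = 2^-1 *: ((2%:R * z ^+ 1) *: 1)); last first.
    have : z = 2^-1 * ((2%:R * z ^+ 1) * 1) by rewrite expr1; field.
    by [].
  rewrite (_ : (fun z0 => _) = 2^-1 *: (fun z0 : R => z0 ^+ 2)); last first.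
    by apply/funext => w; rewrite /= mulrC.
  apply: is_deriveZ.
  exact: (@is_deriveX _ _ id 2 z 1 1).
- by move=> z zx; rewrite normrN (le_trans (sinB_norm_le_sqr z))// lerXn2r// nnegrE.
Qed.

Lemma expR_le_2 x : x <= 1/2 -> expR x <= 2.
Proof.
move=> x1; have := expR_ge1Dx (- x); rewrite expRN => h.
have := expR_gt0 x => e0; have : (1 - x) * expR x <= 1.
  by rewrite -ler_pdivlMr// div1r.
by nra.
Qed.

Lemma expRN_taylor1_norm_le y : `|y| <= 1/2 -> `|expR (- y) - (1 - y)| <= y ^+ 2 * 2.
Proof.
move=> y1.
have := @lipschitz_of_derive (fun z => expR (- z) - (1 - z)) (fun z => - (expR (- z) - 1)) `|y| (`|y| * 2) _ _ y 0.
rewrite !subr0 oppr0 expR0 subrr subr0 mulrAC -expr2 real_normK ?num_real//.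
apply; rewrite ?normr0//.
- move=> z; rewrite (_ : - (expR (- z) - 1) = expR (- z) * - 1 - (0 - 1)); last by ring.
  apply: is_deriveB.
- move=> z zy; rewrite normrN.
  have z2 : `|z| <= 1/2 by rewrite (le_trans zy).
  have /ler_normlP[z3 z4] := z2.
  have h1 := expR_ge1Dx (- z); have h2 := expR_ge1Dx z.
  have h3 : expR (- z) <= 2 by apply: expR_le_2.
  have e0 := expR_gt0 (- z).
  have h4 : expR z * expR (- z) = 1 by rewrite -expRD subrr expR0.
  have [z0|z0] := leP 0 z.
    have e1 : expR (- z) <= 1 by rewrite -expR0 ler_expR oppr_le0.
    rewrite ler_norml; apply/andP; split; last by have := normr_ge0 y; lra.
    by move: zy; rewrite (ger0_norm z0); lra.
  rewrite ger0_norm; last by lra.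
  have : expR (- z) - 1 <= - z * 2 by nra.
  by move: zy; rewrite (ltr0_norm z0); lra.
Qed.

End ElementaryBounds.

Lemma fct_mulZr {R : realType} {X : Type} (k : R) (f g : X -> R) :
  f * (k *: g) = k *: (f * g).
Proof. by apply/funext => x; rewrite !fct_pointwise; ring. Qed.

(** * Abstract recursion along a sequence of cones *)

Section ConeRecursion.
Context {R : realType} {X : Type}.
Variables (dom C : nat -> (X -> R) -> Prop) (N : nat -> (X -> R) -> R)
  (P : nat -> (X -> R) -> X -> R) (h u : nat -> X -> R)
  (kappa c S : nat -> R) (s A : R).
Implicit Types (f g : X -> R) (j : nat) (a b K : R).

Hypothesis domZD : forall j a f g, dom j f -> dom j g -> dom j (a *: f + g).
Hypothesis dom_cone : forall j f, C j f -> dom j f.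
Hypothesis dom_mul : forall j (g : R -> R) K f, 0 <= K ->
  (forall y z, `|y| <= s -> `|z| <= s -> `|g y - g z| <= K * `|y - z|) ->
  dom j f -> dom j ((g \o u j) * f).
Hypothesis coneD : forall j f g, C j f -> C j g -> C j (f + g).
Hypothesis coneZ : forall j a f, 0 <= a -> C j f -> C j (a *: f).
Hypothesis cone_h : forall j, C j (h j).
Hypothesis Nlin : forall j a f g, dom j f -> dom j g ->
  N j (a *: f + g) = a * N j f + N j g.
Hypothesis Plin : forall j a f g, dom j f -> dom j g ->
  P j (a *: f + g) = a *: P j f + P j g.
Hypothesis dom_P : forall j f, dom j f -> dom j.+1 (P j f).
Hypothesis N_P : forall j f, dom j f -> N j.+1 (P j f) = N j f.
Hypothesis P_h : forall j, P j (h j) = h j.+1.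
Hypothesis N_h : forall j, N j (h j) = 1.
Hypothesis N_uh : forall j, N j (u j * h j) = 0.
Hypothesis P_cone : forall j f, C j f ->
  C j.+1 (P j f - (kappa j * N j f) *: h j.+1).
(** Such a multiplier [g \o u j] has supremum and Hölder constant at most [K] times those of [u j],
    so its cost is linear in [K]. The same hypothesis then serves sin (t y), cos (t y) - 1 and sin
    (t y) - t y, with [K] equal to |t| or t^2 s. *)
Hypothesis P_mul_cone : forall j (g : R -> R) K f, 0 <= K ->
  (forall y z, `|y| <= s -> `|z| <= s -> `|g y - g z| <= K * `|y - z|) ->
  (forall y, `|y| <= s -> `|g y| <= K * `|y|) ->
  C j f -> C j.+1 ((K * c j) *: P j f + P j ((g \o u j) * f)).
(** [N] sees only the size of the multiplier, hence [S j] in place of [c j]; [L] keeps the product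
    in the domain. Separating [K] from [L] allows [K] of order |t|^3 s^2 for the Taylor
    remainders. *)
Hypothesis N_mul_cone : forall j (g : R -> R) K L f, 0 <= K -> 0 <= L ->
  (forall y z, `|y| <= s -> `|z| <= s -> `|g y - g z| <= L * `|y - z|) ->
  (forall y, `|y| <= s -> `|g y| <= K * `|y|) ->
  C j f -> `|N j ((g \o u j) * f)| <= K * S j * N j f.
Hypothesis kappa01 : forall j, 0 <= kappa j <= 1.
Hypothesis S_ge0 : forall j, 0 <= S j.
Hypothesis S_le_s : forall j, S j <= s.
Hypothesis S_le_c : forall j, S j <= c j.
Hypothesis c_le : forall j, c j <= A * kappa j.
Hypothesis s_ge1 : 1 <= s.
Hypothesis s_le_A : s <= A.

(** The order-unit norm: - a h_j <= f <= a h_j in the partial order given by the cone. *)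
Definition dominated j a f := C j (a *: h j + f) /\ C j (a *: h j - f).

Lemma cone0 j : C j 0.
Proof. by have := coneZ (lexx 0) (cone_h j); rewrite scale0r. Qed.

Lemma dominated_dom j a f : dominated j a f -> dom j f.
Proof.
move=> [f1 f2].
have -> : f = (- (1/2)) *: (a *: h j - f) + ((1/2) *: (a *: h j + f) + 0).
  apply/funext => x; rewrite !fct_pointwise; by field.
apply: domZD; first exact: dom_cone.
by apply: domZD; [exact: dom_cone|apply: dom_cone; exact: cone0].
Qed.

Lemma dominatedD j a b f g : dominated j a f -> dominated j b g ->
  dominated j (a + b) (f + g).
Proof.
move=> [f1 f2] [g1 g2]; split.
  rewrite (_ : _ + _ = (a *: h j + f) + (b *: h j + g)); first exact: coneD.
  by apply/funext => x; rewrite !fct_pointwise; ring.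
rewrite (_ : _ - _ = (a *: h j - f) + (b *: h j - g)); first exact: coneD.
by apply/funext => x; rewrite !fct_pointwise; ring.
Qed.

Lemma dominatedN j a f : dominated j a f -> dominated j a (- f).
Proof. by move=> [f1 f2]; split; rewrite ?opprK. Qed.

Lemma dominatedZ j k a f : dominated j a f -> dominated j (`|k| * a) (k *: f).
Proof.
move=> fa; wlog k0 : k f fa / 0 <= k.
  move=> H; have [|k0] := leP 0 k; first exact: H.
  have := H (- k) (- f) (dominatedN fa); rewrite normrN scalerN scaleNr opprK.
  by apply; rewrite oppr_ge0 ltW.
case: fa => f1 f2; rewrite ger0_norm//; split; rewrite -scalerA.
  by rewrite -scalerDr; exact: coneZ.
by rewrite -scalerBr; exact: coneZ.
Qed.

Lemma dominated_le j a b f : a <= b -> dominated j a f -> dominated j b f.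
Proof.
move=> ab [f1 f2].
have ba : C j ((b - a) *: h j) by apply: coneZ => //; rewrite subr_ge0.
split.
  rewrite (_ : _ + _ = (a *: h j + f) + (b - a) *: h j); first exact: coneD.
  by apply/funext => x; rewrite !fct_pointwise; ring.
rewrite (_ : _ - _ = (a *: h j - f) + (b - a) *: h j); first exact: coneD.
by apply/funext => x; rewrite !fct_pointwise; ring.
Qed.

Lemma dominated_h j : dominated j 1 (h j).
Proof.
split; rewrite scale1r; last by rewrite subrr; exact: cone0.
exact: coneD.
Qed.

Let dom_h j : dom j (h j). Proof. exact: dom_cone. Qed.

Let domD j f g : dom j f -> dom j g -> dom j (f + g).
Proof. by move=> f1 g1; rewrite -[f]scale1r; exact: domZD. Qed.

Let domZ j k f : dom j f -> dom j (k *: f).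
Proof.
by move=> f1; rewrite -[_ *: _]addr0; apply: domZD => //; apply: dom_cone; exact: cone0.
Qed.

Let domN j f : dom j f -> dom j (- f).
Proof. by move=> f1; rewrite -scaleN1r; exact: domZ. Qed.

Let ND j f g : dom j f -> dom j g -> N j (f + g) = N j f + N j g.
Proof. by move=> f1 g1; rewrite -[f]scale1r Nlin// mul1r scale1r. Qed.

Let N0 j : N j 0 = 0.
Proof.
have d0 : dom j 0 by apply: dom_cone; exact: cone0.
have := ND d0 d0; rewrite addr0 -{1}[N j 0]addr0 => /addrI/esym.
by [].
Qed.

Let NZ j k f : dom j f -> N j (k *: f) = k * N j f.
Proof.
move=> f1; rewrite -[_ *: _]addr0 Nlin// ?N0 ?addr0//; apply: dom_cone; exact: cone0.
Qed.

Let NN j f : dom j f -> N j (- f) = - N j f.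
Proof. by move=> f1; rewrite -scaleN1r NZ// mulN1r. Qed.

Let PD j f g : dom j f -> dom j g -> P j (f + g) = P j f + P j g.
Proof. by move=> f1 g1; rewrite -[f]scale1r Plin// !scale1r. Qed.

Let P0 j : P j 0 = 0.
Proof.
have d0 : dom j 0 by apply: dom_cone; exact: cone0.
have := PD d0 d0; rewrite addr0 -{1}[P j 0]addr0 => /addrI/esym.
by [].
Qed.

Let PZ j k f : dom j f -> P j (k *: f) = k *: P j f.
Proof.
move=> f1; rewrite -[_ *: _]addr0 Plin// ?P0 ?addr0//; apply: dom_cone; exact: cone0.
Qed.

Let PN j f : dom j f -> P j (- f) = - P j f.
Proof. by move=> f1; rewrite -scaleN1r PZ// scaleN1r. Qed.

(** Since [N j f = 0], both a h + f and a h - f have mass [a], so [P_cone] removes the same multiple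
    [kappa j * a] of [h j.+1] from each. *)
Lemma dominated_P j a f : N j f = 0 -> dominated j a f ->
  dominated j.+1 ((1 - kappa j) * a) (P j f).
Proof.
move=> Nf0 fa; have df := dominated_dom fa; case: fa => f1 f2; split.
  have := P_cone f1; rewrite ND// ?NZ ?Nf0 ?addr0// ?N_h ?PD ?PZ ?P_h//; try exact: domZ.
  by congr C; apply/funext => x; rewrite !fct_pointwise; ring.
have := P_cone f2; rewrite ND ?NN ?NZ ?Nf0 ?subr0// ?N_h ?PD ?PN ?PZ ?P_h//; try exact: domZ; try exact: domN.
by congr C; apply/funext => x; rewrite !fct_pointwise; ring.
Qed.

Section Multiplier.
Variables (g : R -> R) (K : R).
Hypothesis K0 : 0 <= K.
Hypothesis glip : forall y z, `|y| <= s -> `|z| <= s -> `|g y - g z| <= K * `|y - z|.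
Hypothesis gle : forall y, `|y| <= s -> `|g y| <= K * `|y|.

(** Put f1 = a h + f and f2 = a h - f. Half the sum of K c P f1 + P (g f1) and K c P f2 - P (g f2)
    equals K c a h + P (g f), as the terms in P (g h) cancel. The opposite signs give the other
    inequality, so the cone property is applied to [g] and to [- g]. *)
Lemma dominated_P_mul j a f : dominated j a f ->
  dominated j.+1 (K * c j * a) (P j ((g \o u j) * f)).
Proof.
move=> fa; have df := dominated_dom fa; case: fa => f1 f2.
have g2lip y z : `|y| <= s -> `|z| <= s -> `|- g y - - g z| <= K * `|y - z|.
  by move=> ys zs; rewrite opprK addrC distrC glip.
have g2le y : `|y| <= s -> `|- g y| <= K * `|y| by move=> ys; rewrite normrN gle.
have dm f' : dom j f' -> dom j ((g \o u j) * f').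
  by move=> ?; exact: (dom_mul K0).
have gN f' : ((fun y => - g y) \o u j) * f' = - ((g \o u j) * f').
  by apply/funext => x; rewrite !fct_pointwise /=; ring.
have H f' : C j f' -> C j.+1 ((K * c j) *: P j f' + P j ((g \o u j) * f')) /\
   C j.+1 ((K * c j) *: P j f' - P j ((g \o u j) * f')).
  move=> Cf'; split; first exact: P_mul_cone.
  have := @P_mul_cone j (fun y => - g y) K f' K0 g2lip g2le Cf'.
  by rewrite gN PN//; apply: dm; exact: dom_cone.
have [h1 h2] := H _ f1; have [h3 h4] := H _ f2.
have ah : dom j (a *: h j) by exact: domZ.
have nf := domN df.
have E1 : P j (a *: h j + f) = a *: h j.+1 + P j f by rewrite PD// PZ// P_h.
have E2 : P j (a *: h j - f) = a *: h j.+1 - P j f by rewrite PD// PN// PZ// P_h.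
have dgf := dm _ df; have dgh := dm _ ah.
have E3 : P j ((g \o u j) * (a *: h j + f)) =
   P j ((g \o u j) * (a *: h j)) + P j ((g \o u j) * f).
  by rewrite mulrDr PD.
have E4 : P j ((g \o u j) * (a *: h j - f)) =
   P j ((g \o u j) * (a *: h j)) - P j ((g \o u j) * f).
  by rewrite mulrDr mulrN PD ?PN//; exact: domN.
have half0 : 0 <= 1/2 :> R by lra.
split.
  have := coneZ half0 (coneD h1 h4); rewrite E1 E2 E3 E4.
  by congr C; apply/funext => x; rewrite !fct_pointwise; by field.
have := coneZ half0 (coneD h2 h3); rewrite E1 E2 E3 E4.
by congr C; apply/funext => x; rewrite !fct_pointwise; by field.
Qed.

End Multiplier.

(** The masses of a h + f and a h - f add up to 2 a, which removes [N j f] from the bound. *)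
Lemma dominated_N_mul j (g : R -> R) K L a f : 0 <= K -> 0 <= L ->
  (forall y z, `|y| <= s -> `|z| <= s -> `|g y - g z| <= L * `|y - z|) ->
  (forall y, `|y| <= s -> `|g y| <= K * `|y|) ->
  dominated j a f -> `|N j ((g \o u j) * f)| <= K * S j * a.
Proof.
move=> K0 L0 glip gle fa; have df := dominated_dom fa; case: fa => f1 f2.
have dm f' : dom j f' -> dom j ((g \o u j) * f').
  by move=> ?; exact: (dom_mul L0).
have h1 := N_mul_cone K0 L0 glip gle f1; have h2 := N_mul_cone K0 L0 glip gle f2.
have ah : dom j (a *: h j) by exact: domZ.
have nf := domN df.
have dgf := dm _ df; have dgh := dm _ ah.
move: h1 h2; rewrite !mulrDr mulrN !ND ?NN ?NZ ?N_h//; try exact: domN.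
rewrite !ler_norml => /andP[h1 h2] /andP[h3 h4]; apply/andP; split; lra.
Qed.

(** The phase [x] carries exp (i t S_j) through real functions: the shift by - pi / 2 stands for
    multiplication by i. Real cones are then enough, and bounds uniform in [x] treat the real and
    imaginary parts together. *)
Fixpoint fwd t j x : X -> R :=
  if j is j'.+1 then
    P j' (((fun y => cos (t * y)) \o u j') * fwd t j' x +
          ((fun y => sin (t * y)) \o u j') * fwd t j' (x - pi / 2))
  else cos x *: h 0.

(** In the application this is the image of S_j h_0 under P_{j-1} ... P_0, that is, [h j] times the
    conditional mean of S_j given the point reached at time j. *)
Fixpoint psum j : X -> R :=
  if j is j'.+1 then P j' (psum j' + u j' * h j') else 0.

(* The increment Var S_{j+1} - Var S_j: psum j is the first order coefficient in t of
   the push-forward, which carries the correlations of u_j with its past. *)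
Definition var_step j : R := N j ((u j * u j) * h j) + 2 * N j (u j * psum j).

Let s0 : 0 <= s. Proof. by move: s_ge1; lra. Qed.

Let A0 : 0 <= A. Proof. exact: le_trans s0 s_le_A. Qed.

Let id_lip (y z : R) : `|y| <= s -> `|z| <= s -> `|id y - id z| <= 1 * `|y - z|.
Proof. by rewrite mul1r. Qed.

Let id_le (y : R) : `|y| <= s -> `|id y| <= 1 * `|y|.
Proof. by rewrite mul1r. Qed.

Let sqr_lip (y z : R) : `|y| <= s -> `|z| <= s ->
  `|y * y - z * z| <= (2 * s) * `|y - z|.
Proof.
move=> ys zs; rewrite (_ : y * y - z * z = (y + z) * (y - z)); last by ring.
rewrite normrM ler_wpM2r// (le_trans (ler_normD _ _))//; lra.
Qed.

Let sqr_le (y : R) : `|y| <= s -> `|y * y| <= s * `|y|.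
Proof. by move=> ys; rewrite normrM ler_wpM2r. Qed.

(** The bound does not grow with j: a step gives (1 - kappa) A + c <= A because c <= A kappa. This
    is where the decay of correlations enters. *)
Lemma dominated_psum j : dominated j A (psum j) /\ N j (psum j) = 0.
Proof.
elim: j => [|j [IH1 IH2]].
  split; last exact: N0.
  split; rewrite ?addr0 ?subr0; exact: coneZ.
have du := dominated_P_mul ler01 id_lip id_le (dominated_h j).
have duh : dom j (u j * h j) := dom_mul ler01 id_lip (dom_h j).
have dp := dominated_dom IH1.
split; last by rewrite /= N_P ?ND ?IH2 ?N_uh ?addr0//; exact: domD.
rewrite /= PD//; apply: (dominated_le _ (dominatedD (dominated_P IH2 IH1) du)).
by have := c_le j; lra.
Qed.

Section FixedFrequency.
Variable t : R.
(** The value 1/16 gives 16 A |t| <= 1, so that the remainder [W] stays below the main term in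
    [dominated_F]; it also makes t^2 |var_step| / 2 at most [kappa j / 100], see [y_kappa]. *)
Hypothesis tA : `|t| * A <= 1 / 16.

Let tau := `|t|.
Let tau0 : 0 <= tau. Proof. exact: normr_ge0. Qed.
Let taus : tau * s <= 1 / 16.
Proof. by apply: le_trans tA; rewrite ler_wpM2l. Qed.

Let norm_t (y : R) : `|t * y| = tau * `|y|. Proof. exact: normrM. Qed.

Let sin_lip (y z : R) : `|y| <= s -> `|z| <= s ->
  `|sin (t * y) - sin (t * z)| <= tau * `|y - z|.
Proof. by move=> _ _; rewrite -norm_t mulrBr sin_lipschitz. Qed.

Let sin_le (y : R) : `|y| <= s -> `|sin (t * y)| <= tau * `|y|.
Proof. by move=> _; rewrite -norm_t sin_norm_le. Qed.

Let cos_lip (y z : R) : `|y| <= s -> `|z| <= s ->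
  `|cos (t * y) - cos (t * z)| <= tau * `|y - z|.
Proof. by move=> _ _; rewrite -norm_t mulrBr cos_lipschitz. Qed.

Let cosB_lip (y z : R) : `|y| <= s -> `|z| <= s ->
  `|(cos (t * y) - 1) - (cos (t * z) - 1)| <= (tau ^+ 2 * s) * `|y - z|.
Proof.
move=> ys zs; rewrite (_ : _ - _ - _ = cos (t * y) - cos (t * z)); last by ring.
have := @cos_lipschitz_small _ (tau * s) (t * y) (t * z).
rewrite -mulrBr !norm_t => H; apply: le_trans (H _ _) _; rewrite ?ler_wpM2l//.
by rewrite le_eqVlt; apply/orP; left; apply/eqP; ring.
Qed.

Let cosB_le (y : R) : `|y| <= s -> `|cos (t * y) - 1| <= (tau ^+ 2 * s) * `|y|.
Proof.
move=> ys; apply: le_trans (cosB1_norm_le_sqr _) _; rewrite norm_t exprMn -mulrA.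
by rewrite ler_wpM2l// ?exprn_ge0// expr2 ler_wpM2r.
Qed.

Let cosB_le1 (y : R) : `|y| <= s -> `|cos (t * y) - 1| <= tau * `|y|.
Proof. by move=> _; rewrite -norm_t cosB1_norm_le. Qed.

Let cosB_lip1 (y z : R) : `|y| <= s -> `|z| <= s ->
  `|(cos (t * y) - 1) - (cos (t * z) - 1)| <= tau * `|y - z|.
Proof.
move=> ys zs; rewrite (_ : _ - _ - _ = cos (t * y) - cos (t * z)); last by ring.
exact: cos_lip.
Qed.

Let sinB_lip (y z : R) : `|y| <= s -> `|z| <= s ->
  `|(sin (t * y) - t * y) - (sin (t * z) - t * z)| <= (tau ^+ 2 * s) * `|y - z|.
Proof.
move=> ys zs.
have := @sinB_lipschitz_small _ (tau * s) (t * y) (t * z).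
rewrite -mulrBr !norm_t => H; apply: le_trans (H _ _) _; rewrite ?ler_wpM2l//.
by rewrite le_eqVlt; apply/orP; left; apply/eqP; ring.
Qed.

Let sinB_le (y : R) : `|y| <= s -> `|sin (t * y) - t * y| <= (tau ^+ 2 * s) * `|y|.
Proof.
move=> ys; apply: le_trans (sinB_norm_le_sqr _) _; rewrite norm_t exprMn -mulrA.
by rewrite ler_wpM2l// ?exprn_ge0// expr2 ler_wpM2r.
Qed.

Let K3_le (y : R) : `|y| <= s -> `|t * y| ^+ 3 <= (tau ^+ 3 * s ^+ 2) * `|y|.
Proof.
move=> ys; rewrite norm_t exprMn -mulrA ler_wpM2l ?exprn_ge0//.
by rewrite exprSr ler_wpM2r// lerXn2r// nnegrE.
Qed.

Let F : nat -> R -> X -> R := fwd t.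
Let phi j x := N j (F j x).
(* W and Rm are the remainders of order 0 and 1 in t of the expansion
   F x = phi x *: h + t phi (x - pi / 2) *: psum + O(t^2). *)
Let W j x : X -> R := F j x - phi j x *: h j.
Let Rm j x : X -> R := W j x - (t * phi j (x - pi / 2)) *: psum j.
Let cos1 (y : R) := cos (t * y) - 1.
Let sin1 (y : R) := sin (t * y) - t * y.
Let tau2s : 0 <= tau ^+ 2 * s. Proof. by rewrite mulr_ge0 ?exprn_ge0. Qed.

Let dom_arg j x : dom j (F j x) -> dom j (F j (x - pi / 2)) ->
  dom j (((fun y => cos (t * y)) \o u j) * F j x) /\
  dom j (((fun y => sin (t * y)) \o u j) * F j (x - pi / 2)).
Proof.
by move=> d1 d2; split; [exact: (dom_mul tau0 cos_lip)|exact: (dom_mul tau0 sin_lip)].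
Qed.

Let dom_F j x : dom j (F j x).
Proof.
elim: j x => [|j IH] x; first by exact: domZ.
have [d1 d2] := dom_arg (IH x) (IH _).
by apply: dom_P; exact: domD.
Qed.

Let F_shift2 j x : F j (x - pi / 2 - pi / 2) = - F j x.
Proof.
have E y : y - pi / 2 - pi / 2 = y - pi :> R by field.
elim: j x => [|j IH] x.
  by rewrite /F /= E cosB cospi sinpi mulrN1 mulr0 addr0 scaleNr.
have [d1 d2] := dom_arg (dom_F j x) (dom_F j _).
rewrite /F /= -/F IH IH !mulrN -opprD PN//; exact: domD.
Qed.

Let phi_shift2 j x : phi j (x - pi / 2 - pi / 2) = - phi j x.
Proof. by rewrite /phi F_shift2 NN. Qed.

Let dom_W j x : dom j (W j x).
Proof. by apply: domD => //; apply: domN; exact: domZ. Qed.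

Let N_W j x : N j (W j x) = 0.
Proof. by rewrite ND ?NN ?NZ ?N_h ?mulr1 ?subrr//; [exact: domZ|apply: domN; exact: domZ]. Qed.

Let dom_psum j : dom j (psum j).
Proof. by have [/dominated_dom] := dominated_psum j. Qed.

Let N_psum j : N j (psum j) = 0.
Proof. by have [] := dominated_psum j. Qed.

Let dom_R j x : dom j (Rm j x).
Proof. by apply: domD => //; apply: domN; exact: domZ. Qed.

Let N_R j x : N j (Rm j x) = 0.
Proof.
by rewrite ND ?NN ?NZ ?N_psum ?N_W ?mulr0 ?subrr//; [exact: domZ|apply: domN; exact: domZ].
Qed.

Let dom_cosB j f : dom j f -> dom j ((cos1 \o u j) * f).
Proof. exact: (dom_mul tau0 cosB_lip1). Qed.

Let dom_sin j f : dom j f -> dom j (((fun y => sin (t * y)) \o u j) * f).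
Proof. exact: (dom_mul tau0 sin_lip). Qed.

Let dom_sinB j f : dom j f -> dom j ((sin1 \o u j) * f).
Proof. exact: (dom_mul tau2s sinB_lip). Qed.

Let dom_u j f : dom j f -> dom j (u j * f).
Proof. exact: (dom_mul ler01 id_lip). Qed.

Let dom_uu j f : dom j f -> dom j ((u j * u j) * f).
Proof.
have ts : 0 <= 2 * s by rewrite mulr_ge0.
exact: (dom_mul ts sqr_lip).
Qed.

Let phiS j x : phi j.+1 x = phi j x + N j ((cos1 \o u j) * F j x) +
  N j (((fun y => sin (t * y)) \o u j) * F j (x - pi / 2)).
Proof.
have [d1 d2] := dom_arg (dom_F j x) (dom_F j _).
rewrite {1}/phi /F /= -/F N_P; last exact: domD.
rewrite ND//; congr (_ + _).
rewrite /phi -ND//; last exact: dom_cosB.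
by congr N; apply/funext => z; rewrite !fct_pointwise /= /cos1; ring.
Qed.

Let sin_split j f : ((fun y => sin (t * y)) \o u j) * f =
  (sin1 \o u j) * f + t *: (u j * f).
Proof. by apply/funext => z; rewrite !fct_pointwise /= /sin1; ring. Qed.

(** By centring only [W], which is O(t), contributes: the term of [phiS] that looks linear in t is
    in fact of order t^2. *)
Let N_uF j x : N j (u j * F j x) = N j (u j * W j x).
Proof.
have -> : F j x = W j x + phi j x *: h j by rewrite /W subrK.
rewrite mulrDr ND; last 2 first.
- exact: dom_u.
- by apply: dom_u; exact: domZ.
rewrite fct_mulZr NZ ?N_uh ?mulr0 ?addr0//; first exact: dom_u.
Qed.

Let phiS2 j x : phi j.+1 x = phi j x + N j ((cos1 \o u j) * F j x) +
  N j ((sin1 \o u j) * F j (x - pi / 2)) + t * N j (u j * W j (x - pi / 2)).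
Proof.
rewrite phiS sin_split ND ?NZ ?N_uF ?addrA//; try exact: dom_u.
- exact: dom_sinB.
- by apply: domZ; exact: dom_u.
Qed.

Let PF j x : P j (F j x) = P j (W j x) + phi j x *: h j.+1.
Proof. by rewrite -P_h -PZ// -PD//; [rewrite /W subrK|exact: domZ]. Qed.

Let F_step j x : F j.+1 x = P j (F j x) + P j ((cos1 \o u j) * F j x) +
  P j (((fun y => sin (t * y)) \o u j) * F j (x - pi / 2)).
Proof.
rewrite -PD//; last exact: dom_cosB.
rewrite -PD; last 2 first.
- by apply: domD => //; exact: dom_cosB.
- exact: dom_sin.
rewrite /F /= -/F; congr P; congr (_ + _).
by apply/funext => z; rewrite !fct_pointwise /= /cos1; ring.
Qed.

Let WS j x : W j.+1 x = P j (W j x) + P j ((cos1 \o u j) * F j x) +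
  P j (((fun y => sin (t * y)) \o u j) * F j (x - pi / 2)) +
  (phi j x - phi j.+1 x) *: h j.+1.
Proof.
rewrite {1}/W F_step PF; apply/funext => z; rewrite !fct_pointwise; ring.
Qed.

Let psumS j : psum j.+1 = P j (psum j) + P j (u j * h j).
Proof. by rewrite /= PD//; exact: dom_u. Qed.

Let P_uF j x : P j (u j * F j x) = P j (u j * W j x) + phi j x *: P j (u j * h j).
Proof.
rewrite -PZ; last exact: dom_u.
rewrite -PD; last 2 first.
- exact: dom_u.
- by apply: domZ; exact: dom_u.
congr P; apply/funext => z; rewrite /W !fct_pointwise; ring.
Qed.

Let P_W j x : P j (W j x) = P j (Rm j x) + (t * phi j (x - pi / 2)) *: P j (psum j).
Proof. by rewrite -PZ// -PD//; [rewrite /Rm subrK|exact: domZ]. Qed.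

Let RS j x : Rm j.+1 x = P j (Rm j x)
  + (- (t * (phi j.+1 (x - pi / 2) - phi j (x - pi / 2)))) *: psum j.+1
  + t *: P j (u j * W j (x - pi / 2))
  + P j ((sin1 \o u j) * F j (x - pi / 2)) + P j ((cos1 \o u j) * F j x)
  + (phi j x - phi j.+1 x) *: h j.+1.
Proof.
rewrite {1}/Rm WS sin_split (@PD j ((sin1 \o u j) * _)); last 2 first.
- exact: dom_sinB.
- by apply: domZ; exact: dom_u.
rewrite PZ; last exact: dom_u.
rewrite P_uF P_W psumS; apply/funext => z; rewrite !fct_pointwise; ring.
Qed.

Section Step.
Variables (j : nat) (b b' : R).
Hypothesis b0 : 0 <= b.
Hypothesis phib : forall x, `|phi j x| <= b.
Hypothesis Wb : forall x, dominated j (16 * A * tau * b) (W j x).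
Hypothesis Rb : forall x, dominated j (84 * A ^+ 2 * tau ^+ 2 * b) (Rm j x).
Hypothesis bb' : (1 - kappa j / 2) * b <= b'.

Let At : 16 * A * tau <= 1. Proof. by move: tA; rewrite -/tau; lra. Qed.

Let dominated_F x : dominated j (2 * b) (F j x).
Proof.
have -> : F j x = phi j x *: h j + W j x by rewrite /W addrC subrK.
apply: (dominated_le _ (dominatedD (dominatedZ (phi j x) (dominated_h j)) (Wb x))).
have : 16 * A * tau * b <= 1 * b by rewrite ler_wpM2r.
by have := phib x; lra.
Qed.

Let dphi1 x : `|phi j.+1 x - phi j x| <= 4 * tau * S j * b.
Proof.
have h1 := dominated_N_mul tau0 tau0 cosB_lip1 cosB_le1 (dominated_F x).
have h2 := dominated_N_mul tau0 tau0 sin_lip sin_le (dominated_F (x - pi / 2)).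
rewrite phiS (_ : forall y z w : R, y + z + w - y = z + w) => [|y z w]; last by ring.
by apply: le_trans (ler_normD_le h1 h2) _; lra.
Qed.

(** Centring, through [phiS2], gains the factor A |t| over [dphi1]. The constant is 2 + 2 + 16, with
    16 inherited from the bound on [W]. *)
Let dphi2 x : `|phi j.+1 x - phi j x| <= 20 * A * tau ^+ 2 * S j * b.
Proof.
have -> : phi j.+1 x - phi j x = N j ((cos1 \o u j) * F j x) +
  N j ((sin1 \o u j) * F j (x - pi / 2)) + t * N j (u j * W j (x - pi / 2)).
  by rewrite phiS2; move: (phi j x) => y; ring.
have h1 := dominated_N_mul tau2s tau2s cosB_lip cosB_le (dominated_F x).
have h2 := dominated_N_mul tau2s tau2s sinB_lip sinB_le (dominated_F (x - pi / 2)).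
have h3 := dominated_N_mul ler01 ler01 id_lip id_le (Wb (x - pi / 2)).
have h4 : `|t * N j (u j * W j (x - pi / 2))| <= tau * (S j * (16 * A * tau * b)).
  by rewrite normrM ler_wpM2l// -[S j]mul1r.
apply: le_trans (ler_normD_le (ler_normD_le h1 h2) h4) _.
have : tau ^+ 2 * S j * b * s <= tau ^+ 2 * S j * b * A.
  by rewrite ler_wpM2l// !mulr_ge0// exprn_ge0.
lra.
Qed.

Let k1 : 0 <= kappa j. Proof. by have /andP[] := kappa01 j. Qed.
Let c0 : 0 <= c j. Proof. exact: le_trans (S_ge0 j) (S_le_c j). Qed.
Let m0 : 0 <= tau ^+ 2 * b. Proof. by rewrite mulr_ge0// exprn_ge0. Qed.

(** The new terms contribute (2 + 2 + 4) tau b c <= 8 A tau b kappa, half of what the contraction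
    gains on 16 A tau b; the other half is what [bb'] asks for. This is the origin of 16. *)
Lemma W_step x : dominated j.+1 (16 * A * tau * b') (W j.+1 x).
Proof.
rewrite WS.
have h1 := dominated_P (N_W j x) (Wb x).
have h2 := dominated_P_mul tau0 cosB_lip1 cosB_le1 (dominated_F x).
have h3 := dominated_P_mul tau0 sin_lip sin_le (dominated_F (x - pi / 2)).
have h4 := dominatedZ (phi j x - phi j.+1 x) (dominated_h j.+1).
apply: dominated_le (dominatedD (dominatedD (dominatedD h1 h2) h3) h4).
rewrite distrC mulr1; have h5 := dphi1 x.
have h6 : tau * b * S j <= tau * b * c j by rewrite ler_wpM2l// mulr_ge0.
have h7 : tau * b * c j <= tau * b * (A * kappa j) by rewrite ler_wpM2l// mulr_ge0.
have h8 : 16 * A * tau * ((1 - kappa j / 2) * b) <= 16 * A * tau * b'.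
  by rewrite ler_wpM2l// !mulr_ge0.
move: h5 h6 h7 h8; lra.
Qed.

(** As in [W_step] the constant is twice the cost of the new terms: 5/4 + 16 + 2 + 2 + 20 <= 42 in
    units of A^2 tau^2 b kappa. The summand 5/4 is 20 tau A with tau A <= 1/16. *)
Lemma R_step x : dominated j.+1 (84 * A ^+ 2 * tau ^+ 2 * b') (Rm j.+1 x).
Proof.
rewrite RS.
have h1 := dominated_P (N_R j x) (Rb x).
have h2 := dominatedZ (- (t * (phi j.+1 (x - pi / 2) - phi j (x - pi / 2)))) (dominated_psum j.+1).1.
have h3 := dominatedZ t (dominated_P_mul ler01 id_lip id_le (Wb (x - pi / 2))).
have h4 := dominated_P_mul tau2s sinB_lip sinB_le (dominated_F (x - pi / 2)).
have h5 := dominated_P_mul tau2s cosB_lip cosB_le (dominated_F x).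
have h6 := dominatedZ (phi j x - phi j.+1 x) (dominated_h j.+1).
apply: dominated_le (dominatedD (dominatedD (dominatedD (dominatedD (dominatedD h1 h2) h3) h4) h5) h6).
rewrite normrN normrM -/tau !(distrC (phi j _)) !mulr1 !mul1r.
have e1 := dphi2.
have e2 : tau * `|phi j.+1 (x - pi / 2) - phi j (x - pi / 2)| * A <=
    tau * (20 * A * tau ^+ 2 * S j * b) * A.
  by rewrite ler_wpM2r// ler_wpM2l// e1.
have q0 : 0 <= tau ^+ 2 * b * A by rewrite mulr_ge0.
have e3 : tau ^+ 2 * b * A * S j * (tau * A) <= tau ^+ 2 * b * A * S j * (1 / 16).
  by rewrite ler_wpM2l// mulr_ge0.
have e4 : tau ^+ 2 * b * A * S j <= tau ^+ 2 * b * A * c j by rewrite ler_wpM2l.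
have e5 : tau ^+ 2 * b * A * c j <= tau ^+ 2 * b * A * (A * kappa j) by rewrite ler_wpM2l.
have e6 : tau ^+ 2 * b * c j * s <= tau ^+ 2 * b * c j * A by rewrite ler_wpM2l// mulr_ge0.
have e7 : 84 * A ^+ 2 * tau ^+ 2 * ((1 - kappa j / 2) * b) <= 84 * A ^+ 2 * tau ^+ 2 * b'.
  by rewrite ler_wpM2l// !mulr_ge0// exprn_ge0.
have e8 : 0 <= tau ^+ 2 * b * A * (A * kappa j) by rewrite !mulr_ge0.
move: (e1 x) e2 e3 e4 e5 e6 e7 e8; rewrite !expr2 => *; lra.
Qed.

Let cos2 (y : R) := cos (t * y) - 1 + (t * y) ^+ 2 / 2.

Let v := var_step j.

Let phi_expand x : phi j.+1 x = phi j x * (1 - t ^+ 2 * v / 2) +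
  (N j ((cos2 \o u j) * F j x) - t ^+ 2 / 2 * N j ((u j * u j) * W j x) +
   N j ((sin1 \o u j) * F j (x - pi / 2)) + t * N j (u j * Rm j (x - pi / 2))).
Proof.
have d1 : dom j ((u j * u j) * F j x) by exact: dom_uu.
have d2 := dom_cosB (dom_F j x).
have -> : N j ((cos2 \o u j) * F j x) =
    N j ((cos1 \o u j) * F j x) + t ^+ 2 / 2 * N j ((u j * u j) * F j x).
  rewrite -NZ// -ND//; last exact: domZ.
  by congr N; apply/funext => z; rewrite !fct_pointwise /= /cos2 /cos1; field.
have -> : N j ((u j * u j) * F j x) =
    N j ((u j * u j) * W j x) + phi j x * N j ((u j * u j) * h j).
  rewrite -NZ; last exact: dom_uu.
  rewrite -ND; last 2 first.
  - exact: dom_uu.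
  - by apply: domZ; exact: dom_uu.
  by congr N; apply/funext => z; rewrite /W !fct_pointwise; ring.
rewrite phiS2.
(* At phase x - pi / 2 the first order term of [W] carries phi (x - pi) = - phi x. Multiplied by t
   it yields - t^2 phi N (u psum), the correlation part of [var_step]. *)
have -> : N j (u j * W j (x - pi / 2)) = N j (u j * Rm j (x - pi / 2)) -
    t * phi j x * N j (u j * psum j).
  have -> : W j (x - pi / 2) = Rm j (x - pi / 2) - (t * phi j x) *: psum j.
    by rewrite /Rm phi_shift2 mulrN scaleNr opprK addrK.
  rewrite mulrBr fct_mulZr ND; last 2 first.
  - exact: dom_u.
  - by apply: domN; apply: domZ; exact: dom_u.
  rewrite NN ?NZ//; [exact: dom_u|by apply: domZ; exact: dom_u].
rewrite /v /var_step; move: (phi j x) (N _ _) (N _ _) (N _ _) (N _ _) (N _ _) => *.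
by field.
Qed.

Let cos2_le (y : R) : `|y| <= s -> `|cos2 y| <= tau ^+ 3 * s ^+ 2 * `|y|.
Proof. by move=> ys; apply: le_trans (cos_taylor2_norm_le_cube _) _; exact: K3_le. Qed.

Let sin1_le (y : R) : `|y| <= s -> `|sin1 y| <= tau ^+ 3 * s ^+ 2 * `|y|.
Proof. by move=> ys; apply: le_trans (sinB_norm_le_cube _) _; exact: K3_le. Qed.

(** The constant is 2 + 8 + 2 + 84, one summand for each remainder in [phi_expand]. As [N] charges
    the last factor [u j] only with [S j <= s], the bound is s A^2 and not A^3, which is worth
    n^(2/p) in the end. *)
Lemma phi_step x : `|phi j.+1 x - phi j x * (1 - t ^+ 2 * v / 2)| <=
  96 * tau ^+ 3 * s * A ^+ 2 * b.
Proof.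
have K0 : 0 <= tau ^+ 3 * s ^+ 2 by rewrite mulr_ge0 ?exprn_ge0.
rewrite phi_expand addrC addKr.
have cos2_lip (y z : R) : `|y| <= s -> `|z| <= s ->
    `|cos2 y - cos2 z| <= 2 * (tau ^+ 2 * s) * `|y - z|.
  move=> ys zs; rewrite (_ : cos2 y - cos2 z = ((cos (t * y) - 1) - (cos (t * z) - 1))
    + (t ^+ 2 / 2) * (y * y - z * z)); last by rewrite /cos2; field.
  apply: le_trans (ler_normD_le (cosB_lip ys zs) (lexx _)) _.
  have := sqr_lip ys zs; rewrite normrM.
  have -> : `|t ^+ 2 / 2| = tau ^+ 2 / 2.
    by rewrite ger0_norm ?divr_ge0 ?sqr_ge0// /tau real_normK ?num_real.
  move=> le2; have := ler_wpM2l (_ : 0 <= tau ^+ 2 / 2) le2.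
  by move=> /(_ ltac:(by rewrite divr_ge0 ?exprn_ge0)); move: (tau ^+ 2) => *; lra.
have h1 : `|N j ((cos2 \o u j) * F j x)| <= tau ^+ 3 * s ^+ 2 * S j * (2 * b).
  by apply: (dominated_N_mul K0 _ cos2_lip cos2_le (dominated_F x)); rewrite mulr_ge0.
have h2 : `|N j ((u j * u j) * W j x)| <= s * S j * (16 * A * tau * b).
  by apply: (dominated_N_mul s0 _ sqr_lip sqr_le (Wb x)); rewrite mulr_ge0.
have h3 := dominated_N_mul K0 tau2s sinB_lip sin1_le (dominated_F (x - pi / 2)).
have h4 := dominated_N_mul ler01 ler01 id_lip id_le (Rb (x - pi / 2)).
have h2' : `|- (t ^+ 2 / 2 * N j ((u j * u j) * W j x))| <=
    tau ^+ 2 / 2 * (s * S j * (16 * A * tau * b)).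
  have t2 : t ^+ 2 = tau ^+ 2 by rewrite /tau real_normK ?num_real.
  have t20 : 0 <= tau ^+ 2 / 2 by rewrite divr_ge0 ?exprn_ge0.
  by rewrite normrN normrM t2 (ger0_norm t20) ler_wpM2l.
have h4' : `|t * N j (u j * Rm j (x - pi / 2))| <=
    tau * (1 * S j * (84 * A ^+ 2 * tau ^+ 2 * b)) by rewrite normrM ler_wpM2l.
apply: le_trans (ler_normD_le (ler_normD_le (ler_normD_le h1 h2') h3) h4') _.
have q0 : 0 <= tau ^+ 3 * b by rewrite mulr_ge0 ?exprn_ge0.
have sA : s * S j <= s * s by rewrite ler_wpM2l.
have e1 : tau ^+ 3 * b * (s ^+ 2 * S j) <= tau ^+ 3 * b * (s * A ^+ 2).
  rewrite ler_wpM2l// mulrC ler_pM ?exprn_ge0//.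
  by rewrite lerXn2r// nnegrE.
have e2 : tau ^+ 3 * b * (s * S j * A) <= tau ^+ 3 * b * (s * A ^+ 2).
  rewrite ler_wpM2l// -mulrA ler_wpM2l// expr2 ler_wpM2r//.
  exact: le_trans (S_le_s j) s_le_A.
have e3 : tau ^+ 3 * b * (S j * A ^+ 2) <= tau ^+ 3 * b * (s * A ^+ 2).
  by rewrite ler_wpM2l// ler_wpM2r ?exprn_ge0.
move: e1 e2 e3; rewrite !exprS !expr0 => *; lra.
Qed.

Let v_le : `|v| <= 3 * A * S j.
Proof.
have h1 : `|N j ((u j * u j) * h j)| <= s * S j * 1.
  by apply: (dominated_N_mul s0 _ sqr_lip sqr_le (dominated_h j)); rewrite mulr_ge0.
have h2 := dominated_N_mul ler01 ler01 id_lip id_le (dominated_psum j).1.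
apply: le_trans (ler_normD_le h1 (_ : _ <= 2 * (S j * A))) _.
  by rewrite normrM ger0_norm// ler_wpM2l// -[S j]mul1r.
have : s * S j <= A * S j by rewrite ler_wpM2r.
lra.
Qed.

Let y := t ^+ 2 * v / 2.

Let y_le : `|y| <= 3 / 2 * tau ^+ 2 * A * S j.
Proof.
rewrite /y normrM normrM (ger0_norm (sqr_ge0 t)) (ger0_norm (_ : 0 <= 2^-1))//.
have -> : t ^+ 2 = tau ^+ 2 by rewrite /tau real_normK ?num_real.
have : tau ^+ 2 * `|v| <= tau ^+ 2 * (3 * A * S j) by rewrite ler_wpM2l ?exprn_ge0.
lra.
Qed.

Lemma y_kappa : `|y| <= kappa j / 100.
Proof.
apply: le_trans y_le _.
have e1 : tau ^+ 2 * A * S j <= tau ^+ 2 * A * (A * kappa j).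
  by rewrite ler_wpM2l ?mulr_ge0 ?exprn_ge0//; exact: le_trans (S_le_c j) (c_le j).
have e2 : (tau * A) * (tau * A) <= (1 / 16) * (1 / 16) by rewrite ler_pM// mulr_ge0.
have e3 : kappa j * ((tau * A) * (tau * A)) <= kappa j * ((1 / 16) * (1 / 16)).
  by rewrite ler_wpM2l.
move: e1 e3 k1; rewrite !expr2 => *; lra.
Qed.

Lemma y_sqr : y ^+ 2 * 2 <= tau ^+ 3 * s * A ^+ 2.
Proof.
have q : 0 <= 3 / 2 * tau ^+ 2 * A * S j by rewrite !mulr_ge0 ?exprn_ge0.
have e1 : `|y| * `|y| <= (3 / 2 * tau ^+ 2 * A * S j) * (3 / 2 * tau ^+ 2 * A * S j).
  by rewrite ler_pM.
have -> : y ^+ 2 = `|y| * `|y| by rewrite -expr2 real_normK ?num_real.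
have e2 : S j * S j <= s * s by rewrite ler_pM.
have q2 : 0 <= tau ^+ 3 * A ^+ 2 by rewrite mulr_ge0 ?exprn_ge0.
have e3 : (tau ^+ 3 * A ^+ 2) * (tau * (S j * S j)) <= (tau ^+ 3 * A ^+ 2) * (tau * (s * s)).
  by rewrite ler_wpM2l// ler_wpM2l.
have e4 : (tau ^+ 3 * A ^+ 2) * s * (tau * s) <= (tau ^+ 3 * A ^+ 2) * s * (1 / 16).
  by rewrite ler_wpM2l// mulr_ge0.
have q3 : 0 <= tau ^+ 3 * A ^+ 2 * s by rewrite mulr_ge0.
move: e1 e3 e4 q3; rewrite !exprS !expr0 => *; lra.
Qed.

End Step.

Theorem fwd_char_bound n x V : V = \sum_(i < n) var_step i ->
  `|N n (fwd t n x) - cos x * expR (- (t ^+ 2 * V / 2))| <=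
  expR (- (t ^+ 2 * V / 2)) * ((1 + 200 * `|t| ^+ 3 * s * A ^+ 2) ^+ n - 1).
Proof.
move=> ->.
set e := 200 * `|t| ^+ 3 * s * A ^+ 2.
have e0 : 0 <= e.
  have : 0 <= `|t| ^+ 3 * s * A ^+ 2 by rewrite !mulr_ge0 ?exprn_ge0.
  by rewrite /e; move: (`|t| ^+ 3) => r; lra.
pose E n := expR (- (t ^+ 2 * (\sum_(i < n) var_step i) / 2)).
pose b n := (1 + e) ^+ n * E n.
have E0 m : 0 < E m by exact: expR_gt0.
have b0 m : 0 <= b m by rewrite mulr_ge0 ?exprn_ge0// ?ltW//; lra.
suff [] : [/\ (forall x, `|phi n x - cos x * E n| <= E n * ((1 + e) ^+ n - 1)),
    (forall x, dominated n (16 * A * tau * b n) (W n x)) &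
    (forall x, dominated n (84 * A ^+ 2 * tau ^+ 2 * b n) (Rm n x))] by move=> H _ _; exact: H.
elim: n {x} => [|n [IH1 IH2 IH3]].
  have E00 : E 0%N = 1 by rewrite /E big_ord0 mulr0 mul0r oppr0 expR0.
  have phi0 x : phi 0%N x = cos x by rewrite /phi /F/= NZ// N_h mulr1.
  have W0 x : W 0%N x = 0 by rewrite /W phi0 /F/= subrr.
  have R0 x : Rm 0%N x = 0 by rewrite /Rm W0/= scaler0 subrr.
  have D0 a : 0 <= a -> dominated 0 a 0.
    by move=> a0; split; rewrite ?addr0 ?subr0; exact: coneZ.
  split => x.
  - by rewrite phi0 E00 mulr1 subrr normr0 expr0 subrr mulr0.
  - rewrite W0; apply: D0; apply: mulr_ge0 (b0 _); rewrite mulr_ge0//.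
    by rewrite mulr_ge0.
  - rewrite R0; apply: D0; apply: mulr_ge0 (b0 _).
    by rewrite mulr_ge0 ?exprn_ge0// mulr_ge0 ?exprn_ge0.
set y := t ^+ 2 * var_step n / 2.
have ES : E n.+1 = E n * expR (- y).
  by rewrite /E big_ord_recr/= -expRD; congr expR; rewrite /y; field.
have phib x : `|phi n x| <= b n.
  have h1 := ler_normD_le (IH1 x) (lexx `|cos x * E n|).
  rewrite subrK in h1; apply: le_trans h1 _.
  have : `|cos x| * E n <= 1 * E n by rewrite ler_wpM2r ?cos_max// ltW.
  rewrite normrM (gtr0_norm (E0 n)) /b; lra.
have yk : `|y| <= kappa n / 100 by exact: y_kappa.
have y2 : y ^+ 2 * 2 <= `|t| ^+ 3 * s * A ^+ 2 by exact: y_sqr.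
have /andP[k0 k1] := kappa01 n.
(* The variance increment of one step costs at most [kappa n / 100], so [b] decreases more slowly
   than [bb'] permits. *)
have y1 : 1 - kappa n / 100 <= expR (- y).
  have := expR_ge1Dx (- y); have := ler_norm y; lra.
have phis x := phi_step (b0 n) phib IH2 IH3 x.
have bS : (1 - kappa n / 2) * b n <= b n.+1.
  have -> : b n.+1 = (1 + e) * expR (- y) * b n.
    by rewrite /b ES exprS; ring.
  rewrite ler_wpM2r//; have := expR_ge0 (- y); nra.
split => [x|x|x]; last 2 first.
- exact: (W_step (b0 n) phib IH2 bS).
- exact: (R_step (b0 n) phib IH2 IH3 bS).
have y12 : `|y| <= 1 / 2 by move: yk; lra.
have h3 := expRN_taylor1_norm_le y12.
have h4 : `|phi n x * (expR (- y) - (1 - y))| <= b n * (y ^+ 2 * 2).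
  by rewrite normrM ler_pM.
have h5 : `|expR (- y) * (phi n x - cos x * E n)| <= expR (- y) * (E n * ((1 + e) ^+ n - 1)).
  by rewrite normrM (ger0_norm (expR_ge0 _)) ler_wpM2l// expR_ge0.
rewrite -normrN in h4.
have := ler_normD_le (ler_normD_le (phis x) h4) h5.
have -> : phi n.+1 x - phi n x * (1 - t ^+ 2 * var_step n / 2) +
    - (phi n x * (expR (- y) - (1 - y))) + expR (- y) * (phi n x - cos x * E n) =
    phi n.+1 x - cos x * E n.+1.
  by rewrite ES -/y; ring.
move=> /le_trans; apply.
(* Of the 97, 96 come from [phi_step] and 1 from replacing 1 - y by expR (- y). The 200 in [e]
   leaves room for expR (- y) >= 1/2. *)
have h6 : 97 * `|t| ^+ 3 * s * A ^+ 2 * b n <= expR (- y) * e * b n.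
  have : 97 * `|t| ^+ 3 * s * A ^+ 2 <= expR (- y) * e.
    have : (1 / 2) * e <= expR (- y) * e by rewrite ler_wpM2r//; move: y1; lra.
    have : 0 <= `|t| ^+ 3 * s * A ^+ 2 by rewrite !mulr_ge0// exprn_ge0.
    rewrite /e; lra.
  by move=> /(ler_wpM2r (b0 n)).
have h7 : b n * (y ^+ 2 * 2) <= b n * (`|t| ^+ 3 * s * A ^+ 2) by rewrite ler_wpM2l.
have -> : E n.+1 * ((1 + e) ^+ n.+1 - 1) =
    expR (- y) * e * b n + expR (- y) * (E n * ((1 + e) ^+ n - 1)).
  by rewrite ES /b exprS; ring.
by move: h6 h7; rewrite -/tau; lra.
Qed.

End FixedFrequency.
End ConeRecursion.

(** * Smoothing inequality *)

Section GaussianFourier.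
Context {R : realType}.
Implicit Types (a r s t x y : R).
Local Notation leb := (@lebesgue_measure R).
Local Notation pos := (`]0, +oo[%classic : set R).

(** The characteristic function at [r] of a centred normal law with standard deviation [a]. *)
Definition gaussw a r : R := expR (- ((a * r) ^+ 2 / 2)).

Lemma gaussw_gt0 a r : 0 < gaussw a r. Proof. exact: expR_gt0. Qed.

Lemma gaussw_ge0 a r : 0 <= gaussw a r. Proof. exact: expR_ge0. Qed.

Lemma gaussw_le1 a r : gaussw a r <= 1.
Proof. by rewrite -expR0 ler_expR oppr_le0 divr_ge0 ?sqr_ge0. Qed.

Lemma continuous_gaussw a : continuous (gaussw a).
Proof.
move=> x; apply: (@continuous_comp _ _ _ (fun r => - ((a * r) ^+ 2 / 2)) expR).
  apply: cvgN; apply: cvgM; last exact: cvg_cst.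
  apply: (@continuous_comp _ _ _ (fun r => a * r) (fun z => z ^+ 2)).
    by apply: cvgM; [exact: cvg_cst|exact: cvg_id].
  exact: exprn_continuous.
exact: continuous_expR.
Qed.

Lemma measurable_gaussw a : measurable_fun setT (gaussw a).
Proof. exact: continuous_measurable_fun (@continuous_gaussw a). Qed.

Lemma gausswE a : 0 < a -> gaussw a =
  (fun x => (normal_peak a^-1)^-1 * normal_pdf 0 a^-1 x).
Proof.
move=> a0; have aV : a^-1 != 0 by rewrite invr_neq0// gt_eqF.
apply/funext => x; rewrite normal_pdfE// mulrA mulVf ?mul1r; last first.
  by rewrite gt_eqF// normal_peak_gt0.
rewrite /gaussw /normal_fun subr0; congr expR.
by rewrite -mulr_natr; field; rewrite gt_eqF.
Qed.

Lemma integrable_gaussw a : 0 < a -> leb.-integrable setT (EFin \o gaussw a).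
Proof.
move=> a0; rewrite gausswE// (_ : _ \o _ = fun x =>
  ((normal_peak a^-1)^-1%:E * (normal_pdf 0 a^-1 x)%:E)%E).
  by apply: integrableZl => //; exact: integrable_normal_pdf.
by apply/funext => x /=; rewrite EFinM.
Qed.

Lemma integrable_gaussw_pos a : 0 < a -> leb.-integrable pos (EFin \o gaussw a).
Proof.
move=> a0; apply: (integrableS measurableT _ _ (integrable_gaussw a0)) => //.
Qed.

Lemma integral_gaussw a : 0 < a ->
  \int[leb]_(r in pos) gaussw a r = Num.sqrt (pi / 2) / a.
Proof.
move=> a0; have aV : a^-1 != 0 by rewrite invr_neq0// gt_eqF.
rewrite Rintegral_itv_obnd_cbnd; last exact: integrable_gaussw_pos.
have H : (\int[leb]_x (gaussw a x)%:E)%E = (Num.sqrt (2 * pi) / a)%:E.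
  under eq_integral do rewrite gausswE// EFinM.
  rewrite integralZl//; last exact: integrable_normal_pdf.
  rewrite integral_normal_pdf mule1 /normal_peak invrK; congr EFin.
  rewrite -mulrnAr sqrtrM ?sqr_ge0// sqrtr_sqr ger0_norm ?invr_ge0 ?ltW//.
  by rewrite mulrC -[pi *+ 2]mulr_natl.
move: H; rewrite ge0_symfun_integralT; last 3 first.
- exact: gaussw_ge0.
- exact: continuous_gaussw.
- by move=> x; rewrite /gaussw /= mulrN sqrrN.
have -> : [set x | 0 <= x] = `[0, +oo[%classic :> set R.
  by apply/seteqP; split => x /=; rewrite in_itv/= andbT.
move=> H.
have fi : (\int[leb]_(x in `[0%R, +oo[) (gaussw a x)%:E)%E \is a fin_num.
  apply: integrable_fin_num => //.
  by apply: (integrableS measurableT _ _ (integrable_gaussw a0)).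
have := congr1 fine H; rewrite fineM// /= -/(Rintegral _ _ _) => /(congr1 (fun z => z / 2)).
rewrite mulrAC mulfV// mul1r => ->.
rewrite (_ : 2 * pi = 2 ^+ 2 * (pi / 2)); last by field.
rewrite sqrtrM ?sqr_ge0// sqrtr_sqr ger0_norm//; field.
by rewrite gt_eqF.
Qed.

Lemma is_derive_Rintegral d (Y : measurableType d) (mu : {measure set Y -> \bar R})
    (B : set Y) (f df : R -> Y -> R) (g : Y -> R) s : measurable B ->
  (forall s, mu.-integrable B (EFin \o f s)) ->
  (forall s (z : Y), B z -> is_derive s (1 : R) (f ^~ z) (df s z)) ->
  (forall z : Y, 0 <= g z) ->
  mu.-integrable B (EFin \o g) ->
  (forall s (z : Y), B z -> `|df s z| <= g z) ->
  is_derive s (1 : R) (fun s => \int[mu]_(y in B) f s y) (\int[mu]_(y in B) df s y).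
Proof.
move=> mB intf dfE g0 intg dfg.
have I0 : `]s - 1, s + 1[%classic s by rewrite /= in_itv/=; apply/andP; split; lra.
have pE t (y : Y) : B y -> partial1of2 f t y = df t y.
  by move=> By; rewrite partial1of2E; have := dfE t y By => H; exact: derive_val.
have dfg' t (y : Y) : `]s - 1, s + 1[%classic t -> B y -> `|partial1of2 f t y| <= g y.
  by move=> _ By; rewrite pE// dfg.
have H := @cvg_differentiation_under_integral R _ Y mu f B mB s _ _ I0 (fun t _ => intf t)
  (fun t (y : Y) _ By => @ex_derive _ _ _ _ _ _ _ (dfE t y By)) g g0 intg dfg'.
have E : \int[mu]_(y in B) partial1of2 f s y = \int[mu]_(y in B) df s y.
  by apply: eq_Rintegral => y /set_mem By; rewrite pE.
rewrite E in H; apply: DeriveDef.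
  apply/cvg_ex; eexists; under eq_fun do rewrite scaler1; exact: H.
by apply/cvg_lim => //; under eq_fun do rewrite scaler1; exact: H.
Qed.

Lemma continuous_sinM s : continuous (fun r : R => sin (r * s)).
Proof.
move=> x; apply: (@continuous_comp _ _ _ (fun r => r * s) sin).
  by apply: cvgM; [exact: cvg_id|exact: cvg_cst].
exact: continuous_sin.
Qed.

Lemma continuous_cosM s : continuous (fun r : R => cos (r * s)).
Proof.
move=> x; apply: (@continuous_comp _ _ _ (fun r => r * s) cos).
  by apply: cvgM; [exact: cvg_id|exact: cvg_cst].
exact: continuous_cos.
Qed.

Lemma measurable_inv_pos : measurable_fun pos (fun r : R => r^-1).
Proof.
apply: open_continuous_measurable_fun => //.
by move=> x /set_mem /=; rewrite in_itv/= andbT => x0; apply: inv_continuous; rewrite gt_eqF.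
Qed.

Lemma le_integrable_gaussw a C (f : R -> R) : 0 < a -> measurable_fun pos f ->
  (forall r, 0 < r -> `|f r| <= C * gaussw a r) ->
  leb.-integrable pos (EFin \o f).
Proof.
move=> a0 mf fC.
apply: (@le_integrable _ _ _ leb pos _ (EFin \o f) (fun r => (C%:E * (gaussw a r)%:E)%E)) => //.
- exact/measurable_EFinP.
- move=> r /=; rewrite in_itv/= andbT => r0; rewrite lee_fin.
  by rewrite (le_trans (fC r r0))// ler_norm.
- by apply: integrableZl => //; exact: integrable_gaussw_pos.
Qed.

Definition gauss_cos a s : R := \int[leb]_(r in pos) (cos (r * s) * gaussw a r).
(** The Gil-Pelaez integral of that normal law: its distribution function at s is 1/2 + gauss_sinc a
    s / pi, see [Phi_sinc]. There is no singularity at 0, as |sin (r s) / r| <= |s|. *)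
Definition gauss_sinc a s : R := \int[leb]_(r in pos) (sin (r * s) / r * gaussw a r).

Lemma integrable_gauss_cos a s : 0 < a ->
  leb.-integrable pos (EFin \o (fun r => cos (r * s) * gaussw a r)).
Proof.
move=> a0; apply: (@le_integrable_gaussw a 1) => //.
  apply: measurable_funM; apply: measurable_funTS.
    exact: continuous_measurable_fun (@continuous_cosM s).
  exact: measurable_gaussw.
move=> r r0; rewrite normrM (ger0_norm (gaussw_ge0 _ _)) ler_wpM2r ?gaussw_ge0//.
exact: cos_max.
Qed.

Lemma sinc_norm_le r s : 0 < r -> `|sin (r * s) / r| <= `|s|.
Proof.
move=> r0; rewrite normrM normfV (gtr0_norm r0) ler_pdivrMr//.
by rewrite (le_trans (sin_norm_le _))// normrM (gtr0_norm r0) mulrC.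
Qed.

Lemma measurable_sinc s : measurable_fun pos (fun r => sin (r * s) / r).
Proof.
apply: measurable_funM; last exact: measurable_inv_pos.
apply: measurable_funTS.
exact: continuous_measurable_fun (@continuous_sinM s).
Qed.

Lemma integrable_gauss_sinc a s : 0 < a ->
  leb.-integrable pos (EFin \o (fun r => sin (r * s) / r * gaussw a r)).
Proof.
move=> a0; apply: (@le_integrable_gaussw a `|s|) => //.
  apply: measurable_funM; first exact: measurable_sinc.
  by apply: measurable_funTS; exact: measurable_gaussw.
move=> r r0; rewrite normrM (ger0_norm (gaussw_ge0 _ _)) ler_wpM2r ?gaussw_ge0//.
exact: sinc_norm_le.
Qed.

Lemma is_derive_gauss_sinc a s : 0 < a ->
  is_derive s (1 : R) (gauss_sinc a) (gauss_cos a s).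
Proof.
move=> a0; apply: (@is_derive_Rintegral _ _ leb pos
    (fun s r => sin (r * s) / r * gaussw a r) (fun s r => cos (r * s) * gaussw a r)
    (gaussw a)) => //.
- by move=> t; exact: integrable_gauss_sinc.
- move=> t r /=; rewrite in_itv/= andbT => r0.
  have H1 : is_derive t (1 : R) (fun x => r * x) r.
    by have := is_deriveZ; rewrite -[X in is_derive _ _ _ X]mulr1; exact.
  have H2 : is_derive t (1 : R) (fun x => sin (r * x)) (cos (r * t) * r).
    exact: is_derive1_comp.
  have -> : (fun x => sin (r * x) / r * gaussw a r) =
      (gaussw a r / r) *: (fun x => sin (r * x)).
    by apply/funext => x; rewrite fct_pointwise; ring.
  have -> : cos (r * t) * gaussw a r = (gaussw a r / r) *: (cos (r * t) * r).
    by rewrite /GRing.scale/=; field; rewrite gt_eqF.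
  exact: is_deriveZ.
- by move=> r; exact: gaussw_ge0.
- exact: integrable_gaussw_pos.
- move=> t r _; rewrite normrM (ger0_norm (gaussw_ge0 _ _)) ler_piMl ?gaussw_ge0//.
  exact: cos_max.
Qed.

Lemma ge0_mul_gaussw_le a r : 0 < a -> 0 <= r -> r * gaussw a r <= a^-1 * gaussw (a / 2) r.
Proof.
move=> a0 r0.
(* 3/8 = 1/2 - 1/8 is what remains of the exponent once [gaussw (a / 2)] is split off; it absorbs
   the factor a r. *)
have -> : gaussw a r = expR (- (3 / 8 * (a * r) ^+ 2)) * gaussw (a / 2) r.
  by rewrite /gaussw -expRD; congr expR; field.
rewrite mulrA ler_wpM2r ?gaussw_ge0// expRN ler_pdivrMr ?expR_gt0//.
rewrite mulrC ler_pdivlMr//.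
apply: le_trans (expR_ge1Dx _).
have : 0 <= (a * r - 4 / 3) ^+ 2 by exact: sqr_ge0.
by rewrite !expr2; lra.
Qed.

Lemma gaussw_le_inv a r : 0 < a -> 0 < r -> gaussw a r <= (a * r)^-1.
Proof.
move=> a0 r0; have ar0 : 0 < a * r by exact: mulr_gt0.
rewrite /gaussw expRN lef_pV2 ?posrE ?expR_gt0//; apply: le_trans (expR_ge1Dx _).
have : 0 <= (a * r - 1) ^+ 2 by exact: sqr_ge0.
by rewrite !expr2; lra.
Qed.

(** Integration by parts on the half-line rests on this: [F] vanishes at 0 and at infinity. The
    integral is reached along the intervals [0, n + 1] by dominated convergence. *)
Lemma Rintegral_derive_eq0 (f F : R -> R) (C : R) : continuous f ->
  leb.-integrable pos (EFin \o f) ->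
  (forall x, is_derive x (1 : R) F (f x)) -> F 0 = 0 ->
  (forall x, 0 < x -> `|F x| <= C * x^-1) ->
  \int[leb]_(x in pos) f x = 0.
Proof.
move=> cf intf dF F0 FC.
pose D : set R := `[0, +oo[%classic.
have intf' : leb.-integrable D (EFin \o f).
  apply/integrableP; split.
    by apply/measurable_EFinP/measurable_funTS; exact: continuous_measurable_fun.
  have /integrableP[_] := intf; rewrite -integral_itv_obnd_cbnd//.
  by apply/measurableT_comp => //; apply/measurable_EFinP/measurable_funTS; exact: continuous_measurable_fun.
have H : (\int[leb]_(x in D) ((f \_ `[0, n.+1%:R]%classic) x)%:E)%E @[n --> \oo] -->
    (\int[leb]_(x in D) (f x)%:E)%E.
  apply: (@dominated_cvg _ _ _ leb D _ _ _ (fun x => `|f x|%:E)) => //.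
  - exact: measurable_itv.
  - move=> n; apply/measurable_EFinP; apply: measurable_funTS.
    apply/(measurable_restrictT f) => //; apply: measurable_funTS.
    exact: continuous_measurable_fun.
  - move=> x; rewrite /D /= in_itv/= andbT => x0.
    apply: cvg_EFin; first by exact: nearW.
    apply: cvg_near_cst; near=> n.
    rewrite /= patchE mem_set//= in_itv/= x0/=.
    near: n; exists (Num.truncn `|x|) => //= n /= hn.
    rewrite (le_trans (ler_norm _))// ltW// (lt_le_trans (truncnS_gt _))//.
    by rewrite ler_nat.
  - by have := integrable_norm intf'; apply.
  - move=> n x _ /=; rewrite lee_fin patchE; case: ifPn => // _.
    by rewrite normr0.
have E n : (\int[leb]_(x in D) ((f \_ `[0, n.+1%:R]%classic) x)%:E)%E = (F n.+1%:R)%:E.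
  have -> : (F n.+1%:R)%:E = ((F n.+1%:R)%:E - (F 0)%:E)%E by rewrite F0 sube0.
  rewrite -(@continuous_FTC2 _ f F)//.
  - rewrite [RHS]integral_mkcond [LHS]integral_mkcond; apply: eq_integral => x _.
    rewrite !patchE /D; case: ifPn => /= [xD|xD].
      by case: ifPn.
    case: ifPn => // /set_mem/=; rewrite in_itv/= => /andP[x0 _].
    by move: xD; rewrite notin_setE/= in_itv/= x0.
  - exact: continuous_subspaceT.
  - split.
    + by move=> x _; exact: ex_derive.
    + apply: cvg_at_right_filter; apply: differentiable_continuous.
      exact/derivable1_diffP/ex_derive.
    + apply: cvg_at_left_filter; apply: differentiable_continuous.
      exact/derivable1_diffP/ex_derive.
  - by move=> x _; rewrite derive1E; exact: derive_val.
have HF : (F n.+1%:R) @[n --> \oo] --> (0 : R).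
  apply/norm_cvg0P.
  have C0 : (C * harmonic n) @[n --> \oo] --> (0 : R).
    by rewrite -[X in _ --> X](mulr0 C); apply: cvgM; [exact: cvg_cst|exact: cvg_harmonic].
  apply: (squeeze_cvgr _ (cvg_cst 0) C0).
  by near=> n; rewrite normr_ge0/=; apply: FC.
have HE : (\int[leb]_(x in D) ((f \_ `[0, n.+1%:R]%classic) x)%:E)%E @[n --> \oo] --> (0%:E).
  by under eq_fun do rewrite E; apply: cvg_EFin => //; exact: nearW.
rewrite Rintegral_itv_obnd_cbnd// /Rintegral.
by rewrite (cvg_unique _ H HE).
Unshelve. all: end_near. Qed.

End GaussianFourier.

Section GaussianFourierInversion.
Context {R : realType}.
Implicit Types (a r s t x y : R).
Local Notation leb := (@lebesgue_measure R).
Local Notation pos := (`]0, +oo[%classic : set R).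

Lemma eq_of_derive0 (f : R -> R) : (forall x, is_derive x (1 : R) f 0) ->
  forall x y, f x = f y.
Proof.
move=> df x y; apply/eqP; rewrite -subr_eq0 -normr_le0.
have := @lipschitz_of_derive _ f (fun=> 0) (Num.max `|x| `|y|) 0 df _ x y.
rewrite mul0r; apply; rewrite ?le_max ?lexx ?orbT// => z _.
by rewrite normr0.
Qed.

Lemma is_derive_expR_comp (g : R -> R) x (dg : R) : is_derive x (1 : R) g dg ->
  is_derive x (1 : R) (fun y => expR (g y)) (expR (g x) * dg).
Proof. exact: (@is_derive1_comp _ expR g x (expR (g x)) dg (is_derive_expR (g x))). Qed.

Lemma is_derive_gaussw a r :
  is_derive r (1 : R) (gaussw a) (gaussw a r * - (a ^+ 2 * r)).
Proof.
have H1 : is_derive r (1 : R) (fun x : R => - (a ^+ 2 / 2) *: (x ^+ 2)) (- (a ^+ 2 * r)).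
  have -> : - (a ^+ 2 * r) = (- (a ^+ 2 / 2)) *: ((2%:R * r ^+ 1) *: 1).
    by rewrite /GRing.scale/= expr1; field.
  apply: is_deriveZ; exact: (@is_deriveX _ _ id 2 r 1 1).
have E x : gaussw a x = expR (- (a ^+ 2 / 2) *: (x ^+ 2)).
  by rewrite /gaussw /=; congr expR; rewrite /GRing.scale/=; field.
by have := is_derive_expR_comp H1; rewrite -(funext E) -E.
Qed.

Lemma is_derive_sinM s r : is_derive r (1 : R) (fun x => sin (x * s)) (cos (r * s) * s).
Proof.
have H1 : is_derive r (1 : R) (fun x => x * s) s.
  rewrite (_ : (fun x => x * s) = s *: id); last by apply/funext => x; rewrite fct_pointwise mulrC.
  by rewrite -[X in is_derive _ _ _ X]mulr1; exact: is_deriveZ.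
exact: is_derive1_comp.
Qed.

Let continuous_Mgauss (f : R -> R) a : continuous f -> continuous (fun r => f r * gaussw a r).
Proof. by move=> cf x; apply: cvgM; [exact: cf|exact: continuous_gaussw]. Qed.

Let continuous_idsin s : continuous (fun r : R => r * sin (r * s)).
Proof. by move=> x; apply: cvgM; [exact: cvg_id|exact: continuous_sinM]. Qed.

Lemma integrable_gauss_idsin a s : 0 < a ->
  leb.-integrable pos (EFin \o (fun r => r * sin (r * s) * gaussw a r)).
Proof.
move=> a0; have a20 : 0 < a / 2 by rewrite divr_gt0.
apply: (@le_integrable_gaussw _ (a / 2) a^-1) => //.
  apply: measurable_funTS; apply: continuous_measurable_fun.
  exact: continuous_Mgauss.
move=> r r0; rewrite !normrM (gtr0_norm r0) (ger0_norm (gaussw_ge0 _ _)).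
apply: le_trans (ge0_mul_gaussw_le a0 (ltW r0)).
by rewrite ler_wpM2r ?gaussw_ge0// ler_piMr ?sin_max// ltW.
Qed.

(** Differentiation under the integral gives the integral of - r sin (r s) gaussw a r. Integrating
    the r-derivative of sin (r s) gaussw a r turns it into a multiple of [gauss_cos], hence a linear
    differential equation. *)
Lemma is_derive_gauss_cos a s : 0 < a ->
  is_derive s (1 : R) (gauss_cos a) (- (s / a ^+ 2) * gauss_cos a s).
Proof.
move=> a0.
have Icos : leb.-integrable pos (EFin \o (fun r => s * (cos (r * s) * gaussw a r))).
  rewrite (_ : _ \o _ = fun x => (s%:E * (cos (x * s) * gaussw a x)%:E)%E)//.
  by apply: integrableZl => //; exact: integrable_gauss_cos.
have Isin : leb.-integrable pos (EFin \o (fun r => a ^+ 2 * (r * sin (r * s) * gaussw a r))).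
  rewrite (_ : _ \o _ = fun x => ((a ^+ 2)%:E * (x * sin (x * s) * gaussw a x)%:E)%E)//.
  by apply: integrableZl => //; exact: integrable_gauss_idsin.
have H : \int[leb]_(r in pos) (s * (cos (r * s) * gaussw a r) -
     a ^+ 2 * (r * sin (r * s) * gaussw a r)) = 0.
  apply: (@Rintegral_derive_eq0 _ _ (fun r => sin (r * s) * gaussw a r) a^-1).
  - move=> x; have c1 := @continuous_Mgauss _ a (@continuous_cosM _ s) x.
    have c2 := @continuous_Mgauss _ a (@continuous_idsin s) x.
    apply: cvgB; apply: cvgM; [exact: cvg_cst|exact: c1|exact: cvg_cst|exact: c2].
  - rewrite (_ : _ \o _ = fun x => ((s * (cos (x * s) * gaussw a x))%:E -
       (a ^+ 2 * (x * sin (x * s) * gaussw a x))%:E)%E)//.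
    exact: integrableB.
  - move=> x; apply: (is_derive_eq (is_deriveM (is_derive_sinM s x) (is_derive_gaussw a x))).
    by rewrite /GRing.scale/=; ring.
  - by rewrite mul0r sin0 mul0r.
  - move=> x x0; rewrite normrM (ger0_norm (gaussw_ge0 _ _)) -invfM.
    by apply: le_trans (gaussw_le_inv a0 x0); rewrite ler_piMl ?gaussw_ge0 ?sin_max.
have E : \int[leb]_(r in pos) ((-1) * (r * sin (r * s) * gaussw a r)) =
    - (s / a ^+ 2) * gauss_cos a s.
  have a2 : a ^+ 2 != 0 by rewrite expf_neq0// gt_eqF.
  move: H; rewrite RintegralB// !RintegralZl//; last 3 first.
  - exact: integrable_gauss_idsin.
  - exact: integrable_gauss_idsin.
  - exact: integrable_gauss_cos.
  rewrite -/(gauss_cos a s) => /eqP; rewrite subr_eq0 => /eqP H.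
  apply: (mulfI a2); rewrite mulrCA -H; field; rewrite gt_eqF//.
rewrite -E.
apply: (@is_derive_Rintegral _ _ _ leb pos
    (fun s r => cos (r * s) * gaussw a r) (fun s r => -1 * (r * sin (r * s) * gaussw a r))
    (fun r => `|a^-1 * gaussw (a / 2) r|)) => //.
- by move=> t; exact: integrable_gauss_cos.
- move=> t r _.
  have H1 : is_derive t (1 : R) (fun x => r * x) r.
    by have := is_deriveZ; rewrite -[X in is_derive _ _ _ X]mulr1; exact.
  have H2 : is_derive t (1 : R) (fun x => cos (r * x)) (- sin (r * t) * r).
    exact: is_derive1_comp.
  have -> : (fun x => cos (r * x) * gaussw a r) = gaussw a r *: (fun x => cos (r * x)).
    by apply/funext => x; rewrite fct_pointwise; ring.
  have -> : -1 * (r * sin (r * t) * gaussw a r) = gaussw a r *: (- sin (r * t) * r).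
    by rewrite /GRing.scale/=; ring.
  exact: is_deriveZ.
- apply: integrable_norm; rewrite (_ : _ \o _ = fun x => (a^-1%:E * (gaussw (a / 2) x)%:E)%E)//.
  by apply: integrableZl => //; apply: integrable_gaussw_pos; rewrite divr_gt0.
- move=> t r /=; rewrite in_itv/= andbT => r0.
  rewrite mulN1r normrN !normrM (gtr0_norm r0) !(ger0_norm (gaussw_ge0 _ _)).
  rewrite (gtr0_norm (_ : 0 < a^-1)) ?invr_gt0//; apply: le_trans (ge0_mul_gaussw_le a0 (ltW r0)).
  by rewrite ler_wpM2r ?gaussw_ge0// ler_piMr ?sin_max// ltW.
Qed.

(** The quotient by [gaussw a^-1] has zero derivative, and the value at s = 0 is the Gaussian
    integral. *)
Lemma gauss_cosE a s : 0 < a ->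
  gauss_cos a s = Num.sqrt (pi / 2) / a * gaussw a^-1 s.
Proof.
move=> a0.
have c0 : gauss_cos a 0 = Num.sqrt (pi / 2) / a.
  rewrite -integral_gaussw//; apply: eq_Rintegral => r _.
  by rewrite mulr0 cos0 mul1r.
have D x : is_derive x (1 : R) (fun x => gauss_cos a x / gaussw a^-1 x) 0.
  pose E (x : R) := expR (x ^+ 2 / a ^+ 2 / 2).
  have EE y : (gaussw a^-1 y)^-1 = E y.
    by rewrite /gaussw expRN invrK; congr expR; field; rewrite gt_eqF.
  have -> : (fun x => gauss_cos a x / gaussw a^-1 x) = gauss_cos a * E.
    by apply/funext => y; rewrite EE.
  have H1 : is_derive x (1 : R) (fun x : R => (a ^- 2 / 2) *: (x ^+ 2)) (x / a ^+ 2).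
    have -> : x / a ^+ 2 = (a ^- 2 / 2) *: ((2%:R * x ^+ 1) *: 1).
      by rewrite /GRing.scale/= expr1; field; rewrite gt_eqF.
    apply: is_deriveZ; exact: (@is_deriveX _ _ id 2 x 1 1).
  have EE2 y : E y = expR ((a ^- 2 / 2) *: (y ^+ 2)).
    by rewrite /E /=; congr expR; rewrite /GRing.scale/=; field; rewrite gt_eqF.
  have H2 : is_derive x (1 : R) E (E x * (x / a ^+ 2)).
    by have := is_derive_expR_comp H1; rewrite -(funext EE2) -EE2.
  apply: (is_derive_eq (is_deriveM (is_derive_gauss_cos x a0) H2)).
  by rewrite /GRing.scale/=; ring.
have := eq_of_derive0 D s 0.
rewrite [gaussw _ 0](_ : _ = 1); last by rewrite /gaussw mulr0 expr0n/= mul0r oppr0 expR0.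
by rewrite divr1 c0 => <-; rewrite divfK// gt_eqF// gaussw_gt0.
Qed.

End GaussianFourierInversion.

(** * The standard normal distribution function *)

Section NormalCdf.
Context {R : realType}.
Implicit Types (a r s t x y L : R).
Local Notation leb := (@lebesgue_measure R).
Local Notation pos := (`]0, +oo[%classic : set R).
Local Notation pdf := (@normal_pdf R 0 1).

Lemma pdfE x : pdf x = (Num.sqrt (2 * pi))^-1 * gaussw 1 x.
Proof.
rewrite normal_pdfE ?oner_eq0// /normal_peak /normal_fun /gaussw expr1n mul1r.
by rewrite -mulr_natl subr0 mul1r mulNr.
Qed.

Lemma sqrt2pi_ge1 : 1 <= Num.sqrt (2 * pi) :> R.
Proof.
by rewrite -[leLHS]sqrtr1 ler_wsqrtr//; have := pi_ge2 R; lra.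
Qed.

Lemma pdf_le x : pdf x <= gaussw 1 x.
Proof.
by rewrite pdfE ler_piMl ?gaussw_ge0// invf_le1 ?sqrt2pi_ge1// (lt_le_trans ltr01)// sqrt2pi_ge1.
Qed.

Lemma pdf_le1 x : pdf x <= 1.
Proof. exact: le_trans (pdf_le x) (gaussw_le1 _ _). Qed.

Lemma pdf_ge0 x : 0 <= pdf x. Proof. exact: normal_pdf_ge0. Qed.

Let integrable_pdf (A : set R) : measurable A -> leb.-integrable A (EFin \o pdf).
Proof.
move=> mA; apply: (integrableS measurableT) => //; exact: integrable_normal_pdf.
Qed.

Lemma PhiE x : Phi x = \int[leb]_(t in `]-oo, x]) pdf t.
Proof. by []. Qed.

Lemma is_derive_Phi x : is_derive x (1 : R) Phi (pdf x).
Proof.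
have [d1 d2] : derivable (@Phi R) x 1 /\ (@Phi R)^`()%classic x = pdf x.
  apply: (@continuous_FTC1 R pdf -oo%O x (x + 1)).
  - by rewrite ltrDl.
  - exact: integrable_pdf.
  - exact: ltNyr.
  - by apply: continuous_normal_pdf; rewrite oner_eq0.
apply: DeriveDef; first exact: d1.
by rewrite -derive1E; exact: d2.
Qed.

Lemma Phi_le x y : x <= y -> Phi x <= Phi y.
Proof.
move=> xy; rewrite !PhiE /Rintegral fine_le//; try exact: integrable_fin_num (integrable_pdf _).
apply: ge0_subset_integral => //.
- by apply/measurable_EFinP/measurable_funTS; exact: measurable_normal_pdf.
- by move=> z _; rewrite lee_fin pdf_ge0.
- by move=> z /=; rewrite !in_itv/= => /le_trans; apply.
Qed.

Lemma Phi_ge0 x : 0 <= Phi x.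
Proof. by rewrite PhiE; apply: Rintegral_ge0 => t _; exact: pdf_ge0. Qed.

Lemma Phi_le1 x : Phi x <= 1.
Proof.
rewrite -lee_fin /Phi fineK ?fin_num_measure//; exact: probability_le1.
Qed.

Lemma Phi0 : Phi (0 : R) = 1 / 2.
Proof.
have s0 : 0 < Num.sqrt (2 * pi) :> R by rewrite (lt_le_trans ltr01) ?sqrt2pi_ge1.
have E1 : normal_prob (0 : R) 1 `]0, +oo[ = (1 / 2)%:E.
  rewrite -[LHS]fineK ?fin_num_measure//; congr EFin.
  rewrite -[LHS]/(\int[leb]_(t in pos) pdf t).
  rewrite (_ : (fun t => pdf t) = (fun t => (Num.sqrt (2 * pi))^-1 * gaussw 1 t)); last first.
    by apply/funext => t; rewrite pdfE.
  rewrite RintegralZl//; last exact: integrable_gaussw_pos.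
  rewrite integral_gaussw// divr1 -sqrtrV ?mulr_ge0 ?pi_ge0//.
  rewrite -sqrtrM ?invr_ge0 ?mulr_ge0 ?pi_ge0//.
  rewrite (_ : (2 * pi)^-1 * (pi / 2) = (1 / 2) ^+ 2); last first.
    by move: (pi_gt0 R); move: (@pi R) => p p0; field; rewrite gt_eqF.
  by rewrite sqrtr_sqr ger0_norm.
have E2 : (normal_prob (0 : R) 1 (~` `]0%R, +oo[) = 1 - (1 / 2)%:E)%E.
  by rewrite -E1; exact: (probability_setC (normal_prob (0 : R) 1)).
by rewrite /Phi -(setCitvr (BRight 0)) E2 -EFinB /=; lra.
Qed.

Lemma PhiN x : Phi (- x) = 1 - Phi x.
Proof.
have D y : is_derive y (1 : R) (fun y => Phi (- y) + Phi y) 0.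
  have H1 : is_derive y (1 : R) (fun y => Phi (- y)) (pdf (- y) * -1).
    by apply: is_derive1_comp; exact: is_derive_Phi.
  apply: (is_derive_eq (is_deriveD H1 (is_derive_Phi y))).
  have -> : pdf (- y) = pdf y by rewrite !pdfE /gaussw; congr (_ * expR _); ring.
  by rewrite mulrN1 addNr.
by have := eq_of_derive0 D x 0; rewrite oppr0 Phi0; lra.
Qed.

Lemma Phi_lipschitz x y : `|Phi x - Phi y| <= `|x - y|.
Proof.
rewrite -[leRHS]mul1r.
apply: (@lipschitz_of_derive _ Phi pdf (Num.max `|x| `|y|)).
- by move=> z; exact: is_derive_Phi.
- by move=> z _; rewrite ger0_norm ?pdf_ge0 ?pdf_le1.
- by rewrite le_max lexx.
- by rewrite le_max lexx orbT.
Qed.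

(** Instead of an inversion theorem: both sides have the s-derivative pdf (s / a) / a, by
    [gauss_cosE], and both are 1/2 at s = 0. *)
Lemma Phi_sinc a s : 0 < a -> Phi (s / a) = 1 / 2 + gauss_sinc a s / pi.
Proof.
move=> a0.
have D x : is_derive x (1 : R) (fun x => Phi (x / a) - gauss_sinc a x / pi) 0.
  have H0 : is_derive x (1 : R) (fun x => x / a) a^-1.
    rewrite (_ : (fun x => x / a) = a^-1 *: id); last by apply/funext => y; rewrite fct_pointwise mulrC.
    by rewrite -[X in is_derive _ _ _ X]mulr1; exact: is_deriveZ.
  have H1 : is_derive x (1 : R) (fun x => Phi (x / a)) (pdf (x / a) * a^-1).
    by apply: is_derive1_comp; exact: is_derive_Phi.
  have H2 := is_deriveZ pi^-1 (is_derive_gauss_sinc x a0).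
  have -> : (fun x => Phi (x / a) - gauss_sinc a x / pi) =
      (fun x => Phi (x / a)) - pi^-1 *: gauss_sinc a.
    by apply/funext => y; rewrite !fct_pointwise [gauss_sinc a y / _]mulrC.
  apply: (is_derive_eq (is_deriveB H1 H2)).
  have -> : pi^-1 *: gauss_cos a x = pi^-1 * gauss_cos a x by [].
  rewrite gauss_cosE// pdfE.
  have -> : gaussw 1 (x / a) = gaussw a^-1 x by rewrite /gaussw mul1r [x / a]mulrC.
  have p0 := pi_gt0 R.
  have -> : Num.sqrt (pi / 2) = pi / Num.sqrt (2 * pi) :> R.
    have s0 : 0 < Num.sqrt (2 * pi) :> R by rewrite sqrtr_gt0 mulr_gt0.
    apply: (mulIf (lt0r_neq0 s0)); rewrite divfK ?gt_eqF// -sqrtrM ?divr_ge0 ?pi_ge0//.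
    rewrite (_ : pi / 2 * (2 * pi) = pi ^+ 2); last by move: (@pi R) => p; field.
    by rewrite sqrtr_sqr ger0_norm// pi_ge0.
  have s0 : 0 < Num.sqrt (2 * pi) :> R by rewrite sqrtr_gt0 mulr_gt0.
  move: p0 s0; move: (@pi R) => p p0; move: (Num.sqrt _) => q q0.
  by field; rewrite !gt_eqF.
have := eq_of_derive0 D s 0; rewrite !mul0r Phi0.
have -> : gauss_sinc a 0 = 0 :> R.
  rewrite /gauss_sinc (_ : (fun r => _) = fun r => 0).
    by rewrite Rintegral_cst// mul0r.
  by apply/funext => r; rewrite mulr0 sin0 !mul0r.
by rewrite mul0r subr0 => /eqP; rewrite subr_eq => /eqP.
Qed.

(** On t <= - L the density is at most 2 exp (- L^2 / 4) times that of N(0, 4), whose mass is at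
    most 1. The frequencies above T produce the same exponent, so the two tails merge in
    [smoothing_inequality]. *)
Lemma PhiN_le_expR L : 0 <= L -> Phi (- L) <= 2 * expR (- (L ^+ 2 / 4)).
Proof.
move=> L0; rewrite PhiE.
have aux (l t : R) : 0 <= l -> l <= t -> - t / (1 ^+ 2 *+ 2) <= - (l / 4) + - t / (2 ^+ 2 *+ 2).
  by rewrite expr1n (_ : 2 ^+ 2 *+ 2 = 8) => [l0 lt|]; [lra|ring].
have I2 : leb.-integrable `]-oo, - L] (EFin \o normal_pdf (0 : R) 2).
  by apply: (integrableS measurableT) => //; exact: integrable_normal_pdf.
have I2' : leb.-integrable `]-oo, - L]
    (EFin \o (fun t => 2 * expR (- (L ^+ 2 / 4)) * normal_pdf (0 : R) 2 t)).
  rewrite (_ : _ \o _ = fun t => ((2 * expR (- (L ^+ 2 / 4)))%:E * (normal_pdf 0 2 t)%:E)%E)//.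
  exact: integrableZl.
apply: le_trans (le_Rintegral _ _ I2' _) _ => //.
- exact: integrable_pdf.
- move=> t /=; rewrite in_itv/= => tL.
  rewrite normal_pdfE ?oner_eq0// normal_pdfE ?pnatr_eq0// /normal_peak /normal_fun !subr0.
  have -> : Num.sqrt (2 ^+ 2 * pi *+ 2) = 2 * Num.sqrt (1 ^+ 2 * pi *+ 2) :> R.
    by rewrite expr1n mul1r -mulrnAr sqrtrM ?sqr_ge0// sqrtr_sqr ger0_norm.
  rewrite invfM mulrA mulrA [2 * _]mulrC -[_ * 2 * 2^-1]mulrA mulfV// mulr1.
  rewrite [leRHS]mulrAC [leRHS]mulrC ler_wpM2l ?invr_ge0 ?sqrtr_ge0// -expRD ler_expR.
  have Lt : L ^+ 2 <= t ^+ 2.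
    rewrite -[t ^+ 2]sqrrN lerXn2r// ?nnegrE lerNr//.
    by rewrite oppr0 (le_trans tL)// oppr_le0.
  by apply: aux Lt; exact: sqr_ge0.
- rewrite RintegralZl// ler_piMr ?mulr_ge0 ?expR_ge0//.
  rewrite -lee_fin /Rintegral fineK; last exact: integrable_fin_num.
  exact: (@probability_le1 _ _ _ (normal_prob 0 2)).
Qed.

(* Phi is compared at x and c x with c = (1 + eps^2)^(-1/2), the effect of
   adding an independent Gaussian of variance eps^2. *)
Lemma Phi_scale_le eps x : `|Phi (x / Num.sqrt (1 + eps ^+ 2)) - Phi x| <= eps ^+ 2.
Proof.
set b := Num.sqrt _; have e0 := sqr_ge0 eps.
have b2 : b ^+ 2 = 1 + eps ^+ 2 by rewrite sqr_sqrtr//; lra.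
have b1 : 1 <= b by rewrite -[leLHS]sqrtr1 ler_wsqrtr//; lra.
have be : b - 1 <= eps ^+ 2.
  have : 0 <= (b - 1) * b by rewrite mulr_ge0//; move: b1; lra.
  by move: b1 b2; rewrite expr2; move: b (eps ^+ 2) => *; lra.
wlog x0 : x / 0 <= x.
  move=> H; have [/H//|/ltW x0] := leP 0 x.
  have := H (- x); rewrite oppr_ge0 => /(_ x0).
  rewrite mulNr !PhiN (_ : forall y z : R, 1 - y - (1 - z) = - (y - z)) => [|y z]; last by ring.
  by rewrite normrN.
have xb : x / b <= x by rewrite ler_pdivrMr ?ler_peMr//; lra.
have xb0 : 0 <= x / b by rewrite divr_ge0//; lra.
have cf : {within `[x / b, x], continuous (@Phi R)}.
  by apply: derivable_within_continuous => z _; have := is_derive_Phi z => H; exact: ex_derive.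
have [c] := MVT_segment xb (fun z _ => is_derive_Phi z) cf.
rewrite in_itv/= => /andP[c1 c2]; rewrite distrC => ->.
rewrite normrM (ger0_norm (pdf_ge0 _)) ger0_norm ?subr_ge0//.
apply: le_trans be; have -> : x - x / b = (x / b) * (b - 1) by field; lra.
have h1 : pdf c * (x / b) <= gaussw 1 c * c by rewrite ler_pM ?pdf_ge0 ?pdf_le.
have h2 : gaussw 1 c * c <= 1.
  have [->|c0] := eqVneq c 0; first by rewrite mulr0.
  have cp : 0 < c by rewrite lt0r c0 (le_trans xb0).
  by have := gaussw_le_inv (ltr01 : 0 < 1 :> R) cp; rewrite mul1r -ler_pdivlMr ?invr_gt0// ?invrK ?div1r// mulrC.
rewrite mulrA -[leRHS]mul1r ler_wpM2r ?subr_ge0//; lra.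
Qed.

End NormalCdf.

Lemma smoothing_arith {R : realFieldType} (w wp wm F Fp Fm n err e2 l d e : R) :
  w <= wp + n -> wm <= w + n -> `|wp - Fp| <= err + e2 -> `|wm - Fm| <= err + e2 ->
  `|Fp - F| <= l -> `|Fm - F| <= l ->
  err <= 32 * d + 8 * e -> n <= 2 * e -> e2 <= l ->
  `|w - F| <= 32 * d + 2 * l + 10 * e.
Proof.
move=> wwp wmw; rewrite !ler_norml => /andP[_ h2] /andP[h3 _] /andP[_ h6] /andP[h7 _] *.
by apply/andP; split; lra.
Qed.

(** * Distribution functions from characteristic functions *)

Section Smoothing.
Context {R : realType} d (X : measurableType d) (nu : {finite_measure set X -> \bar R}).
Variables (h Y : X -> R) (M B : R).
Implicit Types (f g : X -> R).
Local Notation leb := (@lebesgue_measure R).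
Local Notation pos := (`]0, +oo[%classic : set R).
Hypothesis mh : measurable_fun setT h.
Hypothesis mY : measurable_fun setT Y.
Hypothesis h_ge0 : forall x, 0 <= h x.
Hypothesis h_le : forall x, h x <= M.
Hypothesis Y_le : forall x, `|Y x| <= B.

Definition wexp (f : X -> R) : R := \int[nu]_x (h x * f x).

Lemma integrable_wexp f (C : R) : measurable_fun setT f -> (forall x, `|f x| <= C) ->
  nu.-integrable setT (EFin \o (fun x => h x * f x)).
Proof.
move=> mf fC; apply: measurable_bounded_integrable => //.
- exact: fin_num_fun_lty.
- exact: measurable_funM.
- exists (M * C); split; first exact: num_real.
  move=> y MCy x _ /=; apply: le_trans (ltW MCy).
  by rewrite normrM ler_pM// ger0_norm.
Qed.

Lemma le_wexp f g (C D : R) : measurable_fun setT f -> measurable_fun setT g ->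
  (forall x, `|f x| <= C) -> (forall x, `|g x| <= D) -> (forall x, f x <= g x) ->
  wexp f <= wexp g.
Proof.
move=> mf mg fC gD fg; apply: le_Rintegral => //.
- exact: integrable_wexp fC.
- exact: integrable_wexp gD.
- by move=> x _; rewrite ler_wpM2l.
Qed.

Lemma wexpD f g (C D : R) : measurable_fun setT f -> measurable_fun setT g ->
  (forall x, `|f x| <= C) -> (forall x, `|g x| <= D) ->
  wexp (fun x => f x + g x) = wexp f + wexp g.
Proof.
move=> mf mg fC gD; rewrite /wexp -RintegralD//.
- by apply: eq_Rintegral => x _; rewrite mulrDr.
- exact: integrable_wexp fC.
- exact: integrable_wexp gD.
Qed.

Lemma wexpZ f (C k : R) : measurable_fun setT f -> (forall x, `|f x| <= C) ->
  wexp (fun x => k * f x) = k * wexp f.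
Proof.
move=> mf fC; rewrite /wexp -RintegralZl//.
- by apply: eq_Rintegral => x _; rewrite mulrCA.
- exact: integrable_wexp fC.
Qed.

Hypothesis wexp1 : wexp (fun=> 1) = 1.

Lemma wexp_cst (k : R) : wexp (fun=> k) = k.
Proof.
rewrite -[RHS]mulr1 -wexp1 -(wexpZ (C := 1))//.
- by congr wexp; apply/funext => x; rewrite mulr1.
- by move=> x; rewrite normr1.
Qed.

Lemma norm_wexp_le f (C : R) : measurable_fun setT f -> (forall x, `|f x| <= C) ->
  `|wexp f| <= C.
Proof.
move=> mf fC.
have C0 (x : X) : `|(fun=> C) x| <= `|C| by [].
have NC0 (x : X) : `|(fun=> - C) x| <= `|C| by rewrite normrN.
rewrite ler_norml; apply/andP; split.
  rewrite -(wexp_cst (- C)).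
  apply: (@le_wexp (fun=> - C) f `|C| C) => // x.
  by have := fC x; rewrite ler_norml => /andP[].
rewrite -[leRHS](wexp_cst C); apply: (@le_wexp f (fun=> C) C `|C|) => // x.
exact: le_trans (ler_norm _) (fC x).
Qed.

Section SmoothedExpectation.
Variable z eps : R.
Hypothesis eps0 : 0 < eps.

(** The cut at 0 makes the integrand [F] measurable on the whole product, as Fubini's theorem
    requires, with no separate treatment of r <= 0. *)
Let invp : R -> R := (fun r => r^-1) \_ pos.

Let minvp : measurable_fun setT invp.
Proof. by apply/(measurable_restrictT (fun r : R => r^-1)) => //; exact: measurable_inv_pos. Qed.

Let F (w : X * R) : R := h w.1 * (sin (w.2 * (z - Y w.1)) * invp w.2 * gaussw eps w.2).

Let mF : measurable_fun setT F.
Proof.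
apply: measurable_funM; first exact: measurableT_comp mh measurable_fst.
apply: measurable_funM; last exact: measurableT_comp (measurable_gaussw _) measurable_snd.
apply: measurable_funM; last exact: measurableT_comp minvp measurable_snd.
apply: measurableT_comp.
  exact: continuous_measurable_fun (@continuous_sin R).
apply: measurable_funM; first exact: measurable_snd.
apply: measurable_funB; first exact: measurable_cst.
exact: measurableT_comp mY measurable_fst.
Qed.

Let c := `|M * (`|z| + B)|.

Let sinvp_le (r s : R) : `|sin (r * s) * invp r| <= `|s|.
Proof.
rewrite /invp patchE; case: ifPn => [/set_mem/=|_]; last by rewrite mulr0 normr0.
by rewrite in_itv/= andbT; exact: sinc_norm_le.
Qed.

Let zY_le x : `|z - Y x| <= `|z| + B.
Proof. by rewrite (le_trans (ler_normB _ _))// lerD2l. Qed.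

Let F_le w : `|F w| <= c * gaussw eps w.2.
Proof.
rewrite /F !normrM (ger0_norm (h_ge0 _)) (ger0_norm (gaussw_ge0 _ _)) mulrA.
rewrite ler_wpM2r ?gaussw_ge0//; apply: le_trans (ler_norm _).
rewrite ler_pM ?mulr_ge0//; by rewrite -normrM (le_trans (sinvp_le _ _)).
Qed.

Let intG : leb.-integrable setT (fun r => (c * gaussw eps r)%:E).
Proof.
rewrite (_ : (fun r => _) = fun r => (c%:E * (gaussw eps r)%:E)%E)//.
by apply: integrableZl => //; exact: integrable_gaussw.
Qed.

Let mFx x : measurable_fun setT (fun r : R => F (x, r)).
Proof.
apply: (@measurableT_comp _ _ _ _ _ _ F _ (fun r : R => (x, r))) => //.
exact: measurable_fun_pair.
Qed.

Let intF : (nu \x leb)%E.-integrable setT (EFin \o F).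
Proof.
apply/integrable12ltyP.
  by apply/measurable_EFinP.
pose I := (\int[leb]_r (c * gaussw eps r)%:E)%E.
have If : I \is a fin_num by exact: integrable_fin_num.
apply: (@le_lt_trans _ _ (\int[nu]_x I)%E).
  apply: ge0_le_integral => //.
  - by move=> x _; exact: integral_ge0.
  - apply: (@measurable_fun_fubini_tonelli_F _ _ _ _ _ leb (fun w => `|(F w)%:E|%E)) => //.
    exact/measurableT_comp/measurable_EFinP.
  - move=> x _; apply: ge0_le_integral => //.
    + apply/(@measurable_EFinP _ _ _ setT (fun r => `|F (x, r)|)).
      exact: measurableT_comp (mFx x).
    + exact: measurable_int intG.
    + by move=> r _ /=; rewrite lee_fin F_le.
have I0 : (0 <= I)%E.
  by apply: integral_ge0 => r _; rewrite lee_fin mulr_ge0 ?gaussw_ge0// /c normr_ge0.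
by rewrite integral_cst//; apply: lte_mul_pinfty I0 If _; exact: fin_num_fun_lty.
Qed.

Let msinY r : measurable_fun setT (fun x => sin (r * (z - Y x))).
Proof.
apply: measurableT_comp; first exact: continuous_measurable_fun (@continuous_sin R).
apply: measurable_funM; first exact: measurable_cst.
by apply: measurable_funB => //; exact: measurable_cst.
Qed.

Let F_x x : (\int[leb]_r (F (x, r))%:E)%E = (h x * gauss_sinc eps (z - Y x))%:E.
Proof.
have -> : (\int[leb]_r (F (x, r))%:E)%E = (\int[leb]_r F (x, r))%:E.
  rewrite /Rintegral fineK//; apply: integrable_fin_num => //.
  apply: (le_integrable _ _ _ intG) => //.
    by apply/(@measurable_EFinP _ _ _ setT (fun r => F (x, r))); exact: mFx.
  by move=> r _; rewrite lee_fin (le_trans (F_le (x, r)))// ler_norm.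
congr EFin; rewrite /gauss_sinc -RintegralZl//; last exact: integrable_gauss_sinc.
rewrite [RHS]Rintegral_mkcond; apply: eq_Rintegral => r _.
by rewrite /F /invp !patchE /=; case: ifPn => // _; rewrite mulr0 mul0r mulr0.
Qed.

Let F_r r : (\int[nu]_x (F (x, r))%:E)%E =
  ((fun r => wexp (fun x => sin (r * (z - Y x))) / r * gaussw eps r) \_ pos r)%:E.
Proof.
have E x : F (x, r) = (invp r * gaussw eps r) * (h x * sin (r * (z - Y x))).
  by rewrite /F /=; ring.
have I : nu.-integrable setT (EFin \o (fun x => h x * sin (r * (z - Y x)))).
  by apply: (@integrable_wexp _ 1) => // x; exact: sin_max.
under eq_integral do rewrite E EFinM.
rewrite integralZl//.
have -> : (\int[nu]_x (h x * sin (r * (z - Y x)))%:E)%E = (wexp (fun x => sin (r * (z - Y x))))%:E.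
  by rewrite /wexp /Rintegral fineK//; exact: integrable_fin_num.
rewrite -EFinM; congr EFin; rewrite /invp !patchE; case: ifPn => _; first by ring.
by rewrite !mul0r.
Qed.

Lemma wexp_sinc : wexp (fun x => gauss_sinc eps (z - Y x)) =
  \int[leb]_(r in pos) (wexp (fun x => sin (r * (z - Y x))) / r * gaussw eps r).
Proof.
have := Fubini intF; under eq_integral do rewrite F_x.
under [X in _ = X -> _]eq_integral do rewrite F_r.
by move=> /(congr1 fine) E; rewrite Rintegral_mkcond.
Qed.

Lemma integrable_wexp_sinc : leb.-integrable pos
  (EFin \o (fun r => wexp (fun x => sin (r * (z - Y x))) / r * gaussw eps r)).
Proof.
apply: (@le_integrable_gaussw _ eps (`|z| + B)) => //.
  apply/measurable_restrictT => //; apply/measurable_EFinP.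
  have := measurable_fubini_G intF; congr (measurable_fun _ _); apply/funext => r.
  exact: F_r.
move=> r r0; rewrite normrM (ger0_norm (gaussw_ge0 _ _)) ler_wpM2r ?gaussw_ge0//.
rewrite normrM normfV (gtr0_norm r0) ler_pdivrMr//.
apply: norm_wexp_le => // x; rewrite (le_trans (sin_norm_le _))//.
by rewrite normrM (gtr0_norm r0) mulrC ler_wpM2r// ltW.
Qed.

End SmoothedExpectation.

Variables (T L delta : R).
Hypothesis T_ge1 : 1 <= T.
Hypothesis L_ge1 : 1 <= L.
(** [gaussw (1 / 2) r ^+ 2] is exp (- r^2 / 4), half of the Gaussian exponent. After division by r,
    one of the two factors absorbs r^2 (their product is at most 8) and the other one is
    integrated. *)
Hypothesis char_close : forall r z : R, 0 < r <= T ->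
  `|wexp (fun x => cos (r * Y x - z)) - cos z * gaussw 1 r| <=
  delta * r ^+ 3 * gaussw (1 / 2) r ^+ 2.

Let eps := L / T.
Let T0 : 0 < T. Proof. exact: lt_le_trans T_ge1. Qed.
Let L0 : 0 < L. Proof. exact: lt_le_trans L_ge1. Qed.
Let eps0 : 0 < eps. Proof. exact: divr_gt0. Qed.

Let msin (r z : R) : measurable_fun setT (fun x => sin (r * (z - Y x))).
Proof.
apply: measurableT_comp; first exact: continuous_measurable_fun (@continuous_sin R).
apply: measurable_funM; first exact: measurable_cst.
by apply: measurable_funB => //; exact: measurable_cst.
Qed.

Let sin_close (r z : R) : 0 < r <= T ->
  `|wexp (fun x => sin (r * (z - Y x))) - sin (r * z) * gaussw 1 r| <=
  delta * r ^+ 3 * gaussw (1 / 2) r ^+ 2.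
Proof.
move=> rT; have := @char_close r (r * z - pi / 2) rT.
have E y : cos (y - pi / 2) = sin y.
  by rewrite cosB cos_pihalf sin_pihalf mulr0 add0r mulr1.
rewrite E (_ : (fun x => cos _) = (fun x => sin (r * (z - Y x))))//.
apply/funext => x; rewrite -E -[LHS]cosN -[RHS]cosN.
have -> : - (r * Y x - (r * z - pi / 2)) = r * (z - Y x) - pi / 2 by ring.
by rewrite cosN.
Qed.

Let wsin_le1 (r z : R) : `|wexp (fun x => sin (r * (z - Y x)))| <= 1.
Proof. by apply: norm_wexp_le => // x; exact: sin_max. Qed.

Let delta0 : 0 <= delta.
Proof.
have : 0 <= delta * 1 ^+ 3 * gaussw (1 / 2) 1 ^+ 2.
  by apply: le_trans (normr_ge0 _) (@char_close 1 0 _); rewrite ltr01.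
by rewrite expr1n mulr1 pmulr_lge0// exprn_gt0// gaussw_gt0.
Qed.

Let b := Num.sqrt (1 + eps ^+ 2).
Let b0 : 0 < b. Proof. by rewrite sqrtr_gt0 ltr_pwDl// sqr_ge0. Qed.

Let gaussw_b r : gaussw b r = gaussw 1 r * gaussw eps r.
Proof.
have : b ^+ 2 = 1 + eps ^+ 2 by rewrite sqr_sqrtr// addr_ge0 ?sqr_ge0.
by rewrite /gaussw -expRD => b2; congr expR; rewrite exprMn b2; field.
Qed.

(** The two summands belong to r <= T and r > T. As sqrt (pi / 2) <= 2, the integrals of
    [gaussw (1 / 2)] and [gaussw (eps / 2)] are at most 4 and 4 / eps. *)
Let err := 8 * delta * 4 + 2 / T * expR (- (L ^+ 2 / 4)) * (4 / eps).

Let sinc_close (z : R) : `|wexp (fun x => gauss_sinc eps (z - Y x)) - gauss_sinc b z| <= err.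
Proof.
rewrite wexp_sinc// /gauss_sinc.
pose W r := wexp (fun x => sin (r * (z - Y x))).
have I1 := integrable_wexp_sinc z eps0.
have I2 := integrable_gauss_sinc z b0.
rewrite -RintegralB//.
have e20 : 0 < eps / 2 by rewrite divr_gt0.
have h20 : 0 < 1 / 2 :> R by [].
pose G r := 8 * delta * gaussw (1 / 2) r + 2 / T * expR (- (L ^+ 2 / 4)) * gaussw (eps / 2) r.
have IG1 : leb.-integrable pos (EFin \o (fun r => 8 * delta * gaussw (1 / 2) r)).
  rewrite (_ : _ \o _ = fun r => ((8 * delta)%:E * (gaussw (1 / 2) r)%:E)%E)//.
  by apply: integrableZl => //; exact: integrable_gaussw_pos.
have IG2 : leb.-integrable pos (EFin \o (fun r => 2 / T * expR (- (L ^+ 2 / 4)) * gaussw (eps / 2) r)).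
  rewrite (_ : _ \o _ = fun r => ((2 / T * expR (- (L ^+ 2 / 4)))%:E * (gaussw (eps / 2) r)%:E)%E)//.
  by apply: integrableZl => //; exact: integrable_gaussw_pos.
have IG : leb.-integrable pos (EFin \o G).
  rewrite (_ : EFin \o G = fun r => ((8 * delta * gaussw (1 / 2) r)%:E +
    (2 / T * expR (- (L ^+ 2 / 4)) * gaussw (eps / 2) r)%:E)%E)//.
  exact: integrableD.
have Gle : \int[leb]_(r in pos) G r <= err.
  rewrite RintegralD// !RintegralZl//; try exact: integrable_gaussw_pos.
  rewrite !integral_gaussw// /err.
  have sq2 : Num.sqrt (pi / 2) <= 2 :> R.
    rewrite -[leRHS]ger0_norm// -sqrtr_sqr ler_wsqrtr//.
    by have := pihalf_lt2 R; move: (@pi R) => *; lra.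
  have T20 : 0 <= 2 / T * expR (- (L ^+ 2 / 4)) by rewrite mulr_ge0 ?expR_ge0// divr_ge0// ltW.
  apply: lerD.
    by rewrite ler_wpM2l ?mulr_ge0// div1r invrK; lra.
  rewrite ler_wpM2l// invfM invrK mulrCA mulrA -mulrA mulrC.
  rewrite ler_wpM2r ?invr_ge0 ?(ltW eps0)//.
  by move: sq2; move: (Num.sqrt _) => q q2; lra.
have pw (r : R) : 0 < r -> `|W r / r * gaussw eps r - sin (r * z) / r * gaussw b r| <= G r.
  move=> r0.
  rewrite gaussw_b mulrA -mulrBl normrM (ger0_norm (gaussw_ge0 _ _)).
  rewrite (_ : W r / r - sin (r * z) / r * gaussw 1 r = (W r - sin (r * z) * gaussw 1 r) / r); last by ring.
  rewrite normrM (ger0_norm (_ : 0 <= r^-1)); last by rewrite invr_ge0 ltW.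
  have G1 : 0 <= 8 * delta * gaussw (1 / 2) r by rewrite mulr_ge0 ?gaussw_ge0// mulr_ge0.
  have G2 : 0 <= 2 / T * expR (- (L ^+ 2 / 4)) * gaussw (eps / 2) r.
    by rewrite mulr_ge0 ?gaussw_ge0// mulr_ge0 ?expR_ge0// divr_ge0// ltW.
  have ri0 : 0 <= r^-1 by rewrite invr_ge0 ltW.
  have [rT|Tr] := leP r T.
    apply: (@le_trans _ _ (8 * delta * gaussw (1 / 2) r)); last by rewrite /G lerDl.
    have rT' : 0 < r <= T by rewrite r0.
    have h1 := sin_close z rT'.
    apply: (@le_trans _ _ (delta * r ^+ 3 * gaussw (1 / 2) r ^+ 2 * r^-1 * 1)).
      by rewrite ler_pM ?gaussw_le1 ?gaussw_ge0 ?mulr_ge0// ler_wpM2r.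
    have -> : delta * r ^+ 3 * gaussw (1 / 2) r ^+ 2 * r^-1 * 1 =
        delta * gaussw (1 / 2) r * (r ^+ 2 * gaussw (1 / 2) r) by field; rewrite gt_eqF.
    have h2 : r ^+ 2 * gaussw (1 / 2) r <= 8.
      rewrite /gaussw expRN ler_pdivrMr ?expR_gt0//.
      have := expR_ge1Dx ((1 / 2 * r) ^+ 2 / 2); rewrite exprMn; lra.
    have h3 : 0 <= delta * gaussw (1 / 2) r by rewrite mulr_ge0 ?gaussw_ge0.
    by have := ler_wpM2l h3 h2; lra.
  apply: (@le_trans _ _ (2 / T * expR (- (L ^+ 2 / 4)) * gaussw (eps / 2) r)); last by rewrite /G lerDr.
  have h1 : `|W r - sin (r * z) * gaussw 1 r| <= 2.
    rewrite (le_trans (ler_normB _ _))// [leRHS](_ : _ = 1 + 1)// lerD//; first exact: wsin_le1.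
    rewrite normrM -[leRHS]mulr1 ler_pM ?sin_max// ger0_norm ?gaussw_ge0 ?gaussw_le1//.
  have h2 : r^-1 <= T^-1 by rewrite lef_pV2 ?posrE// ltW.
  (* For r > T one has eps r >= L, so (eps r)^2 / 2 exceeds L^2 / 4 + (eps r)^2 / 8. *)
  have h3 : gaussw eps r <= expR (- (L ^+ 2 / 4)) * gaussw (eps / 2) r.
    rewrite /gaussw -expRD ler_expR.
    have Lr : L <= eps * r by rewrite /eps mulrAC ler_pdivlMr// ler_wpM2l// ltW.
    have : L ^+ 2 <= (eps * r) ^+ 2 by rewrite lerXn2r// nnegrE ltW// mulr_gt0.
    rewrite (_ : (eps / 2 * r) ^+ 2 = (eps * r) ^+ 2 / 4); last by field.
    have := sqr_ge0 (eps * r); move: ((eps * r) ^+ 2) (L ^+ 2) => *; lra.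
  rewrite -[leRHS]mulrA ler_pM ?gaussw_ge0 ?mulr_ge0// ler_pM//.
have ID : leb.-integrable pos (EFin \o (fun r => W r / r * gaussw eps r -
    sin (r * z) / r * gaussw b r)).
  rewrite (_ : _ \o _ = fun r => ((W r / r * gaussw eps r)%:E -
     (sin (r * z) / r * gaussw b r)%:E)%E)//.
  exact: integrableB.
apply: le_trans Gle; apply: le_trans (le_normr_Rintegral _ ID) _ => //.
apply: le_Rintegral => //; first exact: integrable_norm.
by move=> r /=; rewrite in_itv/= andbT; exact: pw.
Qed.

Let measurable_Phi : measurable_fun setT (@Phi R).
Proof.
apply: continuous_measurable_fun => x; apply: differentiable_continuous.
by apply/derivable1_diffP; have H := is_derive_Phi x; exact: ex_derive.
Qed.

Let mPhiY (z : R) : measurable_fun setT (fun x => Phi ((z - Y x) / eps)).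
Proof.
apply: measurableT_comp => //; apply: measurable_funM; last exact: measurable_cst.
by apply: measurable_funB => //; exact: measurable_cst.
Qed.

Let Phi_norm_le1 (y : R) : `|Phi y| <= 1.
Proof. by rewrite ger0_norm ?Phi_ge0 ?Phi_le1. Qed.

Let smooth_close (z : R) : `|wexp (fun x => Phi ((z - Y x) / eps)) - Phi z| <= err + eps ^+ 2.
Proof.
rewrite -[X in X - Phi z](subrK (Phi (z / b))) -addrA.
apply: ler_normD_le; last exact: Phi_scale_le.
have E : wexp (fun x => gauss_sinc eps (z - Y x)) =
    pi * wexp (fun x => Phi ((z - Y x) / eps)) - pi / 2.
  rewrite (_ : (fun x => gauss_sinc eps (z - Y x)) =
      (fun x => pi * Phi ((z - Y x) / eps) + - (pi / 2))); last first.
    apply/funext => x; rewrite (Phi_sinc _ eps0).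
    by move: (gt_eqF (pi_gt0 R)); move: (@pi R) => p p0; field; rewrite p0.
  rewrite (wexpD (C := pi) (D := pi)).
  - rewrite (wexpZ (C := 1)) ?wexp_cst// => x; exact: Phi_norm_le1.
  - by apply: measurable_funM => //; exact: measurable_cst.
  - exact: measurable_cst.
  - by move=> x; rewrite normrM (ger0_norm (pi_ge0 R)) ler_piMr ?pi_ge0.
  - by move=> x; rewrite normrN ger0_norm ?divr_ge0 ?pi_ge0//; have := pi_ge0 R; lra.
have := sinc_close z; rewrite E (Phi_sinc _ b0).
have p1 : 1 <= pi :> R by rewrite (le_trans _ (pi_ge2 R))// ler1n.
move: p1 (wexp _) (gauss_sinc b z) => p1 w g H.
have -> : w - (1 / 2 + g / pi) = pi^-1 * (pi * w - pi / 2 - g).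
  by move: p1; move: (@pi R) => p p1; field; rewrite gt_eqF// (lt_le_trans _ p1).
rewrite normrM ger0_norm ?invr_ge0 ?pi_ge0// ler_pdivrMl ?pi_gt0//.
have err0 := le_trans (normr_ge0 _) H.
by apply: le_trans H _; rewrite ler_peMl.
Qed.

Let err_le : err <= 32 * delta + 8 * expR (- (L ^+ 2 / 4)).
Proof.
rewrite /err; apply: lerD; first by lra.
have -> : 2 / T * expR (- (L ^+ 2 / 4)) * (4 / eps) = 8 * expR (- (L ^+ 2 / 4)) * L^-1.
  by rewrite /eps; field; rewrite !gt_eqF.
by rewrite ler_piMr ?invf_le1// mulr_ge0 ?expR_ge0.
Qed.

(* Up to Phi (- L), the indicator of Y <= x lies between Phi ((x - eps L - Y) / eps) and
   Phi ((x + eps L - Y) / eps): Y is perturbed by a Gaussian of standard deviation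
   eps = L / T, whose Fourier transform cuts off the frequencies r > T. *)
Theorem smoothing_inequality (x : R) :
  `|wexp (fun w => (Y w <= x)%R%:R) - Phi x| <=
  32 * delta + 2 * (L ^+ 2 / T) + 10 * expR (- (L ^+ 2 / 4)).
Proof.
have Ldiv y : (x + eps * L - y) / eps = L + (x - y) / eps.
  by field; rewrite gt_eqF.
have Ldiv' y : (x - eps * L - y) / eps = - L + (x - y) / eps.
  by field; rewrite gt_eqF.
have mI : measurable_fun setT (fun w => (Y w <= x)%R%:R : R).
  rewrite (_ : (fun w => _) = \1_(Y @^-1` `]-oo, x]%classic)).
    by apply: measurable_indic; rewrite -[_ @^-1` _]setTI; exact: mY.
  apply/funext => w; rewrite indicE.
  have -> : (w \in Y @^-1` `]-oo, x]%classic) = (Y w <= x)%R; last by [].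
  by apply/idP/idP; rewrite inE /= in_itv.
have I1 w : `|(Y w <= x)%R%:R : R| <= 1 by rewrite ger0_norm// lern1 leq_b1.
have PD z w : `|Phi ((z - Y w) / eps) + Phi (- L)| <= 2.
  by rewrite (le_trans (ler_normD _ _))// [leRHS](_ : _ = 1 + 1)// lerD.
have ID w : `|(Y w <= x)%R%:R + Phi (- L) : R| <= 2.
  by rewrite (le_trans (ler_normD _ _))// [leRHS](_ : _ = 1 + 1)// lerD.
have PL := PhiN_le_expR (ltW L0).
have e1 : eps * L = L ^+ 2 / T by rewrite /eps; ring.
have e2 : eps ^+ 2 <= L ^+ 2 / T.
  rewrite -e1 expr2 ler_wpM2l ?(ltW eps0)// /eps ler_pdivrMr// ler_peMr//.
  exact: ltW.
have up : wexp (fun w => (Y w <= x)%R%:R) <=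
    wexp (fun w => Phi ((x + eps * L - Y w) / eps)) + Phi (- L).
  rewrite -[Phi (- L)]wexp_cst -(wexpD (C := 1) (D := 1))//.
  apply: (@le_wexp _ _ 1 2) => //.
    by apply: measurable_funD => //; exact: measurable_cst.
  move=> w; have := Phi_ge0 (- L); case: (leP (Y w) x) => Yx P0; last by rewrite addr_ge0// Phi_ge0.
  rewrite Ldiv PhiN; have : Phi L <= Phi (L + (x - Y w) / eps).
    by apply: Phi_le; rewrite lerDl divr_ge0 ?subr_ge0 ?(ltW eps0).
  by rewrite /=; lra.
have lo : wexp (fun w => Phi ((x - eps * L - Y w) / eps)) <=
    wexp (fun w => (Y w <= x)%R%:R) + Phi (- L).
  rewrite -[Phi (- L)]wexp_cst -(wexpD (C := 1) (D := 1))//.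
  apply: (@le_wexp _ _ 1 2) => //.
    by apply: measurable_funD => //; exact: measurable_cst.
  move=> w; case: (leP (Y w) x) => Yx.
    by have := Phi_ge0 (- L); have := Phi_le1 ((x - eps * L - Y w) / eps); rewrite /=; lra.
  rewrite add0r Ldiv'; apply: Phi_le; rewrite gerDl.
  by rewrite nmulr_rle0 ?invr_ge0 ?(ltW eps0)// subr_lt0.
have eL0 := ltW (mulr_gt0 eps0 L0).
have p1 : `|Phi (x + eps * L) - Phi x| <= eps * L.
  by apply: le_trans (Phi_lipschitz _ _) _; rewrite addrAC subrr add0r ger0_norm.
have p2 : `|Phi (x - eps * L) - Phi x| <= eps * L.
  by apply: le_trans (Phi_lipschitz _ _) _; rewrite addrAC subrr add0r normrN ger0_norm.
rewrite -e1 in e2 *.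
exact: smoothing_arith up lo (smooth_close (x + eps * L)) (smooth_close (x - eps * L)) p1 p2 err_le PL e2.
Qed.

End Smoothing.
(** * From characteristic functions to the rate *)

Section CltRate.
Context {R : realType}.
Implicit Types (r q g d A P e : R).

Lemma exprn1D_sub1_le e n : 0 <= e -> (1 + e) ^+ n - 1 <= n%:R * e * expR (n%:R * e).
Proof.
move=> e0; have h1 : (1 + e) ^+ n <= expR (n%:R * e).
  by rewrite expRM_natl; apply: lerXn2r; rewrite ?nnegrE ?expR_ge0 ?expR_ge1Dx ?addr_ge0.
have h2 := expR_ge1Dx (- (n%:R * e)); have h3 := expRxMexpNx_1 (n%:R * e).
have h4 := ler_wpM2l (expR_ge0 (n%:R * e)) h2.
rewrite h3 in h4; move: h1 h4; move: ((1 + e) ^+ n) (expR (n%:R * e)) => a b; lra.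
Qed.

Section Numbers.
(** In the application g = sqrt n, P = n^(1/p), q = sigma_n >= d g, and r / q is the frequency t of
    the unnormalised sum. The constants of a step are then A P for s and A P^3 for A, whence the
    power P^7. *)
Variables (A d g P q r : R).
Hypotheses (A1 : 1 <= A) (d0 : 0 < d) (d1 : d <= 1) (P1 : 1 <= P) (g0 : 0 < g).
Hypothesis dgq : d * g <= q.
Hypothesis r0 : 0 < r.
Let k := 200 * A ^+ 3 / d ^+ 3.
Hypothesis rT : r <= g / (4 * k * P ^+ 7).

Let A0 : 0 < A. Proof. exact: lt_le_trans ltr01 A1. Qed.
Let P0 : 0 < P. Proof. exact: lt_le_trans ltr01 P1. Qed.
Let q0 : 0 < q. Proof. by apply: lt_le_trans dgq; exact: mulr_gt0. Qed.
Let k0 : 0 < k. Proof.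
apply: divr_gt0; last exact: exprn_gt0.
by apply: mulr_gt0; [rewrite ltr0n|exact: exprn_gt0].
Qed.

Let rT' : r * (800 * A ^+ 3 * P ^+ 7) <= g * d ^+ 3.
Proof.
move: rT; rewrite ler_pdivlMr; last first.
  by apply: mulr_gt0; [apply: mulr_gt0|exact: exprn_gt0].
have -> : r * (4 * k * P ^+ 7) = r * (800 * A ^+ 3 * P ^+ 7) / d ^+ 3.
  by rewrite /k; field; rewrite gt_eqF.
by rewrite ler_pdivrMr// exprn_gt0.
Qed.

Lemma clt_freq_small : `|r / q| * (A * P ^+ 3) <= 1 / 16.
Proof.
rewrite gtr0_norm ?divr_gt0// mulrAC ler_pdivrMr//.
have h1 : r * (A * P ^+ 3) <= r * (A ^+ 3 * P ^+ 7).
  apply: ler_wpM2l; first exact: ltW.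
  apply: ler_pM; rewrite ?exprn_ge0 ?(ltW A0) ?(ltW P0)//; last by rewrite ler_weXn2l.
  by rewrite -[leLHS]expr1 ler_weXn2l.
have h2 : g * d ^+ 3 <= q.
  apply: le_trans dgq; rewrite mulrC ler_wpM2r ?(ltW g0)//.
  by rewrite -{2}[d]expr1 ler_wiXn2l// ltW.
move: h1 h2 rT'; rewrite (_ : r * (800 * _ * _) = 800 * (r * (A ^+ 3 * P ^+ 7))); last by ring.
move: (r * (A ^+ 3 * P ^+ 7)) (r * (A * P ^+ 3)) (g * d ^+ 3) => a b c h1 h2 h3; have := q0; lra.
Qed.

(** The range of r gives k P^7 r / g <= 1/4, hence n e <= r^2 / 4: the factor exp (n e) in (1 + e)^n
    - 1 <= n e exp (n e) consumes only half of the Gaussian exponent r^2 / 2. *)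
Lemma clt_char_error n : g ^+ 2 = n%:R ->
  expR (- (r ^+ 2 / 2)) *
    ((1 + 200 * `|r / q| ^+ 3 * (A * P) * (A * P ^+ 3) ^+ 2) ^+ n - 1) <=
  k * P ^+ 7 / g * r ^+ 3 * expR (- (r ^+ 2 / 4)).
Proof.
move=> gn; set e := 200 * _ * _ * _.
have e0 : 0 <= e.
  apply: mulr_ge0; last by rewrite exprn_ge0// mulr_ge0 ?exprn_ge0 ?ltW.
  by apply: mulr_ge0; [apply: mulr_ge0; [by rewrite ler0n|exact: exprn_ge0]|apply: mulr_ge0; exact: ltW].
have kr0 : 0 <= k * P ^+ 7 / g * r ^+ 3.
  by rewrite mulr_ge0 ?exprn_ge0 ?ltW// divr_gt0// mulr_gt0// exprn_gt0.
have ne : n%:R * e <= k * P ^+ 7 / g * r ^+ 3.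
  have -> : n%:R * e = (200 * A ^+ 3 * P ^+ 7 * r ^+ 3 * g ^+ 2) / q ^+ 3.
    by rewrite /e gtr0_norm ?divr_gt0// -gn; field; rewrite gt_eqF.
  rewrite ler_pdivrMr ?exprn_gt0//.
  have -> : 200 * A ^+ 3 * P ^+ 7 * r ^+ 3 * g ^+ 2 = k * P ^+ 7 / g * r ^+ 3 * (d * g) ^+ 3.
    by rewrite /k; field; rewrite !gt_eqF.
  by rewrite ler_wpM2l// lerXn2r// nnegrE ?mulr_ge0// ltW.
have rr : k * P ^+ 7 / g * r ^+ 3 <= r ^+ 2 / 4.
  have -> : k * P ^+ 7 / g * r ^+ 3 = r ^+ 2 * (k * P ^+ 7 * r / g) by ring.
  rewrite ler_wpM2l ?sqr_ge0// ler_pdivrMr//.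
  move: rT; rewrite ler_pdivlMr; last by apply: mulr_gt0; [apply: mulr_gt0|exact: exprn_gt0].
  by rewrite (_ : r * _ = 4 * (k * P ^+ 7 * r)); [lra|ring].
apply: le_trans (_ : _ <= expR (- (r ^+ 2 / 2)) * (n%:R * e * expR (n%:R * e))) _.
  by rewrite ler_wpM2l ?expR_ge0// exprn1D_sub1_le.
move: (n%:R * e) (mulr_ge0 (ler0n R n) e0) ne (le_trans ne rr) => y y0 yk yr.
rewrite mulrCA -expRD; apply: (ler_pM y0 (expR_ge0 _) yk).
by rewrite ler_expR; move: yr; lra.
Qed.

End Numbers.

(** One term of the exponential series is enough: with m + 1 >= p / 2 and P = n^(1/p) the right-hand
    side is O(n^(-1/2)), below the rate. *)
Lemma expRN_quarter_le P m : 1 <= P -> expR (- (P / 4)) <= m.+1`!%:R * 4 ^+ m.+1 / P ^+ m.+1.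
Proof.
move=> P1; have P0 : 0 < P by exact: lt_le_trans ltr01 P1.
have h := @expR_ge1Dxn R (P / 4) m (ltW (divr_gt0 P0 (ltr0n _ 4))).
have f0 : 0 < (m.+1)`!%:R :> R by rewrite ltr0n fact_gt0.
rewrite expRN -[leRHS]invrK lef_pV2 ?posrE ?expR_gt0 ?invr_gt0 ?divr_gt0 ?mulr_gt0 ?exprn_gt0//.
apply: le_trans h; apply: le_trans (_ : _ <= (P / 4) ^+ m.+1 / (m.+1)`!%:R) _.
  by rewrite expr_div_n le_eqVlt; apply/orP; left; apply/eqP; field; rewrite !gt_eqF ?exprn_gt0.
by rewrite lerDr.
Qed.

Lemma powRn_eventually_ge (e K : R) : 0 < e ->
  exists N : nat, forall n : nat, (N <= n)%N -> (0 < n)%N /\ K <= n%:R `^ e.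
Proof.
move=> e0; exists (Num.bound (`|K| `^ e^-1)).+1 => n Nn; split; first exact: leq_trans Nn.
have h1 : `|K| `^ e^-1 <= n%:R.
  apply: le_trans (ltW (archi_boundP _)) _; first exact: powR_ge0.
  by rewrite ler_nat; exact: leq_trans (leqnSn _) Nn.
apply: le_trans (ler_norm K) _.
have -> : `|K| = (`|K| `^ e^-1) `^ e by rewrite -powRrM mulVf ?lt0r_neq0// powRr1.
by apply: ge0_ler_powR; rewrite ?nnegrE ?powR_ge0// ltW.
Qed.

Section Rate.
Context {d : measure_display} {X : measurableType d} (nu : {finite_measure set X -> \bar R}).
Variables (h : X -> R) (M : R) (Z : nat -> X -> R) (B V : nat -> R) (p A c : R) (N0 : nat).
Hypothesis mh : measurable_fun setT h.
Hypothesis h_ge0 : forall x, 0 <= h x.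
Hypothesis h_le : forall x, h x <= M.
Hypothesis h1 : wexp nu h (fun=> 1) = 1.
Hypothesis mZ : forall n, measurable_fun setT (Z n).
Hypothesis Z_le : forall n x, `|Z n x| <= B n.
Hypothesis p16 : 16 < p.
Hypothesis A1 : 1 <= A.
Hypothesis c0 : 0 < c.
Hypothesis c1 : c <= 1.
Hypothesis cV : forall n, (N0 <= n)%N -> c ^+ 2 * n%:R <= V n.
Hypothesis char_bound : forall n (t z : R), (0 < n)%N ->
  `|t| * (A * n%:R `^ (3 / p)) <= 1 / 16 ->
  `|wexp nu h (fun x => cos (t * Z n x - z)) - cos z * expR (- (t ^+ 2 * V n / 2))| <=
  expR (- (t ^+ 2 * V n / 2)) *
  ((1 + 200 * `|t| ^+ 3 * (A * n%:R `^ p^-1) * (A * n%:R `^ (3 / p)) ^+ 2) ^+ n - 1).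

Theorem clt_rate : exists (C : R) (N : nat), forall n, (N <= n)%N -> forall z : R,
  `|wexp nu h (fun x => (Z n x <= z * Num.sqrt (V n))%R%:R) - Phi z| <=
  C * n%:R `^ (- (2^-1 - 8 / p)).
Proof.
have p0 : 0 < p by apply: lt_trans p16; rewrite ltr0n.
have A0 : 0 < A by exact: lt_le_trans ltr01 A1.
pose e := 2^-1 - 8 / p.
have e0 : 0 < e.
  rewrite subr_gt0 ltr_pdivrMr//; move: p16; lra.
pose k := 200 * A ^+ 3 / c ^+ 3.
have k0 : 0 < k.
  apply: divr_gt0; last exact: exprn_gt0.
  by apply: mulr_gt0; [rewrite ltr0n|exact: exprn_gt0].
(* T >= 1 amounts to 4 k P^7 <= g = n^e P^8 and so holds once n^e >= 4 k; the condition e > 0 is p >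
   16. *)
have [N1 HN1] := powRn_eventually_ge (4 * k) e0.
pose m := Num.bound (p / 2).
have pm : p / 2 <= m.+1%:R.
  apply: le_trans (ltW (archi_boundP _)) _; first by rewrite divr_ge0// ltW.
  by rewrite ler_nat leqnSn.
pose C' : R := m.+1`!%:R * 4 ^+ m.+1.
exists (40 * k + 10 * C'), (maxn N0 N1) => n; rewrite geq_max => /andP[n0 /HN1[n_gt0 kn]] z.
pose P := n%:R `^ p^-1 : R; pose g := Num.sqrt n%:R : R.
have n1 : 1 <= n%:R :> R by rewrite ler1n.
have nn0 : n%:R != 0 :> R by rewrite pnatr_eq0 -lt0n.
have P1 : 1 <= P by rewrite -[leLHS](powRr0 n%:R) ler_powR// invr_ge0 ltW.
have P0 : 0 < P by exact: lt_le_trans ltr01 P1.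
have g0 : 0 < g by rewrite sqrtr_gt0 (lt_le_trans ltr01).
have g2 : g ^+ 2 = n%:R by rewrite sqr_sqrtr// (le_trans ler01).
have Pn j : P ^+ j = n%:R `^ (j%:R / p).
  by rewrite /P -powR_mulrn ?powR_ge0// -powRrM mulrC.
have gE : g = n%:R `^ e * P ^+ 8.
  rewrite Pn -powRD ?nn0 ?implybT// /g -powR12_sqrt ?(le_trans ler01)//.
  by rewrite /e subrK.
have q_ge : c * g <= Num.sqrt (V n).
  have -> : c * g = Num.sqrt ((c * g) ^+ 2) by rewrite sqrtr_sqr gtr0_norm// mulr_gt0.
  by apply: ler_wsqrtr; rewrite exprMn g2; exact: cV.
have q0 : 0 < Num.sqrt (V n) by apply: lt_le_trans q_ge; exact: mulr_gt0.
have Vq : Num.sqrt (V n) ^+ 2 = V n.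
  by rewrite sqr_sqrtr// ltW// -sqrtr_gt0.
set q := Num.sqrt (V n) in q_ge q0 Vq *.
(* T is the largest frequency that [clt_char_error] admits. L^2 = P makes exp (- L^2 / 4) smaller
   than any power of n, at the price of one factor P: 2 L^2 / T is of order P^8 / g, which is the
   rate. *)
pose T := g / (4 * k * P ^+ 7); pose L := n%:R `^ (p^-1 / 2) : R.
have L2 : L ^+ 2 = P by rewrite -powR_mulrn ?powR_ge0// -powRrM divfK.
have L1 : 1 <= L by rewrite -[leLHS](powRr0 n%:R) ler_powR// divr_ge0// invr_ge0 ltW.
have den0 : 0 < 4 * k * P ^+ 7 by apply: mulr_gt0; [apply: mulr_gt0|exact: exprn_gt0].
have T1 : 1 <= T.
  rewrite ler_pdivlMr// mul1r gE; apply: ler_pM kn _.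
  - by apply: mulr_ge0; [rewrite ler0n|exact: ltW].
  - by rewrite exprn_ge0// ltW.
  - by rewrite ler_weXn2l.
pose Y x := Z n x / q.
have mY : measurable_fun setT Y by apply: measurable_funM => //; exact: measurable_cst.
have YB x : `|Y x| <= B n / q.
  have iq : 0 <= q^-1 by rewrite invr_ge0 ltW.
  by rewrite normrM [X in _ * X]ger0_norm// ler_wpM2r.
have P3 : n%:R `^ (3 / p) = P ^+ 3 by rewrite Pn.
have char_close r z' : 0 < r <= T ->
    `|wexp nu h (fun x => cos (r * Y x - z')) - cos z' * gaussw 1 r| <=
    (k * P ^+ 7 / g) * r ^+ 3 * gaussw (1 / 2) r ^+ 2.
  move=> /andP[r0 rT].
  have E1 : (fun x => cos (r * Y x - z')) = (fun x => cos (r / q * Z n x - z')).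
    by apply/funext => x; rewrite /Y; congr cos; ring.
  have G1 : gaussw 1 r = expR (- ((r / q) ^+ 2 * V n / 2)).
    by rewrite /gaussw -Vq; congr expR; field; rewrite gt_eqF.
  have G2 : gaussw (1 / 2) r ^+ 2 = expR (- (r ^+ 2 / 4)).
    by rewrite /gaussw -expRM_natl; congr expR; field.
  have small := clt_freq_small A1 c0 c1 P1 g0 q_ge r0 rT.
  have err := clt_char_error A1 c0 P1 g0 q_ge r0 rT g2.
  rewrite E1 G1 G2; apply: le_trans (char_bound z' n_gt0 _) _; rewrite P3//.
  by move: err; rewrite -/P; congr (expR _ * _ <= _); rewrite -Vq; field; rewrite gt_eqF.
have := smoothing_inequality mh mY h_ge0 h_le YB h1 T1 L1 char_close z.
have -> : (fun x => (Y x <= z)%R%:R : R) = (fun x => (Z n x <= z * q)%R%:R).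
  by apply/funext => x; rewrite /Y ler_pdivrMr.
move=> /le_trans; apply; rewrite L2.
have rateE : n%:R `^ (- (2^-1 - 8 / p)) = P ^+ 8 / g.
  by rewrite powRN -/e gE; field; rewrite !gt_eqF ?exprn_gt0// powR_gt0// (lt_le_trans ltr01).
rewrite rateE; have P8 : P ^+ 7 <= P ^+ 8 by rewrite ler_weXn2l.
have s1 : 32 * (k * P ^+ 7 / g) <= 32 * k * (P ^+ 8 / g).
  have : k * (P ^+ 7 / g) <= k * (P ^+ 8 / g).
    by apply: ler_wpM2l (ltW k0) _ _ _; rewrite ler_wpM2r// invr_ge0 ltW.
  by rewrite -(mulrA k) -(mulrA 32); move: (k * _) (k * _) => a1 a2; lra.
have s2 : 2 * (P / T) = 8 * k * (P ^+ 8 / g).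
  by rewrite /T; field; rewrite !gt_eqF.
have s3 : 10 * expR (- (P / 4)) <= 10 * C' * (P ^+ 8 / g).
  rewrite -mulrA ler_wpM2l//; apply: le_trans (expRN_quarter_le m P1) _.
  have C0 : 0 <= C' by rewrite mulr_ge0// exprn_ge0.
  rewrite -/C' ler_wpM2l//; apply: (@le_trans _ _ g^-1).
    rewrite lef_pV2 ?posrE ?exprn_gt0// Pn /g -powR12_sqrt ?(le_trans ler01)//.
    by rewrite ler_powR// ler_pdivlMr// mulrC.
  by rewrite ler_peMl ?invr_ge0 ?(ltW g0)// exprn_ege1.
by rewrite s2; move: s1 s3; move: (P ^+ 8 / g) => *; lra.
Qed.

End Rate.

End CltRate.
Lemma Rintegral_dominated_cvg {R : realType} d (Y : measurableType d)
    (m : {measure set Y -> \bar R}) (D : set Y) (f_ : nat -> Y -> R) (f g : Y -> R) :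
  measurable D -> (forall n, measurable_fun D (f_ n)) ->
  (forall x, D x -> f_ ^~ x @ \oo --> f x) ->
  m.-integrable D (EFin \o g) -> (forall n x, D x -> `|f_ n x| <= g x) ->
  (fun n => \int[m]_(x in D) f_ n x) @ \oo --> \int[m]_(x in D) f x.
Proof.
move=> mD mf_ ff ig fg.
have mf : measurable_fun D f by exact: measurable_fun_cvg ff.
have [|||||H1 _ H2] := @dominated_convergence _ _ _ m D mD (fun n => EFin \o f_ n) (EFin \o f) (EFin \o g).
- by move=> n; exact/measurable_EFinP.
- exact/measurable_EFinP.
- by apply: aeW => x Dx /=; apply/cvg_EFin; [exact: nearW|exact: ff].
- exact: ig.
- by apply: aeW => x n Dx /=; rewrite lee_fin; exact: fg.
rewrite /Rintegral; apply: fine_cvg; rewrite fineK; first exact: H2.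
exact: integrable_fin_num.
Qed.

(** * Transfer operators and Gibbs measures *)

Section CountingSums.
Context {R : realType}.
Implicit Types (I : set nat) (a : nat -> R).
Local Notation cnt := (@counting nat R).

Lemma ge0_integral_counting I (f : nat -> \bar R) : (forall i, I i -> (0 <= f i)%E) ->
  (\int[cnt]_(i in I) f i = \esum_(i in I) f i)%E.
Proof.
move=> f0; rewrite integral_mkcond ge0_integral_count.
  rewrite nneseries_esumT.
    by rewrite [RHS]esum_mkcond; apply: eq_esum => i _; rewrite patchE.
  by move=> i; rewrite patchE; case: ifPn => //; rewrite inE => /f0.
by move=> i; rewrite patchE; case: ifPn => //; rewrite inE => /f0.
Qed.

Lemma integrable_counting I a : cnt.-integrable I (EFin \o a) <->
  (\esum_(i in I) (`|a i|)%:E < +oo)%E.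
Proof.
split => [/integrableP[_]|aI].
  by rewrite ge0_integral_counting//.
by apply/integrableP; split => //; rewrite ge0_integral_counting.
Qed.

(** As integrals for the counting measure, transfer operators with countably many branches inherit
    linearity, monotonicity and dominated convergence. *)
Lemma rsum_counting I a : cnt.-integrable I (EFin \o a) ->
  rsum I a = \int[cnt]_(i in I) a i.
Proof.
move=> aI; rewrite /Rintegral integralE fineB; last 2 first.
- exact: integrable_pos_fin_num.
- exact: integrable_neg_fin_num.
rewrite !ge0_integral_counting//.
by congr (fine _ - fine _); apply: eq_esum => i _; rewrite ?funeposE ?funenegE EFin_max.
Qed.

End CountingSums.

(** * Inverse branches of the transfer operator *)

Section Branches.
Context {R : realType} {dO : measure_display} {Omega : measurableType dO}.
Context {dX : measure_display} {X : measurableType dX}.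
Variables (theta : Omega -> Omega) (E : set (Omega * X)) (T : Omega -> X -> X)
  (phi : Omega -> X -> R).
Local Notation Fib := (Fib E).
Local Notation Lop := (Lop E T phi).
Local Notation cnt := (@counting nat R).

(** What the two settings have in common. The contraction of the branches is left out, since its
    form differs between them. *)
Definition branches w (I : set nat) (y : nat -> X -> X) (D : R) :=
  (forall x, Fib (theta w) x ->
    [/\ (forall i, I i -> preim E T w x (y i x)),
       (forall i j, I i -> I j -> y i x = y j x -> i = j) &
       (forall z, preim E T w x z -> exists2 i, I i & z = y i x)]) /\
  (forall x, Fib (theta w) x ->
    (\esum_(z in preim E T w x) (expR (phi w z))%:E <= D%:E)%E).

Variables (w : Omega) (I : set nat) (y : nat -> X -> X) (D : R).
Hypothesis ybr : branches w I y D.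

Definition bweight (f : X -> R) x i := expR (phi w (y i x)) * f (y i x).

Lemma preim_bij x : Fib (theta w) x -> set_bij I (preim E T w x) (y ^~ x).
Proof.
move=> /(proj1 ybr)[h1 h2 h3]; split => //.
- by move=> i j; rewrite !inE; exact: h2.
- by move=> z /h3[i Ii ->]; exists i.
Qed.

Lemma Fib_branch x i : Fib (theta w) x -> I i -> Fib w (y i x).
Proof. by move=> /(proj1 ybr)[h1 _ _] /h1[]. Qed.

Lemma esum_branch x (F : X -> \bar R) : Fib (theta w) x ->
  (\esum_(z in preim E T w x) F z = \esum_(i in I) F (y i x))%E.
Proof. by move=> /preim_bij; exact: reindex_esum. Qed.

Lemma integrable_bweight x f : Fib (theta w) x -> bounded_on (Fib w) f ->
  cnt.-integrable I (EFin \o bweight f x).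
Proof.
move=> xF [K fK].
have int1 : cnt.-integrable I (EFin \o (fun i => expR (phi w (y i x)))).
  apply/integrable_counting; rewrite -(esum_branch (fun z => `|expR (phi w z)|%:E))//.
  under eq_esum do rewrite ger0_norm ?expR_ge0//.
  by rewrite (le_lt_trans (proj2 ybr x xF))// ltry.
have : cnt.-integrable I (fun i => K%:E * (expR (phi w (y i x)))%:E)%E.
  by apply: integrableZl.
apply: le_integrable => // i Ii /=; rewrite lee_fin /bweight !normrM mulrC.
by apply: ler_wpM2r => //; rewrite (le_trans (fK _ (Fib_branch xF Ii)))// ler_norm.
Qed.

Lemma LopE x f : Fib (theta w) x -> bounded_on (Fib w) f ->
  Lop w f x = \int[cnt]_(i in I) bweight f x i.
Proof.
move=> xF fb; rewrite -rsum_counting; last exact: integrable_bweight.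
by rewrite /Lop /rsum !esum_branch.
Qed.

Lemma Lop_linear x a f g : Fib (theta w) x ->
  bounded_on (Fib w) f -> bounded_on (Fib w) g ->
  Lop w (a *: f + g) x = a * Lop w f x + Lop w g x.
Proof.
move=> xF fb gb.
have ib := integrable_bweight xF.
have afb : bounded_on (Fib w) (a *: f).
  case: fb => K fK; exists (`|a| * K) => z zF.
  by rewrite fct_pointwise normrM ler_wpM2l// fK.
have sb : bounded_on (Fib w) (a *: f + g).
  case: afb gb => K fK [K' gK]; exists (K + K') => z zF.
  by rewrite fct_pointwise ler_normD_le ?fK ?gK.
rewrite !LopE// -RintegralZl//; last exact: ib.
rewrite -RintegralD//; last 2 first.
- rewrite (_ : _ \o _ = EFin \o bweight (a *: f) x); first exact: ib.
  by apply/funext => i; rewrite /bweight /= !fct_pointwise; congr EFin; ring.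
- exact: ib.
by apply: eq_Rintegral => i _; rewrite /bweight !fct_pointwise; ring.
Qed.

Lemma Lop0 x : Fib (theta w) x -> Lop w 0 x = 0.
Proof.
move=> xF; have b0 : bounded_on (Fib w) (0 : X -> R) by exists 0 => z _; rewrite normr0.
by have := Lop_linear (-1) xF b0 b0; rewrite scaler0 addr0; lra.
Qed.

Lemma LopZ_branch x a f : Fib (theta w) x -> bounded_on (Fib w) f ->
  Lop w (a *: f) x = a * Lop w f x.
Proof.
move=> xF fb; have b0 : bounded_on (Fib w) (0 : X -> R) by exists 0 => z _; rewrite normr0.
by rewrite -[_ *: _]addr0 Lop_linear// Lop0// addr0.
Qed.

(** Two base points are compared through branches of equal index; the distortion estimates of
    setting A rest on this. *)
Lemma le_Lop_branch x x' f g : Fib (theta w) x -> Fib (theta w) x' ->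
  bounded_on (Fib w) f -> bounded_on (Fib w) g ->
  (forall i, I i -> bweight f x i <= bweight g x' i) -> Lop w f x <= Lop w g x'.
Proof.
by move=> xF xF' fb gb fg; rewrite !LopE// le_Rintegral//; exact: integrable_bweight.
Qed.

Lemma le_Lop x f g : Fib (theta w) x ->
  bounded_on (Fib w) f -> bounded_on (Fib w) g ->
  (forall z, Fib w z -> f z <= g z) -> Lop w f x <= Lop w g x.
Proof.
move=> xF fb gb fg; apply: le_Lop_branch => // i Ii.
by rewrite /bweight ler_wpM2l ?expR_ge0// fg//; exact: Fib_branch.
Qed.

Lemma eq_Lop x f g : Fib (theta w) x -> {in Fib w, f =1 g} -> Lop w f x = Lop w g x.
Proof.
move=> xF fg; rewrite /Lop /rsum !esum_branch//.
by congr (fine _ - fine _); apply: eq_esum => i Ii; rewrite fg// inE; exact: Fib_branch.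
Qed.

Lemma Lop_cvg x (f_ : nat -> X -> R) f K : Fib (theta w) x ->
  (forall n z, Fib w z -> `|f_ n z| <= K) -> (forall z, Fib w z -> f_ ^~ z @ \oo --> f z) ->
  (fun n => Lop w (f_ n) x) @ \oo --> Lop w f x.
Proof.
move=> xF fK ff.
have f_b n : bounded_on (Fib w) (f_ n) by exists K; exact: fK.
have fb : bounded_on (Fib w) f.
  exists K => z zF; rewrite -(cvg_lim _ (cvg_norm (ff z zF)))//.
  apply: limr_le; first by apply: is_cvg_norm; apply/cvg_ex; exists (f z); exact: ff.
  by apply: nearW => n; exact: fK.
rewrite LopE//; under eq_fun do rewrite LopE//.
have cK : bounded_on (Fib w) (cst K) by exists `|K|.
apply: (@Rintegral_dominated_cvg _ _ _ _ _ _ _ (bweight (cst K) x)) => //.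
- move=> i Ii; rewrite /bweight; apply: cvgM; first exact: cvg_cst.
  by apply: ff; exact: Fib_branch.
- exact: integrable_bweight.
move=> n i Ii; rewrite /bweight normrM ger0_norm ?expR_ge0// ler_wpM2l ?expR_ge0//.
by apply: fK; exact: Fib_branch.
Qed.

Lemma Lop1_gt0 x i : Fib (theta w) x -> I i -> 0 < Lop w (one (R := R)) x.
Proof.
move=> xF Ii; have b1 : bounded_on (Fib w) (one (R := R)).
  by exists 1 => z _; rewrite /one normr1.
rewrite LopE//; apply: (@lt_le_trans _ _ (bweight one x i)).
  by rewrite /bweight mulr1 expR_gt0.
have ib := integrable_bweight xF b1.
rewrite -lee_fin /Rintegral fineK; last exact: integrable_fin_num.
rewrite ge0_integral_counting => [|j _]; last by rewrite lee_fin mulr_ge0 ?expR_ge0.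
apply: esum_ge; exists [set i]; first by split => // _ ->.
by rewrite fsbig_set1.
Qed.

End Branches.
Import HBSimple HBNNSimple.
(** The functional monotone class theorem, for bounded pointwise convergence of sequences:
    indicators by a lambda-system argument, then simple functions, nonnegative bounded functions by
    approximation from below, and general ones after adding a constant. *)
Lemma bounded_monotone_class {R : realType} d (Y : measurableType d)
    (G : set (set Y)) (F : set (Y -> R)) :
  @measurable _ Y = <<s G >> -> setI_closed G ->
  F (cst 1) -> (forall a f g, F f -> F g -> F (a *: f + g)) ->
  (forall (f_ : nat -> Y -> R) (f : Y -> R) (K : R), (forall n, F (f_ n)) -> (forall n x, `|f_ n x| <= K) ->
     (forall x, f_ ^~ x @ \oo --> f x) -> F f) ->
  (forall A, G A -> F (\1_A)) ->
  forall f : Y -> R, measurable_fun setT f -> (exists K : R, forall x, `|f x| <= K) -> F f.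
Proof.
move=> mG GI F1 Flin Fcvg FG.
have F0 : F 0.
  by have := Flin (-1) _ _ F1 F1; rewrite scaleN1r addrC subrr.
have FD f g : F f -> F g -> F (f + g).
  by move=> f1 g1; rewrite -[f]scale1r; exact: Flin.
have FZ a f : F f -> F (a *: f).
  by move=> f1; rewrite -[_ *: _]addr0; exact: Flin.
have FI A : measurable A -> F (\1_A).
  rewrite mG; move: A; apply: (@lambda_system_subset _ G GI setT (fun A => F (\1_A))) => //.
  split=> [//||A B BA fA fB|A_ ndA fA].
  - by rewrite indicT.
  - rewrite (_ : \1_(A `\` B) = (-1) *: \1_B + \1_A); first exact: Flin.
    apply/funext => x; rewrite !fct_pointwise !indicE in_setD mulN1r.
    case: (boolP (x \in B)) => xB /=; last by rewrite andbT oppr0 add0r.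
    by rewrite (mem_set (BA _ (set_mem xB))) andbF addrC subrr.
  - apply: (Fcvg (fun n => \1_(A_ n)) _ 1) => // [n x|x].
      by rewrite indicE ger0_norm// lern1 leq_b1.
    rewrite indicE; apply: cvg_near_cst.
    case: (boolP (x \in \bigcup_i A_ i)).
      rewrite inE => -[m _ Am]; exists m => // n /= mn.
      by rewrite indicE mem_set//; exact: subsetPset (ndA _ _ mn) _ Am.
    move=> xA; apply: nearW => n; rewrite indicE memNset// => An.
    by move/negP: xA; apply; rewrite inE; exists n.
have FS (f : {nnsfun Y >-> R}) : F (fun x => f x).
  have -> : (fun x => f x) =
      \sum_(y <- finmap.enum_fset (fset_set (range f))) (y *: (\1_(f @^-1` [set y]) : Y -> R)).
    apply/funext => x; rewrite fimfunE fsbig_finite//= fct_sumE.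
    by apply: eq_bigr => y _.
  elim/big_ind : _ => // y _.
  by apply: FZ; apply: FI; exact: measurable_funPTI.
have Fge0 (f : Y -> R) (K : R) : measurable_fun setT f -> (forall x, 0 <= f x) -> (forall x, f x <= K) -> F f.
  move=> mf f0 fK.
  have mef : measurable_fun setT (EFin \o f) by exact/measurable_EFinP.
  pose f_ := nnsfun_approx measurableT mef.
  have ff x : f_ ^~ x @ \oo --> f x.
    have := @cvg_nnsfun_approx _ _ _ _ measurableT _ mef (fun x _ => f0 x) x I.
    by move=> /fine_cvgP[].
  apply: (Fcvg (fun n x => f_ n x) f K) => //.
  move=> n x; rewrite ger0_norm//; apply: le_trans (fK x).
  rewrite -(cvg_lim _ (ff x))//; apply: (@nondecreasing_cvgn_le _ (f_ ^~ x)).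
    by move=> m k mk; have /lefP := nd_nnsfun_approx measurableT mef mk; apply.
  by apply/cvg_ex; exists (f x); exact: ff.
move=> f mf [K fK].
rewrite (_ : f = (- K) *: cst 1 + (f + K *: cst 1)); last first.
  by apply/funext => x; rewrite !fct_pointwise; ring.
apply: Flin => //; apply: (Fge0 _ (K + K)).
- apply: (@measurable_funD _ _ _ _ f (cst (K * 1))) => //; exact: measurable_cst.
- move=> x; rewrite !fct_pointwise mulr1; have := fK x; rewrite ler_norml; move: (f x) => r; clear; lra.
- move=> x; rewrite !fct_pointwise mulr1; have := fK x; rewrite ler_norml; move: (f x) => r; clear; lra.
Qed.
Section SupAbs.
Context {R : realType} {X : Type}.
Implicit Types (A : set X) (f : X -> R).

Lemma le_supabs A f x : bounded_on A f -> A x -> `|f x| <= supabs A f.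
Proof.
move=> [K fK] Ax; apply: sup_upper_bound; last by exists x.
by split; [exists `|f x|, x|exists K => _ [z Az <-]; exact: fK].
Qed.

Lemma supabs_ge0 A f : 0 <= supabs A f.
Proof.
have [->|/set0P[x Ax]] := eqVneq A set0; first by rewrite /supabs image_set0 sup0.
have [hs|hs] := pselect (has_sup [set `|f z| | z in A]); last by rewrite /supabs sup_out.
by apply: le_trans (normr_ge0 (f x)) _; apply: sup_upper_bound => //; exists x.
Qed.

End SupAbs.

(** * Hölder functions on a metric space *)

Section Holder.
Context {R : realType} {dX : measure_display} {X : measurableType dX}.
Variables (dist : X -> X -> R) (alpha : R).
Hypothesis Hmetric : is_metric dist.
Hypothesis HborelX : @measurable _ X = <<s dopen dist >>.
Hypothesis Hdiam : forall x y, dist x y <= 1.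
Hypothesis Halpha : 0 < alpha <= 1.
Implicit Types (A U : set X) (f : X -> R) (V : R).

Let a0 : 0 < alpha. Proof. by case/andP: Halpha. Qed.
Let dist_ge0 x y : 0 <= dist x y. Proof. by case: Hmetric. Qed.
Let distxx x : dist x x = 0. Proof. by case: Hmetric => _ h _ _; exact/h. Qed.
Let distC x y : dist x y = dist y x. Proof. by case: Hmetric. Qed.
Let dist_tri x y z : dist x z <= dist x y + dist y z. Proof. by case: Hmetric. Qed.
Let dist_gt0 x y : x <> y -> 0 < dist x y.
Proof.
move=> xy; rewrite lt_neqAle dist_ge0 andbT eq_sym; apply/eqP => d0; apply: xy.
by case: Hmetric => _ h _ _; exact/h.
Qed.

Lemma hdist_ge0 x y : 0 <= dist x y `^ alpha. Proof. exact: powR_ge0. Qed.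

Lemma hdist_le1 x y : dist x y `^ alpha <= 1.
Proof.
have <- : 1 `^ alpha = 1 :> R by rewrite powR1.
by apply: ge0_ler_powR; rewrite ?nnegrE// ltW.
Qed.

Lemma hdistC x y : dist x y `^ alpha = dist y x `^ alpha.
Proof. by rewrite distC. Qed.

Lemma dist_le_hdist x y : dist x y <= dist x y `^ alpha.
Proof.
have [->|/eqP xy] := eqVneq x y; first by rewrite distxx powR_ge0.
rewrite -[leLHS]powRr1; last exact: dist_ge0.
by apply: ger_powR; [rewrite dist_gt0//= Hdiam|case/andP: Halpha].
Qed.

Definition holder A (V : R) f :=
  forall x y, A x -> A y -> `|f x - f y| <= V * dist x y `^ alpha.

Lemma holder_fine A f : (holv dist alpha A f < +oo)%E ->
  0 <= fine (holv dist alpha A f) /\ holder A (fine (holv dist alpha A f)) f.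
Proof.
move=> foo.
have f0 : (0 <= holv dist alpha A f)%E by apply: ereal_sup_ubound; left.
have ffin : holv dist alpha A f \is a fin_num by rewrite ge0_fin_numE.
split; first exact: fine_ge0.
move=> x y Ax Ay; have [->|/eqP xy] := eqVneq x y.
  by rewrite subrr normr0 mulr_ge0 ?hdist_ge0// fine_ge0.
rewrite -ler_pdivrMr ?powR_gt0 ?dist_gt0// -lee_fin fineK//.
by apply: ereal_sup_ubound; right; exists x, y.
Qed.

Lemma holder_holv A V f : 0 <= V -> holder A V f -> (holv dist alpha A f <= V%:E)%E.
Proof.
move=> V0 fV; apply: ge_ereal_sup => _ [->|[x [y [Ax Ay xy ->]]]]; first by rewrite lee_fin.
by rewrite lee_fin ler_pdivrMr ?powR_gt0 ?dist_gt0// fV.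
Qed.

Lemma in_holderP A f : in_holder dist alpha A f <->
  bounded_on A f /\ exists2 V : R, 0 <= V & holder A V f.
Proof.
split=> -[fb fV]; split => //.
  by have [? ?] := holder_fine fV; exists (fine (holv dist alpha A f)).
by case: fV => V V0 fV; rewrite (le_lt_trans (holder_holv V0 fV))// ltry.
Qed.

Lemma holvB_cst A f (k : R) : holv dist alpha A (fun x => f x - k) = holv dist alpha A f.
Proof.
rewrite /holv; congr (ereal_sup (_ `|` _)); apply/seteqP.
by split=> _ [x [y [Ax Ay xy ->]]]; exists x, y; split => //; congr ((`| _ | / _)%:E); ring.
Qed.

Lemma measurable_dopen U : dopen dist U -> measurable U.
Proof. by rewrite HborelX => oU; exact: sub_sigma_algebra. Qed.

Lemma dopenI : setI_closed (dopen dist).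
Proof.
move=> U U' oU oU' x [Ux U'x].
have [r r0 rU] := oU x Ux; have [r' r'0 rU'] := oU' x U'x.
exists (Num.min r r'); first by rewrite lt_min r0.
by move=> y; rewrite lt_min => /andP[? ?]; split; [exact: rU|exact: rU'].
Qed.

(** [A] is only measurable, so the superlevel set of [f] in [A] is exhibited as the trace of an open
    set of the whole space, the union of the balls on whose trace [f] exceeds [a]. *)
Lemma holder_measurable A V f : 0 <= V -> measurable A -> holder A V f -> measurable_fun A f.
Proof.
move=> V0 mA fV _; apply: (measurability _ (RGenOInfty.measurableE R)) => //.
move=> _ [_ [a ->] <-].
pose U := [set x | exists z r, [/\ dist z x < r & forall t, A t -> dist z t < r -> a < f t]].
have oU : dopen dist U.
  move=> x [z [r [zx zr]]]; exists (r - dist z x); first by rewrite subr_gt0.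
  move=> y xy; exists z, r; split => //.
  by rewrite (le_lt_trans (dist_tri z x y))// -ltrBrDl.
rewrite (_ : A `&` _ = A `&` U); first by apply: measurableI => //; exact: measurable_dopen.
apply/seteqP; split=> x [Ax].
  rewrite /= in_itv/= andbT => ax; split => //.
  (* V + 1 instead of V keeps the radius defined when V = 0. *)
  have V1 : 0 < V + 1 by rewrite ltr_wpDl.
  have e0 : 0 < (f x - a) / (V + 1) by rewrite divr_gt0 ?subr_gt0.
  exists x, (((f x - a) / (V + 1)) `^ alpha^-1); split; first by rewrite distxx powR_gt0.
  move=> t At xt; have := fV x t Ax At; have : dist x t `^ alpha < (f x - a) / (V + 1).
    have qE q : 0 <= q -> (q `^ alpha^-1) `^ alpha = q.
      by move=> q0; rewrite -powRrM mulVf ?lt0r_neq0// powRr1.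
    by rewrite -[ltRHS]qE ?(ltW e0)//; apply: gt0_ltr_powR; rewrite ?nnegrE ?powR_ge0.
  rewrite ltr_pdivlMr// => h1 /(le_trans (ler_norm _)) h2.
  have := hdist_ge0 x t; move: h1 h2; rewrite mulrDr mulr1 [_ * V]mulrC.
  move: (dist x t `^ alpha) (f x) (f t) => c2 c3 c4; lra.
move=> [z [r [zx zr]]]; split => //=; rewrite in_itv/= andbT; exact: zr.
Qed.

(** The approximants are min (1, n D) with D the distance to the complement. They are Lipschitz,
    hence Hölder because distances are at most 1 and alpha <= 1. *)
Lemma indic_dopen_approx U : dopen dist U ->
  exists f_ : nat -> X -> R, [/\ (forall n x, `|f_ n x| <= 1),
    (forall n, exists2 V : R, 0 <= V & holder setT V (f_ n)) &
    (forall x, f_ ^~ x @ \oo --> (\1_U x : R))].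
Proof.
(* If [U] is the whole space, the distance to its complement would be the infimum of an empty
   set. *)
move=> oU; have [UT|/set0P[y0 Uy0]] := eqVneq (~` U) set0.
  exists (fun _ => cst 1); split.
  - by move=> n x; rewrite normr1.
  - by move=> n; exists 0 => // x y _ _; rewrite subrr normr0 mul0r.
  - move=> x; rewrite indicE mem_set; first exact: cvg_cst.
    by rewrite -[U]setCK UT setC0.
pose D x := inf [set dist x y | y in ~` U].
have lbD x : has_lbound [set dist x y | y in ~` U] by exists 0 => _ [y _ <-].
have neD x : [set dist x y | y in ~` U] !=set0 by exists (dist x y0), y0.
have D0 x : 0 <= D x by apply: lb_le_inf => // _ [y _ <-].
have DB x x' : D x <= dist x x' + D x'.
  rewrite -lerBlDl; apply: lb_le_inf => // _ [y Uy <-].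
  rewrite lerBlDl; apply: le_trans (dist_tri x x' y); apply: ge_inf => //.
  by exists y.
have Dlip x x' : `|D x - D x'| <= dist x x'.
  by rewrite ler_norml; have := DB x x'; have := DB x' x; rewrite (distC x' x); move=> *; apply/andP; split; lra.
exists (fun n x => Num.min 1 (n%:R * D x)); split.
- by move=> n x; rewrite ger0_norm ?ge_min ?lexx// le_min ler01 mulr_ge0.
- move=> n; exists n%:R => // x x' _ _.
  apply: le_trans (_ : _ <= `|n%:R * D x - n%:R * D x'|) _.
    move: (n%:R * D x) (n%:R * D x') => a b; have c1 := ler_norm (a - b).
    have c2 := ler_norm (b - a); rewrite distrC in c2.
    rewrite ler_norml /Num.min; case: ltP => c3; case: ltP => c4; apply/andP; split; lra.
  by rewrite -mulrBr normrM ger0_norm// ler_wpM2l// (le_trans (Dlip _ _))// dist_le_hdist.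
- move=> x; rewrite indicE; apply: cvg_near_cst.
  have [/set_mem Ux|xU] := boolP (x \in U); last first.
    have -> : D x = 0.
      apply/eqP; rewrite eq_le D0 andbT; apply: ge_inf => //; exists x; last exact: distxx.
      by move=> Ux; move/negP: xU; apply; rewrite inE.
    by apply: nearW => n; rewrite mulr0; apply/min_idPr.
  have [r r0 rU] := oU x Ux.
  have Dr : r <= D x.
    apply: lb_le_inf => // _ [y Uy <-]; rewrite leNgt; apply/negP => xy; exact: Uy (rU y xy).
  near=> n; apply/min_idPl; apply: (@le_trans _ _ (n%:R * r)); last by rewrite ler_wpM2l.
  rewrite -ler_pdivrMr// div1r; near: n; exact: nbhs_infty_ger.
Unshelve. all: by end_near. Qed.

End Holder.
Section BoundedOn.
Context {R : realType} {X : Type}.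
Implicit Types (A : set X) (f g : X -> R) (a : R).

Lemma bounded_onD A f g : bounded_on A f -> bounded_on A g -> bounded_on A (f + g).
Proof.
by move=> [K fK] [K' gK]; exists (K + K') => z zA; rewrite fct_pointwise ler_normD_le ?fK ?gK.
Qed.

Lemma bounded_onM A f g : bounded_on A f -> bounded_on A g -> bounded_on A (f * g).
Proof.
move=> [K fK] [K' gK]; exists (K * K') => z zA.
by rewrite fct_pointwise normrM ler_pM ?fK ?gK.
Qed.

Lemma bounded_on_cst A a : bounded_on A (cst a).
Proof. by exists `|a|. Qed.

Lemma bounded_onZ A a f : bounded_on A f -> bounded_on A (a *: f).
Proof. by move=> fb; apply: (bounded_onM (bounded_on_cst _ a)). Qed.

End BoundedOn.

Section HolderAlgebra.
Context {R : realType} {dX : measure_display} {X : measurableType dX}.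
Variables (dist : X -> X -> R) (alpha : R).
Hypothesis Hmetric : is_metric dist.
Implicit Types (A : set X) (f g : X -> R) (a V : R).
Local Notation in_holder := (in_holder dist alpha).
Local Notation in_holderP := (in_holderP alpha Hmetric).

Lemma in_holderD A f g : in_holder A f -> in_holder A g -> in_holder A (f + g).
Proof.
move=> /in_holderP[fb [V V0 fV]] /in_holderP[gb [W W0 gW]]; apply/in_holderP.
split; first exact: bounded_onD.
exists (V + W); first exact: addr_ge0.
move=> x y Ax Ay; rewrite !fct_pointwise mulrDl opprD addrACA.
by apply: ler_normD_le; [exact: fV|exact: gW].
Qed.

Lemma in_holderM A f g : in_holder A f -> in_holder A g -> in_holder A (f * g).
Proof.
move=> /in_holderP[fb [V V0 fV]] /in_holderP[gb [W W0 gW]]; apply/in_holderP.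
split; first exact: bounded_onM.
case: fb gb => K fK [L gL].
exists (`|L| * V + `|K| * W); first by rewrite addr_ge0 ?mulr_ge0.
move=> x y Ax Ay; rewrite !fct_pointwise mulrDl -!mulrA.
have -> : f x * g x - f y * g y = g x * (f x - f y) + f y * (g x - g y) by ring.
apply: ler_normD_le; rewrite normrM ler_pM ?fV ?gW//.
- by rewrite (le_trans (gL x Ax))// ler_norm.
- by rewrite (le_trans (fK y Ay))// ler_norm.
Qed.

Lemma in_holder_cst A a : in_holder A (cst a).
Proof.
apply/in_holderP; split; first exact: bounded_on_cst.
by exists 0 => // x y _ _; rewrite subrr normr0 mul0r.
Qed.

Lemma in_holderZ A a f : in_holder A f -> in_holder A (a *: f).
Proof. by move=> fb; apply: (in_holderM (in_holder_cst _ a)). Qed.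

Lemma in_holder_comp A (g : R -> R) K s f : 0 <= K -> (forall x, A x -> `|f x| <= s) ->
  (forall y z, `|y| <= s -> `|z| <= s -> `|g y - g z| <= K * `|y - z|) ->
  in_holder A f -> in_holder A (g \o f).
Proof.
move=> K0 fs gK /in_holderP[_ [V V0 fV]]; apply/in_holderP; split.
  exists (`|g 0| + K * s) => x Ax; have := fs x Ax => fxs.
  have s0 := le_trans (normr_ge0 _) fxs.
  have -> : (g \o f) x = g 0 + (g (f x) - g 0) by rewrite /=; ring.
  apply: ler_normD_le => //; apply: le_trans (gK _ _ fxs _) _; first by rewrite normr0.
  by rewrite subr0 ler_wpM2l.
exists (K * V); first exact: mulr_ge0.
move=> x y Ax Ay /=; apply: le_trans (gK _ _ (fs _ Ax) (fs _ Ay)) _.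
by rewrite -mulrA ler_wpM2l// fV.
Qed.

Lemma eq_in_holder A f g : (forall x, A x -> f x = g x) -> in_holder A f -> in_holder A g.
Proof.
move=> fg /in_holderP[[K fK] [V V0 fV]]; apply/in_holderP; split.
  by exists K => x Ax; rewrite -fg// fK.
by exists V => // x y Ax Ay; rewrite -!fg// fV.
Qed.

End HolderAlgebra.

(** * Conformal measures and densities for an abstract family of cones *)

Section Dynamics.
Context {R : realType} {dO : measure_display} {Omega : measurableType dO}.
Context {dX : measure_display} {X : measurableType dX}.
Variables (theta thinv : Omega -> Omega) (E : set (Omega * X)) (T : Omega -> X -> X)
  (phi : Omega -> X -> R) (nu : Omega -> probability X R) (h : Omega -> X -> R)
  (dist : X -> X -> R) (alpha : R).
Hypothesis Hmetric : is_metric dist.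
Hypothesis HborelX : @measurable _ X = <<s dopen dist >>.
Hypothesis Hdiam : forall x y, dist x y <= 1.
Hypothesis Halpha : 0 < alpha <= 1.
Hypothesis HEmeas : measurable E.
Hypothesis HTfib : forall w x, Fib E w x -> Fib E (theta w) (T w x).
Hypothesis HTmeas : measurable_fun E (fun wx => T wx.1 wx.2).
Hypothesis thetaK : cancel theta thinv.
Hypothesis thinvK : cancel thinv theta.

Local Notation Fib := (Fib E).
Local Notation Lop := (Lop E T phi).
Local Notation Lopn := (Lopn theta E T phi).
Local Notation one := (one (R := R)).
Local Notation lam := (lam theta E T phi nu).
Local Notation lamn := (lamn theta E T phi nu).
Local Notation N w f := (integ nu w (Fib w) f).
Local Notation hol w f := (in_holder dist alpha (Fib w) f).

(** [Good] is stable under [theta] and [thinv], as h_w is a limit taken from the past of w and nu_w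
    one taken from its future. The cones stay abstract so that one argument covers both settings;
    [Mc] is their Harnack constant. *)
Variables (Good : Omega -> Prop) (cone : Omega -> (X -> R) -> Prop) (Mc : Omega -> R).
Implicit Types (w : Omega) (f g G : X -> R) (n : nat) (a K : R).

Hypothesis Good_theta : forall w, Good w -> Good (theta w).
Hypothesis Good_thinv : forall w, Good w -> Good (thinv w).
Hypothesis Good_gibbs : forall w, Good w -> gibbs_char theta thinv E T phi nu h dist alpha w.
Hypothesis Good_Fib : forall w, Good w -> Fib w !=set0.
Hypothesis Good_branches : forall w, Good w ->
  exists I y D, branches theta E T phi w I y D.
Hypothesis eq_cone : forall w f g, (forall x, Fib w x -> f x = g x) -> cone w f -> cone w g.
Hypothesis coneD : forall w f g, Good w -> cone w f -> cone w g -> cone w (f + g).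
Hypothesis coneZ : forall w a f, Good w -> 0 <= a -> cone w f -> cone w (a *: f).
Hypothesis cone_cvg : forall w (f_ : nat -> X -> R) f, Good w -> (forall n, cone w (f_ n)) ->
  (forall x, Fib w x -> f_ ^~ x @ \oo --> f x) -> cone w f.
Hypothesis cone_holder : forall w f, Good w -> cone w f -> hol w f.
Hypothesis cone_ge0 : forall w f x, Good w -> cone w f -> Fib w x -> 0 <= f x.
Hypothesis cone_harnack : forall w f x x', Good w -> cone w f -> Fib w x -> Fib w x' ->
  f x <= Mc w * f x'.
Hypothesis cone_span : forall w f, Good w -> hol w f -> exists K, cone w (f + K *: one).
Hypothesis cone_one : forall w, Good w -> cone w one.
Hypothesis cone_L : forall w f, Good w -> cone w f -> cone (theta w) (Lop w f).

Lemma measurable_Fib w : measurable (Fib w).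
Proof.
rewrite (_ : Fib w = xsection E w); first exact: measurable_xsection.
by apply/seteqP; split=> x; rewrite /xsection /= /Defs.Fib /= inE.
Qed.
Let mF := measurable_Fib.

Let hol_bounded w f : hol w f -> bounded_on (Fib w) f. Proof. by case. Qed.

Lemma hol_measurable w f : hol w f -> measurable_fun (Fib w) f.
Proof.
move=> /(in_holderP alpha Hmetric)[_ [V V0 fV]].
exact: (holder_measurable Hmetric HborelX Halpha V0 _ fV).
Qed.

Let bounded_one w : bounded_on (Fib w) one.
Proof. exact: bounded_on_cst. Qed.

Lemma LinLop w x a f g : Good w -> Fib (theta w) x ->
  bounded_on (Fib w) f -> bounded_on (Fib w) g ->
  Lop w (a *: f + g) x = a * Lop w f x + Lop w g x.
Proof. by move=> /Good_branches[I [y [D br]]]; exact: Lop_linear br _ _ _ _. Qed.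

Lemma LopZ w x a f : Good w -> Fib (theta w) x -> bounded_on (Fib w) f ->
  Lop w (a *: f) x = a * Lop w f x.
Proof.
by move=> wG xF fb; have [I [y [D br]]] := Good_branches wG; exact: (LopZ_branch br).
Qed.

Lemma Lop_mono w x f g : Good w -> Fib (theta w) x ->
  bounded_on (Fib w) f -> bounded_on (Fib w) g ->
  (forall z, Fib w z -> f z <= g z) -> Lop w f x <= Lop w g x.
Proof. by move=> /Good_branches[I [y [D br]]]; exact: le_Lop br _ _ _. Qed.

Lemma Lop_eq w x f g : Good w -> Fib (theta w) x -> (forall z, Fib w z -> f z = g z) ->
  Lop w f x = Lop w g x.
Proof.
move=> /Good_branches[I [y [D br]]] xF fg.
by apply: (eq_Lop br) => // z; rewrite inE; exact: fg.
Qed.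

Lemma Lop1_pos w x : Good w -> Fib (theta w) x -> 0 < Lop w one x.
Proof.
move=> wG xF; have [I [y [D br]]] := Good_branches wG; have [z zF] := Good_Fib wG.
have [_ _ h3] := proj1 br _ (HTfib zF).
have [i Ii _] := h3 z (conj zF erefl).
exact: (Lop1_gt0 br xF Ii).
Qed.

Lemma cone_positive w f x0 : Good w -> cone w f -> Fib w x0 -> 0 < f x0 ->
  exists2 c, 0 < c & forall x, Fib w x -> c <= f x.
Proof.
move=> wG fC x0F f0; have M0 : 0 < Mc w.
  by have := cone_harnack wG fC x0F x0F; rewrite -(pmulr_lgt0 _ f0); exact: lt_le_trans.
exists (f x0 / Mc w); first exact: divr_gt0.
by move=> x xF; rewrite ler_pdivrMr// mulrC cone_harnack.
Qed.

Lemma Lop_pos w f x : Good w -> cone w f -> (forall z, Fib w z -> 0 < f z) ->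
  Fib (theta w) x -> 0 < Lop w f x.
Proof.
move=> wG fC f0 xF; have [z zF] := Good_Fib wG.
have [c c0 cf] := cone_positive wG fC zF (f0 z zF).
apply: (@lt_le_trans _ _ (Lop w (c *: one) x)).
  by rewrite LopZ// mulr_gt0// Lop1_pos.
apply: Lop_mono => //; first exact: bounded_onZ.
  by apply: hol_bounded; exact: cone_holder.
by move=> y yF; rewrite fct_pointwise /Defs.one mulr1 cf.
Qed.

Lemma Good_iter w n : Good w -> Good (iter n theta w).
Proof. by move=> wG; elim: n => //= n; exact: Good_theta. Qed.

Lemma Good_iterV w n : Good w -> Good (iter n thinv w).
Proof. by move=> wG; elim: n => //= n; exact: Good_thinv. Qed.

Lemma Lopn_cone w n f : Good w -> cone w f -> cone (iter n theta w) (Lopn n w f).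
Proof. by move=> wG fC; elim: n => //= n IH; apply: cone_L => //; exact: Good_iter. Qed.

Lemma Lopn1_pos w n x : Good w -> Fib (iter n theta w) x -> 0 < Lopn n w one x.
Proof.
move=> wG; elim: n x => [x _|n IH x xF]; first exact: ltr01.
apply: Lop_pos => //; first exact: Good_iter.
by apply: Lopn_cone => //; exact: cone_one.
Qed.

Lemma Lopn_Sr w n f : Lopn n.+1 w f = Lopn n (theta w) (Lop w f).
Proof. by elim: n => //= n ->; rewrite -iterSr. Qed.

Let hol_one w : hol w one. Proof. exact: in_holder_cst. Qed.

Lemma Fib_orbit_points w : Good w -> exists xs : nat -> X, forall n, Fib (iter n theta w) (xs n).
Proof.
move=> wG; have H n : exists x, Fib (iter n theta w) x by apply: Good_Fib; exact: Good_iter.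
by have [xs xsF] := choice H; exists xs.
Qed.

(** For g = 1 the ratios whose limit defines nu are constantly 1; hence nu is carried by the
    fibre. *)
Lemma integ_Fib1 w : Good w -> N w one = 1.
Proof.
move=> wG; have [H _] := Good_gibbs wG.
have [xs xsF] := Fib_orbit_points wG.
have := H one (hol_one w) xs xsF.
under eq_fun => n do rewrite divff ?gt_eqF ?Lopn1_pos//.
by move=> /(cvg_lim (@Rhausdorff R)) <-; rewrite lim_cst.
Qed.

Lemma nu_Fib w : Good w -> (nu w (Fib w) = 1)%E.
Proof.
move=> /integ_Fib1; rewrite /integ /Defs.one /= integral_cst// mul1e => N1.
by rewrite -[LHS]fineK ?N1// fin_num_measure.
Qed.

Lemma integrable_bounded w f : measurable_fun (Fib w) f -> bounded_on (Fib w) f ->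
  (nu w).-integrable (Fib w) (EFin \o f).
Proof.
move=> mf [K fK]; apply: measurable_bounded_integrable => //.
  by rewrite ltey_eq fin_num_measure.
exists K; split; first exact: num_real.
by move=> M KM x xF; apply: le_trans (fK x xF) (ltW KM).
Qed.

Lemma Nlin w a f g :
  measurable_fun (Fib w) f -> bounded_on (Fib w) f ->
  measurable_fun (Fib w) g -> bounded_on (Fib w) g ->
  N w (a *: f + g) = a * N w f + N w g.
Proof.
move=> mf bf mg bg.
transitivity (\int[nu w]_(x in Fib w) (a * f x + g x)); first by [].
have If := integrable_bounded mf bf.
rewrite RintegralD//; last 2 first.
- rewrite (_ : _ \o _ = EFin \o (a *: f)); last by [].
  by apply: integrable_bounded; [exact: measurable_funM|exact: bounded_onZ].
- exact: integrable_bounded.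
by rewrite RintegralZl.
Qed.

Lemma eq_N w f g : (forall x, Fib w x -> f x = g x) -> N w f = N w g.
Proof. by move=> fg; apply: eq_Rintegral => x; rewrite inE; exact: fg. Qed.

Lemma le_N w f g :
  measurable_fun (Fib w) f -> bounded_on (Fib w) f ->
  measurable_fun (Fib w) g -> bounded_on (Fib w) g ->
  (forall x, Fib w x -> f x <= g x) -> N w f <= N w g.
Proof. by move=> mf bf mg bg fg; apply: le_Rintegral => //; exact: integrable_bounded. Qed.

Lemma N_cvg w (f_ : nat -> X -> R) f K : (forall n, measurable_fun (Fib w) (f_ n)) ->
  (forall n x, Fib w x -> `|f_ n x| <= K) ->
  (forall x, Fib w x -> f_ ^~ x @ \oo --> f x) ->
  (fun n => N w (f_ n)) @ \oo --> N w f.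
Proof.
move=> mf fK ff; apply: (@Rintegral_dominated_cvg _ _ _ _ _ _ _ (cst K)) => //.
by apply: integrable_bounded => //; exact: bounded_on_cst.
Qed.

Lemma N_cst w a : Good w -> N w (cst a) = a.
Proof.
by move=> wG; rewrite /integ /= integral_cst// [X in (_ * X)%E](nu_Fib wG) mule1.
Qed.

(** Write L f = L (f + K) - K L 1 with K such that f + K lies in the cone: both images are then in a
    cone, hence Hölder. *)
Lemma Lop_hol w f : Good w -> hol w f -> hol (theta w) (Lop w f).
Proof.
move=> wG fH; have [K fK] := cone_span wG fH.
have L1 := cone_L wG fK; have L2 := cone_L wG (cone_one wG).
have tG := Good_theta wG.
apply: (@eq_in_holder _ _ _ _ _ Hmetric _ (Lop w (f + K *: one) + (- K) *: Lop w one)).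
  move=> x xF; rewrite !fct_pointwise.
  have -> : f + K *: one = K *: one + f by rewrite addrC.
  by rewrite LinLop//; [ring|exact: hol_bounded].
by apply: in_holderD => //; [|apply: in_holderZ => //]; exact: cone_holder.
Qed.

Lemma lam_gt0 w : Good w -> 0 < lam w.
Proof.
move=> wG; have tG := Good_theta wG; have [x0 x0F] := Good_Fib tG.
have C1 := cone_L wG (cone_one wG).
have [c c0 cL] := cone_positive tG C1 x0F (Lop1_pos wG x0F).
have H1 := cone_holder tG C1.
rewrite (lt_le_trans c0)// -[leLHS](N_cst c tG) /Defs.lam; apply: le_N => //.
- exact: bounded_on_cst.
- exact: hol_measurable.
- exact: hol_bounded.
Qed.

(** L^(n+1) f / L^(n+1) 1 is the quotient of L^n (L f) / L^n 1 by L^n (L 1) / L^n 1, and these two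
    ratios converge at theta w to the integrals of L f and L 1. *)
Lemma N_Lop_hol w f : Good w -> hol w f -> N (theta w) (Lop w f) = lam w * N w f.
Proof.
move=> wG fH; have tG := Good_theta wG.
have [xs xsF] := Fib_orbit_points wG.
have xsF' n : Fib (iter n theta (theta w)) (xs n.+1) by rewrite -iterSr.
have c0 := proj1 (Good_gibbs wG) f fH xs xsF.
have c1 := proj1 (Good_gibbs tG) _ (Lop_hol wG fH) (fun n => xs n.+1) xsF'.
have c2 := proj1 (Good_gibbs tG) _ (Lop_hol wG (hol_one w)) (fun n => xs n.+1) xsF'.
have l0 := lam_gt0 wG.
have c3 := cvgM c1 (cvgV (lt0r_neq0 l0) c2).
move: c0; rewrite -cvg_shiftS => c0.
suff c4 : (fun n => Lopn n.+1 w f (xs n.+1) / Lopn n.+1 w one (xs n.+1)) @ \oo -->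
    N (theta w) (Lop w f) / lam w.
  rewrite -(cvg_unique _ c4 c0)//; first by field; rewrite gt_eqF.
apply: cvg_trans (c3 _ _); apply: near_eq_cvg; apply: nearW => n /=.
have p1 : 0 < Lopn n (theta w) one (xs n.+1) by apply: Lopn1_pos.
have p2 : 0 < Lopn n.+1 w one (xs n.+1) by apply: Lopn1_pos.
rewrite -[Lop (iter n theta w) (Lopn n w f)]/(Lopn n.+1 w f).
rewrite -[Lop (iter n theta w) (Lopn n w one)]/(Lopn n.+1 w one) !Lopn_Sr in p2 *.
by field; rewrite !gt_eqF.
Qed.

(* The identity nu_{theta w} (L_w g) = lam_w nu_w g holds for Holder g by the limit defining nu;
   it is needed for bounded measurable g because G o T_w need not be continuous. *)
Definition N_invariant w g := [/\ measurable_fun setT g, bounded_on setT g,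
  measurable_fun (Fib (theta w)) (Lop w g) & N (theta w) (Lop w g) = lam w * N w g].

Let bounded_setT w f : bounded_on setT f -> bounded_on (Fib w) f.
Proof. by move=> [K fK]; exists K => x _; exact: fK. Qed.

Let meas_setT w f : measurable_fun setT f -> measurable_fun (Fib w) f.
Proof. by move=> mf; apply: measurable_funS mf. Qed.

Lemma norm_Lop_le w f K x : Good w -> (forall z, Fib w z -> `|f z| <= K) ->
  Fib (theta w) x -> `|Lop w f x| <= K * Lop w one x.
Proof.
move=> wG fK xF; rewrite ler_norml -mulNr -!LopZ//.
have bK (k : R) : bounded_on (Fib w) (k *: one) by exact: bounded_onZ.
by apply/andP; split; apply: Lop_mono => //; try (by exists K);
  move=> y yF; have := fK y yF; rewrite ler_norml fct_pointwise /Defs.one mulr1 => /andP[].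
Qed.

Let Lop1_le w : Good w -> exists L1, forall K, 0 <= K -> forall f,
  (forall z, Fib w z -> `|f z| <= K) -> forall x, Fib (theta w) x -> `|Lop w f x| <= K * L1.
Proof.
move=> wG; have [L1 L1b] := hol_bounded (Lop_hol wG (hol_one w)).
exists L1 => K K0 f fK x xF; apply: le_trans (norm_Lop_le wG fK xF) _.
by rewrite ler_wpM2l// (le_trans (ler_norm _) (L1b x xF)).
Qed.

Lemma Lop_bounded w f : Good w -> bounded_on (Fib w) f -> bounded_on (Fib (theta w)) (Lop w f).
Proof.
move=> wG [K fK]; have [L1 L1b] := Lop1_le wG.
have [z zF] := Good_Fib wG; have K0 := le_trans (normr_ge0 _) (fK z zF).
by exists (K * L1) => x; exact: L1b.
Qed.

Lemma N_invariant_hol w f : Good w -> measurable_fun setT f -> bounded_on setT f -> hol w f ->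
  N_invariant w f.
Proof.
move=> wG mf bf hf; split => //; last exact: N_Lop_hol.
by apply: hol_measurable; exact: Lop_hol.
Qed.

Lemma N_invariant_linear w a f g : Good w -> N_invariant w f -> N_invariant w g ->
  N_invariant w (a *: f + g).
Proof.
move=> wG [mf bf mLf ef] [mg bg mLg eg].
have Fbf := bounded_setT w bf; have Fbg := bounded_setT w bg.
have LE x : Fib (theta w) x -> Lop w (a *: f + g) x = (a *: Lop w f + Lop w g) x.
  by move=> xF; rewrite LinLop// !fct_pointwise.
split.
- by apply: measurable_funD => //; exact: measurable_funM.
- by apply: bounded_onD => //; exact: bounded_onZ.
- apply: (@eq_measurable_fun _ _ _ _ _ (a *: Lop w f + Lop w g)).
    by move=> x; rewrite inE => /LE.
  by apply: measurable_funD => //; exact: measurable_funM.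
- rewrite (eq_N LE) Nlin//; try exact: Lop_bounded.
  by rewrite Nlin//; [rewrite ef eg; ring|exact: meas_setT..].
Qed.

Lemma N_invariant_cvg w (f_ : nat -> X -> R) f K : Good w -> (forall n, N_invariant w (f_ n)) ->
  (forall n x, `|f_ n x| <= K) -> (forall x, f_ ^~ x @ \oo --> f x) -> N_invariant w f.
Proof.
move=> wG fN fK ff.
have [I [y [D br]]] := Good_branches wG.
have cL x : Fib (theta w) x -> (fun n => Lop w (f_ n) x) @ \oo --> Lop w f x.
  by move=> xF; apply: (Lop_cvg br xF (K := K)) => [n z _|z _]; [exact: fK|exact: ff].
have bf : bounded_on setT f.
  exists K => z _; rewrite -(cvg_lim _ (cvg_norm (ff z)))//.
  apply: limr_le; first by apply: is_cvg_norm; apply/cvg_ex; exists (f z); exact: ff.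
  by apply: nearW => n; exact: fK.
have mf : measurable_fun setT f.
  by apply: (@measurable_fun_cvg _ _ _ _ f_) => // n; case: (fN n).
have mL : measurable_fun (Fib (theta w)) (Lop w f).
  by apply: (@measurable_fun_cvg _ _ _ _ (fun n => Lop w (f_ n))) => // n; case: (fN n).
split => //.
have [L1 L1b] := Lop1_le wG.
have K0 : 0 <= K by have [z _] := Good_Fib wG; apply: le_trans (normr_ge0 _) (fK 0 z).
have Lb n x : Fib (theta w) x -> `|Lop w (f_ n) x| <= K * L1.
  by apply: L1b.
have c1 : (fun n => N (theta w) (Lop w (f_ n))) @ \oo --> N (theta w) (Lop w f).
  by apply: (N_cvg (K := K * L1)) => // n; case: (fN n).
have c2 : (fun n => lam w * N w (f_ n)) @ \oo --> lam w * N w f.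
  apply: cvgM; first exact: cvg_cst.
  by apply: (N_cvg (K := K)) => // n; apply: meas_setT; case: (fN n).
apply: (cvg_unique _ c1); first exact: Rhausdorff.
by apply: cvg_trans c2; apply: near_eq_cvg; apply: nearW => n; case: (fN n).
Qed.

(** A monotone class argument that starts from indicators of open sets, which are bounded limits of
    Hölder functions. *)
Lemma N_Lop w g : Good w -> measurable_fun setT g -> bounded_on setT g -> N_invariant w g.
Proof.
move=> wG mg [K gK].
apply: (bounded_monotone_class HborelX (@dopenI _ _ _ dist)) mg _ => //.
- by apply: N_invariant_hol => //; exact: (bounded_on_cst _ 1).
- by move=> a f g'; exact: N_invariant_linear.
- by move=> f_ f K' h1 h2 h3; apply: (N_invariant_cvg wG h1 h2 h3).
- move=> U /(indic_dopen_approx Hmetric Hdiam Halpha)[f_ [f1 f2 f3]].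
  apply: (N_invariant_cvg wG _ f1 f3) => n; have [V V0 fV] := f2 n.
  apply: N_invariant_hol => //.
  + exact: (holder_measurable Hmetric HborelX Halpha V0 measurableT fV).
  + by exists 1 => x _; exact: f1.
  + apply/(in_holderP alpha Hmetric); split; first by exists 1 => x _; exact: f1.
    by exists V => // x y _ _; exact: fV.
- by exists K => x; exact: gK.
Qed.
Lemma Nlin_hol w a f g : hol w f -> hol w g -> N w (a *: f + g) = a * N w f + N w g.
Proof.
by move=> fH gH; apply: Nlin; [exact: hol_measurable|exact: hol_bounded|
  exact: hol_measurable|exact: hol_bounded].
Qed.

Lemma NZ w a f : hol w f -> N w (a *: f) = a * N w f.
Proof.
move=> fH; rewrite /integ -[RHS]RintegralZl//.
by apply: integrable_bounded; [exact: hol_measurable|exact: hol_bounded].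
Qed.

Lemma eq_Lop_preim w x f g : (forall z, preim E T w x z -> f z = g z) ->
  Lop w f x = Lop w g x.
Proof.
move=> fg; rewrite /Defs.Lop /rsum.
by congr (fine _ - fine _); apply: eq_esum => z zx; rewrite fg.
Qed.

Lemma measurable_T w : measurable_fun (Fib w) (T w).
Proof.
apply: (@measurable_comp _ _ _ _ _ _ E (fun wx => T wx.1 wx.2) _ (pair w)) => //.
  by move=> _ [x xF <-].
by apply: measurable_funTS; exact: pair1_measurable.
Qed.

Lemma measurable_compT w G : measurable_fun (Fib (theta w)) G ->
  measurable_fun (Fib w) (G \o T w).
Proof.
move=> mG; apply: (@measurable_comp _ _ _ _ _ _ (Fib (theta w))) => //.
  by move=> _ [x xF <-]; exact: HTfib.
exact: measurable_T.
Qed.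

Lemma bounded_compT w G : bounded_on (Fib (theta w)) G -> bounded_on (Fib w) (G \o T w).
Proof. by move=> [K GK]; exists K => x xF; exact/GK/HTfib. Qed.

(** On the preimages of x the factor [G \o T w] equals [G x], so it leaves the operator as a
    constant. As [N_Lop] takes functions on the whole space, the product is first extended by 0 off
    the fibre. *)
Lemma N_duality w G f : Good w -> measurable_fun (Fib (theta w)) G ->
  bounded_on (Fib (theta w)) G -> hol w f ->
  N (theta w) (G * Lop w f) = lam w * N w ((G \o T w) * f).
Proof.
move=> wG mG bG fH; set F := (G \o T w) * f.
have bF : bounded_on (Fib w) F by apply: bounded_onM; [exact: bounded_compT|exact: hol_bounded].
have mF' : measurable_fun (Fib w) F.
  by apply: measurable_funM; [exact: measurable_compT|exact: hol_measurable].
have gE x : Fib w x -> (F \_ (Fib w)) x = F x by move=> xF; rewrite patchE mem_set.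
have [||_ _ _] := @N_Lop w (F \_ (Fib w)) wG.
- exact/(measurable_restrictT _ (mF w)).
- case: bF => K FK; exists `|K| => x _; rewrite patchE; case: ifPn; last by rewrite normr0.
  by rewrite inE => /FK /le_trans; apply; exact: ler_norm.
rewrite (eq_N gE) => <-; apply: eq_N => x xF.
rewrite (Lop_eq wG xF gE) (@eq_Lop_preim w x F (G x *: f)).
  by rewrite (LopZ _ wG xF (hol_bounded fH)).
by move=> z [zF zx]; rewrite /F !fct_pointwise /= zx.
Qed.

Lemma iter_thinvK n w : iter n theta (iter n thinv w) = w.
Proof. by elim: n w => //= n IH w; rewrite -iterS iterSr thinvK IH. Qed.

Lemma lamn_gt0 w n : Good w -> 0 < lamn w n.
Proof. by move=> wG; apply: prodr_gt0 => j _; apply: lam_gt0; exact: Good_iter. Qed.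

Lemma Lopn_hol w n f : Good w -> hol w f -> hol (iter n theta w) (Lopn n w f).
Proof. by move=> wG fH; elim: n => //= n IH; apply: Lop_hol => //; exact: Good_iter. Qed.

Lemma N_Lopn w n f : Good w -> hol w f ->
  N (iter n theta w) (Lopn n w f) = lamn w n * N w f.
Proof.
move=> wG fH; elim: n => [|n IH]; first by rewrite /Defs.lamn big_ord0 mul1r.
rewrite /= N_Lop_hol; [|exact: Good_iter|exact: Lopn_hol].
by rewrite IH /Defs.lamn big_ord_recr/=; ring.
Qed.

Lemma cone_le_N w f x : Good w -> cone w f -> Fib w x -> f x <= Mc w * N w f.
Proof.
move=> wG fC xF; have fH := cone_holder wG fC.
rewrite -[leLHS](N_cst (f x) wG).
rewrite -NZ//; have HH : hol w (Mc w *: f) by exact: in_holderZ.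
apply: le_N => //; [exact: bounded_on_cst|exact: hol_measurable|exact: hol_bounded|].
by move=> x' x'F; exact: (cone_harnack wG fC xF x'F).
Qed.

(** The approximants of h_w. They lie in the cone and have mass 1, so Harnack bounds them by [Mc w];
    this is the dominating constant in all limits below. *)
Let hn w n := (lamn (iter n thinv w) n)^-1 *: Lopn n (iter n thinv w) one.

Let hn_cone w n : Good w -> cone w (hn w n).
Proof.
move=> wG; apply: coneZ => //.
  by rewrite invr_ge0 ltW// lamn_gt0//; exact: Good_iterV.
rewrite -[X in cone X](iter_thinvK n).
have vG := Good_iterV n wG.
by apply: Lopn_cone => //; exact: cone_one.
Qed.

Let N_hn w n : Good w -> N w (hn w n) = 1.
Proof.
move=> wG; have vG := Good_iterV n wG.
have H1 : hol w (Lopn n (iter n thinv w) one).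
  by rewrite -[X in hol X _](iter_thinvK n); exact: Lopn_hol.
rewrite NZ// -[X in N X _](iter_thinvK n) N_Lopn//.
by rewrite integ_Fib1// mulr1 mulVf// gt_eqF// lamn_gt0.
Qed.

Let hn_cvg w x : Good w -> Fib w x -> hn w ^~ x @ \oo --> h w x.
Proof.
move=> wG xF; have := proj2 (Good_gibbs wG) x xF.
by under eq_fun do rewrite mulrC.
Qed.

Let hn_le w n x : Good w -> Fib w x -> `|hn w n x| <= Mc w.
Proof.
move=> wG xF; have hC := hn_cone n wG.
by rewrite ger0_norm ?(cone_ge0 wG hC xF)// -[leRHS]mulr1 -(N_hn n wG) cone_le_N.
Qed.

Lemma cone_h w : Good w -> cone w (h w).
Proof.
move=> wG; apply: (cone_cvg (f_ := hn w)) => //.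
  by move=> n; exact: hn_cone.
by move=> x; exact: hn_cvg.
Qed.

Lemma N_h w : Good w -> N w (h w) = 1.
Proof.
move=> wG; have c1 : (fun n => N w (hn w n)) @ \oo --> N w (h w).
  apply: (N_cvg (K := Mc w)) => [n|n x|x].
  - by apply: hol_measurable; apply: cone_holder => //; exact: hn_cone.
  - exact: hn_le.
  - exact: hn_cvg.
apply: (cvg_unique _ c1); first exact: Rhausdorff.
by apply: cvg_near_cst; apply: nearW => n; exact: N_hn.
Qed.

(** L_w sends the n-th approximant at w to lam_w times the approximant of index n + 1 at theta w,
    since both start from the same point of the past. *)
Lemma Lop_h w x : Good w -> Fib (theta w) x -> Lop w (h w) x = lam w * h (theta w) x.
Proof.
move=> wG xF; have tG := Good_theta wG.
have [I [y [D br]]] := Good_branches wG.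
have c1 : (fun n => Lop w (hn w n) x) @ \oo --> Lop w (h w) x.
  apply: (Lop_cvg br xF (K := Mc w)) => [n z|z]; [exact: hn_le|exact: hn_cvg].
have c2 : (fun n => lam w * hn (theta w) n.+1 x) @ \oo --> lam w * h (theta w) x.
  apply: cvgM; first exact: cvg_cst.
  by have := hn_cvg tG xF; rewrite -cvg_shiftS.
apply: (cvg_unique _ c1); first exact: Rhausdorff.
apply: cvg_trans c2; apply: near_eq_cvg; apply: nearW => n.
have vG := Good_iterV n wG.
rewrite /hn iterSr thetaK LopZ//; last first.
  by rewrite -{1}[w](iter_thinvK n); apply: hol_bounded; exact: Lopn_hol.
rewrite fct_pointwise /= iter_thinvK /Defs.lamn big_ord_recr/= iter_thinvK.
have l0 := lam_gt0 wG; have ln0 := lamn_gt0 n vG.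
rewrite -/(lamn _ n); field; by rewrite !gt_eqF.
Qed.
Definition bmeas w f := measurable_fun (Fib w) f /\ bounded_on (Fib w) f.

Lemma bmeas_hol w f : hol w f -> bmeas w f.
Proof. by move=> fH; split; [exact: hol_measurable|exact: hol_bounded]. Qed.

Lemma bmeasD w f g : bmeas w f -> bmeas w g -> bmeas w (f + g).
Proof. by move=> [mf bf] [mg bg]; split; [exact: measurable_funD|exact: bounded_onD]. Qed.

Lemma bmeasM w f g : bmeas w f -> bmeas w g -> bmeas w (f * g).
Proof. by move=> [mf bf] [mg bg]; split; [exact: measurable_funM|exact: bounded_onM]. Qed.

Lemma bmeas_cst w a : bmeas w (cst a).
Proof. by split; [exact: measurable_cst|exact: bounded_on_cst]. Qed.

Lemma bmeasZ w a f : bmeas w f -> bmeas w (a *: f).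
Proof. by move=> fb; apply: (bmeasM (bmeas_cst w a)). Qed.

Lemma bmeas_comp w (g : R -> R) f : continuous g -> (forall x, `|g x| <= 1) ->
  bmeas w f -> bmeas w (g \o f).
Proof.
move=> cg g1 [mf _]; split; last by exists 1 => x _; exact: g1.
by apply: measurableT_comp => //; exact: continuous_measurable_fun.
Qed.

Lemma ND w f g : bmeas w f -> bmeas w g -> N w (f + g) = N w f + N w g.
Proof. by move=> [mf bf] [mg bg]; rewrite -[f in LHS]scale1r Nlin// mul1r. Qed.

Lemma N_Z w a f : bmeas w f -> N w (a *: f) = a * N w f.
Proof. by move=> [mf bf]; rewrite /integ -[RHS]RintegralZl//; exact: integrable_bounded. Qed.

(** Values off the fibre are meaningless, whereas the abstract recursion uses equality of functions.
    Cutting to the fibre makes P_j h_j = h_{j+1} and the linearity of P_j hold literally. *)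
Definition on_Fib w f : X -> R := f * \1_(Fib w).

Lemma on_FibE w f x : Fib w x -> on_Fib w f x = f x.
Proof. by move=> xF; rewrite /on_Fib fct_pointwise indicE mem_set// mulr1. Qed.

Lemma on_Fib_out w f x : ~ Fib w x -> on_Fib w f x = 0.
Proof. by move=> xF; rewrite /on_Fib fct_pointwise indicE memNset// mulr0. Qed.

Lemma eq_on_Fib w f g : (forall x, Fib w x -> f x = g x) -> on_Fib w f = on_Fib w g.
Proof.
move=> fg; apply/funext => x; have [xF|xF] := pselect (Fib w x).
  by rewrite !on_FibE// fg.
by rewrite !on_Fib_out.
Qed.

Lemma hol_on_Fib w f : hol w f -> hol w (on_Fib w f).
Proof. by apply: eq_in_holder => // x xF; rewrite on_FibE. Qed.

Definition normLop w f := on_Fib (theta w) ((lam w)^-1 *: Lop w f).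

Lemma normLop_hol w f : Good w -> hol w f -> hol (theta w) (normLop w f).
Proof. by move=> wG fH; apply: hol_on_Fib; apply: in_holderZ => //; exact: Lop_hol. Qed.

Lemma normLop_h w : Good w -> normLop w (on_Fib w (h w)) = on_Fib (theta w) (h (theta w)).
Proof.
move=> wG; apply: eq_on_Fib => x xF; rewrite fct_pointwise.
rewrite (Lop_eq wG xF (fun z zF => on_FibE (h w) zF)) Lop_h// mulKf// gt_eqF//.
exact: lam_gt0.
Qed.

Lemma N_normLop w G f : Good w -> bmeas (theta w) G -> hol w f ->
  N (theta w) (G * normLop w f) = N w ((G \o T w) * f).
Proof.
move=> wG [mG bG] fH.
have -> : N (theta w) (G * normLop w f) = N (theta w) ((lam w)^-1 *: (G * Lop w f)).
  by apply: eq_N => x xF; rewrite !fct_pointwise /normLop on_FibE// fct_pointwise; ring.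
rewrite N_Z; last by apply: bmeasM => //; apply: bmeas_hol; exact: Lop_hol.
by rewrite N_duality// mulKf// gt_eqF// lam_gt0.
Qed.

Lemma bmeas_compT w G : bmeas (theta w) G -> bmeas w (G \o T w).
Proof. by move=> [mG bG]; split; [exact: measurable_compT|exact: bounded_compT]. Qed.

(** * Characteristic function and variance along one orbit *)

Section Orbit.
Variables (w0 : Omega) (v : nat -> X -> R).
Local Notation w_ j := (iter j theta w0).
Local Notation Tn := (Tn theta T).
Hypothesis w0G : Good w0.
Hypothesis v_hol : forall j, hol (w_ j) (v j).
Let wG j : Good (w_ j). Proof. exact: Good_iter. Qed.
Let P j := normLop (w_ j).
Let hF j := on_Fib (w_ j) (h (w_ j)).
Let uF j := on_Fib (w_ j) (v j).
Local Notation fwd := (fwd P hF uF).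
Local Notation psum := (psum P hF uF).
Let Nj j f := N (w_ j) f.
Local Notation var_step := (var_step Nj P hF uF).

Definition birkhoff n y : R := \sum_(j < n) v j (Tn j w0 y).

Lemma birkhoffS n y : birkhoff n.+1 y = birkhoff n y + v n (Tn n w0 y).
Proof. by rewrite /birkhoff big_ord_recr. Qed.

Lemma bmeas_compTn n G : bmeas (w_ n) G -> bmeas w0 (G \o Tn n w0).
Proof.
elim: n G => // n IH G bG.
exact: (IH (G \o T (w_ n)) (bmeas_compT bG)).
Qed.

Lemma bmeas_birkhoff n : bmeas w0 (birkhoff n).
Proof.
elim: n => [|n IH].
  rewrite (_ : birkhoff 0 = cst 0); first exact: bmeas_cst.
  by apply/funext => y; rewrite /birkhoff big_ord0.
rewrite (_ : birkhoff n.+1 = birkhoff n + (v n \o Tn n w0)).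
  by apply: bmeasD => //; apply: bmeas_compTn; exact: bmeas_hol.
by apply/funext => y; rewrite birkhoffS.
Qed.

Let hF_hol j : hol (w_ j) (hF j).
Proof. by apply: hol_on_Fib; apply: cone_holder => //; exact: cone_h. Qed.

Let uF_hol j : hol (w_ j) (uF j). Proof. exact: hol_on_Fib. Qed.

Let uFE j x : Fib (w_ j) x -> uF j x = v j x. Proof. exact: on_FibE. Qed.

Let hol_bounded_lip j (g : R -> R) : (forall x y, `|g x - g y| <= `|x - y|) ->
  forall t, hol (w_ j) ((fun y => g (t * y)) \o uF j).
Proof.
move=> gL t; have [K uK] := hol_bounded (uF_hol j).
apply: (@in_holder_comp _ _ _ _ _ Hmetric _ (fun y => g (t * y)) `|t| K) => //.
by move=> y z _ _; rewrite -normrM mulrBr; exact: gL.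
Qed.

Lemma fwd_hol t n x : hol (w_ n) (fwd t n x).
Proof.
elim: n x => [x|n IH x]; first exact: (in_holderZ Hmetric _ (hF_hol 0%N)).
rewrite /=; apply: normLop_hol => //; apply: in_holderD => //; apply: in_holderM => //.
  exact: hol_bounded_lip (@cos_lipschitz R) t.
exact: hol_bounded_lip (@sin_lipschitz R) t.
Qed.

Lemma psum_hol n : hol (w_ n) (psum n).
Proof.
elim: n => [|n IH] /=; first exact: (in_holder_cst alpha Hmetric _ 0).
by apply: normLop_hol => //; apply: in_holderD => //; exact: in_holderM.
Qed.

Let cosS (t : R) n (x : R) : X -> R := cos \o (t *: birkhoff n + cst (- x)).

Let bmeas_cosS t n x : bmeas w0 (cosS t n x).
Proof.
apply: bmeas_comp; [exact: continuous_cos|exact: cos_max|].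
by apply: bmeasD; [apply: bmeasZ; exact: bmeas_birkhoff|exact: bmeas_cst].
Qed.

(** The test function [G] makes the induction work: from n to n + 1, the addition formula moves cos
    (t v_n) and sin (t v_n) into the test function at time n. *)
Lemma N_fwd (t : R) n (x : R) G : bmeas (w_ n) G ->
  N w0 ((G \o Tn n w0) * (cosS t n x * hF 0)) = N (w_ n) (G * fwd t n x).
Proof.
elim: n x G => [|n IH] x G bG.
  apply: eq_N => y yF /=; rewrite !fct_pointwise /cosS /= !fct_pointwise /=.
  by rewrite /birkhoff big_ord0 mulr0 add0r cosN.
pose G1 (g : R -> R) := (G \o T (w_ n)) * (g \o (t *: v n)).
have bG1 (g : R -> R) : continuous g -> (forall x, `|g x| <= 1) -> bmeas (w_ n) (G1 g).
  move=> cg g1; apply: bmeasM; first exact: bmeas_compT.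
  by apply: bmeas_comp => //; apply: bmeasZ; exact: bmeas_hol.
have b1 := bG1 cos (@continuous_cos R) (@cos_max R).
have b2 := bG1 sin (@continuous_sin R) (@sin_max R).
have bh : bmeas w0 (hF 0) := bmeas_hol (hF_hol 0%N).
transitivity (N w0 ((G1 cos \o Tn n w0) * (cosS t n x * hF 0) +
                    (G1 sin \o Tn n w0) * (cosS t n (x - pi / 2) * hF 0))).
  apply: eq_N => y yF; rewrite !fct_pointwise /cosS /G1 /= !fct_pointwise /=.
  rewrite birkhoffS mulrDr.
  have -> : t * birkhoff n y + t * v n (Tn n w0 y) - x =
    (t * birkhoff n y - x) + t * v n (Tn n w0 y) by ring.
  have -> : t * birkhoff n y - (x - pi / 2) = (t * birkhoff n y - x) + pi / 2 by ring.
  by rewrite !cosD cos_pihalf sin_pihalf; ring.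
rewrite ND; last 2 first.
- by apply: bmeasM; [exact: bmeas_compTn|exact: bmeasM].
- by apply: bmeasM; [exact: bmeas_compTn|exact: bmeasM].
rewrite !IH// -ND; last 2 first.
- by apply: bmeasM => //; apply: bmeas_hol; exact: fwd_hol.
- by apply: bmeasM => //; apply: bmeas_hol; exact: fwd_hol.
rewrite -[fwd t n.+1 x]/(normLop (w_ n) (((fun y => cos (t * y)) \o uF n) * fwd t n x +
  ((fun y => sin (t * y)) \o uF n) * fwd t n (x - pi / 2))) (N_normLop (wG n) bG); last first.
  apply: in_holderD => //; apply: in_holderM => //; try exact: fwd_hol.
    exact: hol_bounded_lip (@cos_lipschitz R) t.
  exact: hol_bounded_lip (@sin_lipschitz R) t.
apply: eq_N => y yF; rewrite /G1 !fct_pointwise /= uFE// !fct_pointwise; ring.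
Qed.

Lemma N_h_comp n G : bmeas (w_ n) G -> N w0 ((G \o Tn n w0) * hF 0) = N (w_ n) (G * hF n).
Proof.
elim: n G => // n IH G bG.
rewrite (_ : hF n.+1 = P n (hF n)); last by rewrite /P normLop_h.
by rewrite (N_normLop (wG n) bG (hF_hol n)) -IH//; exact: bmeas_compT.
Qed.

Lemma N_psum n G : bmeas (w_ n) G ->
  N w0 ((G \o Tn n w0) * (birkhoff n * hF 0)) = N (w_ n) (G * psum n).
Proof.
elim: n G => [|n IH] G bG.
  apply: eq_N => y yF; by rewrite /= !fct_pointwise /birkhoff big_ord0 mul0r !mulr0.
have bh : bmeas w0 (hF 0) := bmeas_hol (hF_hol 0%N).
have bv : bmeas (w_ n) (v n) by exact: bmeas_hol.
have bT : bmeas (w_ n) (G \o T (w_ n)) := bmeas_compT bG.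
have bT2 : bmeas (w_ n) ((G \o T (w_ n)) * v n) by exact: bmeasM.
transitivity (N w0 (((G \o T (w_ n)) \o Tn n w0) * (birkhoff n * hF 0) +
                    ((((G \o T (w_ n)) * v n) \o Tn n w0) * hF 0))).
  by apply: eq_N => y yF; rewrite !fct_pointwise /= !fct_pointwise /= birkhoffS; ring.
rewrite ND; last 2 first.
- by apply: bmeasM; [exact: bmeas_compTn|apply: bmeasM => //; exact: bmeas_birkhoff].
- by apply: bmeasM => //; exact: bmeas_compTn.
rewrite IH// N_h_comp// -ND; last 2 first.
- by apply: bmeasM => //; apply: bmeas_hol; exact: psum_hol.
- by apply: bmeasM => //; apply: bmeas_hol.
rewrite -[psum n.+1]/(normLop (w_ n) (psum n + uF n * hF n)) (N_normLop (wG n) bG); last first.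
  by apply: in_holderD => //; [exact: psum_hol|exact: in_holderM].
by apply: eq_N => y yF; rewrite !fct_pointwise uFE//; ring.
Qed.

(** Expand the square of S_n + v_n o T^n: the cross term is transported to time n by [N_psum], the
    last square by [N_h_comp]. *)
Lemma N_variance n : N w0 (birkhoff n * birkhoff n * hF 0) = \sum_(i < n) var_step i.
Proof.
elim: n => [|n IH].
  rewrite big_ord0 (_ : _ * _ * _ = cst 0) ?(N_cst 0 w0G)//.
  by apply/funext => y; rewrite !fct_pointwise /birkhoff big_ord0 !mul0r.
have bh : bmeas w0 (hF 0) := bmeas_hol (hF_hol 0%N).
have bv : bmeas (w_ n) (v n) by exact: bmeas_hol.
have bvv := bmeasM bv bv; have bS := bmeas_birkhoff n.
transitivity (N w0 (birkhoff n * birkhoff n * hF 0 +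
   (((v n * v n) \o Tn n w0) * hF 0 + 2 *: ((v n \o Tn n w0) * (birkhoff n * hF 0))))).
  by apply: eq_N => y yF; rewrite !fct_pointwise /= !fct_pointwise /= birkhoffS; ring.
have bm1 : bmeas w0 ((v n \o Tn n w0) * (birkhoff n * hF 0)).
  by apply: bmeasM; [exact: bmeas_compTn|exact: bmeasM].
have bm2 : bmeas w0 (((v n * v n) \o Tn n w0) * hF 0).
  by apply: bmeasM => //; exact: bmeas_compTn.
rewrite ND; last 2 first.
- by apply: bmeasM => //; exact: bmeasM.
- by apply: bmeasD => //; exact: bmeasZ.
rewrite IH ND//; last exact: bmeasZ.
rewrite N_Z// N_h_comp// N_psum// big_ord_recr /= /var_step; congr (_ + (_ + 2 * _)).
  by apply: eq_N => y yF; rewrite !fct_pointwise uFE.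
by apply: eq_N => y yF; rewrite !fct_pointwise uFE.
Qed.

End Orbit.
(** [Ms] is the Harnack constant of the image cone, which lies well inside the cone at theta w;
    [kap0] measures this room, as the fraction of a minorant that can be subtracted without leaving
    the cone. [cS] and [cV] are the prices of the supremum and of the Hölder constant of a
    multiplier. *)
Variables (kap0 Ms cS cV : Omega -> R).
Hypothesis L_harnack : forall w f x x', Good w -> cone w f ->
  Fib (theta w) x -> Fib (theta w) x' -> Lop w f x <= Ms w * Lop w f x'.
Hypothesis cone_sub : forall w f g a, Good w -> cone w f -> cone w g -> 0 <= a ->
  (forall x x', Fib (theta w) x -> Fib (theta w) x' -> a * Lop w g x <= Lop w f x') ->
  cone (theta w) (Lop w f - (kap0 w * a) *: Lop w g).
Hypothesis cone_mul : forall w f psi S V, Good w -> cone w f -> 0 <= S -> 0 <= V ->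
  (forall x, Fib w x -> `|psi x| <= S) -> holder dist alpha (Fib w) V psi ->
  cone (theta w) ((cS w * S + cV w * V) *: Lop w f + Lop w (psi * f)).
Hypothesis kap0_01 : forall w, Good w -> 0 <= kap0 w <= 1.
Hypothesis Ms_ge1 : forall w, Good w -> 1 <= Ms w.
Hypothesis cS_ge1 : forall w, Good w -> 1 <= cS w.
Hypothesis cV_ge0 : forall w, Good w -> 0 <= cV w.

(* cone_sub with a = N f / Ms^2 and g = h: by L_harnack, L f >= N f / Ms and L h <= Ms
   up to the factor lam. *)
Definition kappa w := kap0 w / Ms w ^+ 2.

Let kappa01 w : Good w -> 0 <= kappa w <= 1.
Proof.
move=> wG; have /andP[k0 k1] := kap0_01 wG; have M1 := Ms_ge1 wG.
have M0 : 0 < Ms w ^+ 2 by rewrite exprn_gt0// (lt_le_trans ltr01).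
rewrite /kappa divr_ge0 ?(ltW M0)//= ler_pdivrMr// mul1r (le_trans k1)//.
by rewrite exprn_ege1.
Qed.

Lemma normLop_contract w f : Good w -> cone w f ->
  cone (theta w) (normLop w f - (kappa w * N w f) *: on_Fib (theta w) (h (theta w))).
Proof.
move=> wG fC; have tG := Good_theta wG; have l0 := lam_gt0 wG; have M1 := Ms_ge1 wG.
have M0 : 0 < Ms w by rewrite (lt_le_trans ltr01).
have LC := cone_L wG fC; have hC := cone_h wG; have LhC := cone_L wG hC.
have fH := cone_holder wG fC.
pose a := N w f / Ms w ^+ 2.
have NLE : N (theta w) (Lop w f) = lam w * N w f by exact: N_Lop_hol.
have lower g x : cone w g -> Fib (theta w) x -> N (theta w) (Lop w g) <= Ms w * Lop w g x.
  move=> gC xF; rewrite -[leRHS](N_cst _ tG); have LH := cone_holder tG (cone_L wG gC).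
  apply: le_N; [exact: hol_measurable|exact: hol_bounded|exact: measurable_cst| |].
    exact: bounded_on_cst.
  by move=> z zF; exact: (L_harnack wG gC).
have upper g x : cone w g -> Fib (theta w) x -> Lop w g x <= Ms w * N (theta w) (Lop w g).
  move=> gC xF; have LH := cone_holder tG (cone_L wG gC).
  rewrite -[leLHS](N_cst _ tG) -NZ//; have ZH := in_holderZ Hmetric (Ms w) LH.
  apply: le_N; [exact: measurable_cst|exact: bounded_on_cst|exact: hol_measurable| |].
    exact: hol_bounded.
  by move=> z zF; exact: (L_harnack wG gC).
have N0 : 0 <= N w f.
  rewrite -(N_cst 0 wG); apply: le_N; [exact: measurable_cst|exact: bounded_on_cst| | |].
  - exact: hol_measurable.
  - exact: hol_bounded.
  - by move=> z zF; exact: (cone_ge0 wG fC zF).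
have key : cone (theta w) (Lop w f - (kap0 w * a) *: Lop w (h w)).
  apply: cone_sub => //; first by rewrite divr_ge0// ?exprn_ge0 ?ltW.
  move=> x x' xF x'F; rewrite /a.
  have h1 := upper _ x hC xF; have h2 := lower f x' fC x'F.
  rewrite N_Lop_hol ?N_h ?mulr1 in h1 => //; last exact: cone_holder.
  rewrite NLE in h2; rewrite mulrAC ler_pdivrMr ?exprn_gt0//.
  have h3 := ler_wpM2l N0 h1; have h4 := ler_wpM2l (ltW M0) h2.
  by apply: le_trans h3 _; move: h4; congr (_ <= _); ring.
apply: (@eq_cone _ ((lam w)^-1 *: (Lop w f - (kap0 w * a) *: Lop w (h w)))); last first.
  by apply: coneZ; rewrite // invr_ge0 ltW.
move=> x xF; rewrite !fct_pointwise /normLop !on_FibE// fct_pointwise Lop_h//.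
by rewrite /kappa /a; field; rewrite !gt_eqF.
Qed.

Lemma normLop_mul_cone w f psi S V : Good w -> cone w f -> 0 <= S -> 0 <= V ->
  (forall x, Fib w x -> `|psi x| <= S) -> holder dist alpha (Fib w) V psi ->
  cone (theta w) ((cS w * S + cV w * V) *: normLop w f + normLop w (psi * f)).
Proof.
move=> wG fC S0 V0 psiS psiV; have tG := Good_theta wG.
apply: (@eq_cone _ ((lam w)^-1 *: ((cS w * S + cV w * V) *: Lop w f + Lop w (psi * f)))).
  by move=> x xF; rewrite !fct_pointwise /normLop !on_FibE// !fct_pointwise; ring.
by apply: coneZ; [|rewrite invr_ge0 ltW// lam_gt0|exact: cone_mul].
Qed.

Section OrbitBound.
Variables (w0 : Omega) (v : nat -> X -> R) (S V : nat -> R) (s A : R).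
Local Notation w_ j := (iter j theta w0).
Hypothesis w0G : Good w0.
Hypothesis S0 : forall j, 0 <= S j.
Hypothesis V0 : forall j, 0 <= V j.
Hypothesis vS : forall j x, Fib (w_ j) x -> `|v j x| <= S j.
Hypothesis vV : forall j, holder dist alpha (Fib (w_ j)) (V j) (v j).
Hypothesis N_vh : forall j, N (w_ j) (v j * h (w_ j)) = 0.
Hypothesis S_le : forall j, S j <= s.
Hypothesis c_le : forall j, cS (w_ j) * S j + cV (w_ j) * V j <= A * kappa (w_ j).
Hypothesis s_ge1 : 1 <= s.
Hypothesis s_le_A : s <= A.

Let wG j : Good (w_ j). Proof. exact: Good_iter. Qed.
Let v_hol j : hol (w_ j) (v j).
Proof. by apply/(in_holderP alpha Hmetric); split; [exists (S j); exact: vS|exists (V j)]. Qed.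
Let uF j := on_Fib (w_ j) (v j).
Let uFE j x : Fib (w_ j) x -> uF j x = v j x. Proof. exact: on_FibE. Qed.
Let uFS j x : Fib (w_ j) x -> `|uF j x| <= S j. Proof. by move=> xF; rewrite uFE// vS. Qed.
Let uFV j : holder dist alpha (Fib (w_ j)) (V j) (uF j).
Proof. by move=> x y xF yF; rewrite !uFE// vV. Qed.

Lemma orbit_char_bound t n x : `|t| * A <= 1 / 16 ->
  `|N w0 ((cos \o (t *: birkhoff w0 v n + cst (- x))) * on_Fib w0 (h w0)) -
    cos x * expR (- (t ^+ 2 * N w0 (birkhoff w0 v n * birkhoff w0 v n * on_Fib w0 (h w0)) / 2))|
  <= expR (- (t ^+ 2 * N w0 (birkhoff w0 v n * birkhoff w0 v n * on_Fib w0 (h w0)) / 2)) *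
     ((1 + 200 * `|t| ^+ 3 * s * A ^+ 2) ^+ n - 1).
Proof.
move=> tA; have := N_fwd w0G v_hol t x (bmeas_cst (w_ n) 1).
rewrite (_ : (cst 1 \o _) * _ = (cos \o (t *: birkhoff w0 v n + cst (- x))) * on_Fib w0 (h w0)); last first.
  by apply/funext => y; rewrite !fct_pointwise /= mul1r.
rewrite (_ : cst 1 * ?[f] = ?f); last by apply/funext => y; rewrite !fct_pointwise /= mul1r.
move=> ->; have ulip (g : R -> R) K j : 0 <= K ->
    (forall y z, `|y| <= s -> `|z| <= s -> `|g y - g z| <= K * `|y - z|) ->
    holder dist alpha (Fib (w_ j)) (K * V j) (g \o uF j).
  move=> K0 gK y z yF zF /=.
  apply: le_trans (gK _ _ (le_trans (uFS yF) (S_le j)) (le_trans (uFS zF) (S_le j))) _.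
  by rewrite -mulrA ler_wpM2l// uFV.
have uhol (g : R -> R) K j : 0 <= K ->
    (forall y z, `|y| <= s -> `|z| <= s -> `|g y - g z| <= K * `|y - z|) ->
    hol (w_ j) (g \o uF j).
  move=> K0 gK; apply: (in_holder_comp Hmetric (s := s) K0 _ gK).
    by move=> y yF; exact: le_trans (uFS yF) (S_le j).
  exact: hol_on_Fib.
apply: (@fwd_char_bound R X (fun j f => hol (w_ j) f) (fun j => cone (w_ j))
  (fun j f => N (w_ j) f) (fun j => normLop (w_ j)) (fun j => on_Fib (w_ j) (h (w_ j))) uF
  (fun j => kappa (w_ j)) (fun j => cS (w_ j) * S j + cV (w_ j) * V j) S s A) => //.
- by move=> j a f g fH gH; apply: in_holderD => //; exact: in_holderZ.
- by move=> j f; exact: cone_holder.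
- by move=> j g K f K0 gK fH; apply: in_holderM => //; exact: uhol gK.
- by move=> j f g; exact: coneD.
- by move=> j a f; exact: coneZ.
- move=> j; apply: (@eq_cone _ (h (w_ j))); first by move=> y yF; rewrite on_FibE.
  exact: cone_h.
- by move=> j a f g; exact: Nlin_hol.
- move=> j a f g fH gH; apply/funext => y; rewrite !fct_pointwise /normLop.
  have [yF|yF] := pselect (Fib (theta (w_ j)) y); last by rewrite !on_Fib_out//; ring.
  by rewrite !on_FibE// !fct_pointwise LinLop//; [ring|exact: hol_bounded..].
- by move=> j f; exact: normLop_hol.
- move=> j f fH; have := N_normLop (wG j) (bmeas_cst _ 1) fH.
  have E1 (g : X -> R) : (cst 1 : X -> R) * g = g.
    by apply/funext => y; rewrite !fct_pointwise /= mul1r.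
  by rewrite E1 => ->; rewrite (_ : cst 1 \o _ = cst 1)// E1.
- by move=> j; exact: normLop_h.
- move=> j; rewrite -[RHS](N_h (wG j)); apply: eq_N => y yF; exact: on_FibE.
- move=> j; rewrite -(N_vh j); apply: eq_N => y yF.
  by rewrite !fct_pointwise uFE// on_FibE.
- by move=> j f; exact: normLop_contract.
- move=> j g K f K0 gK gK' fC.
  have := @normLop_mul_cone (w_ j) f (g \o uF j) (K * S j) (K * V j) (wG j) fC.
  rewrite (_ : cS _ * _ + cV _ * _ = K * (cS (w_ j) * S j + cV (w_ j) * V j)); last by ring.
  apply; rewrite ?mulr_ge0//; last exact: ulip.
  move=> y yF /=; apply: le_trans (gK' _ (le_trans (uFS yF) (S_le j))) _.
  by rewrite ler_wpM2l// uFS.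
- move=> j g K L f K0 L0 gL gK fC; have fH := cone_holder (wG j) fC.
  have gH := in_holderM Hmetric (uhol _ _ j L0 gL) fH.
  have bnd y : Fib (w_ j) y -> `|((g \o uF j) * f) y| <= K * S j * f y.
    move=> yF; rewrite fct_pointwise normrM (ger0_norm (cone_ge0 (wG j) fC yF)).
    rewrite ler_wpM2r ?(cone_ge0 (wG j) fC yF)//= (le_trans (gK _ _))//.
      exact: le_trans (uFS yF) (S_le j).
    by rewrite ler_wpM2l// uFS.
  have ZH a : hol (w_ j) (a *: f) by exact: in_holderZ.
  rewrite ler_norml -mulNr -!NZ//; apply/andP; split; apply: le_N;
    try exact: hol_measurable; try exact: hol_bounded;
    by move=> y yF; have := bnd y yF; rewrite ler_norml => /andP[b1 b2];
      rewrite ?fct_pointwise ?mulNr.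
- by move=> j; exact: kappa01.
- move=> j; rewrite -[leLHS]mul1r -[leLHS]addr0 lerD ?mulr_ge0 ?cV_ge0//.
  by rewrite ler_wpM2r// cS_ge1.
- exact: N_variance.
Qed.

End OrbitBound.
Lemma measurable_on_Fib w f : measurable_fun (Fib w) f -> measurable_fun setT (on_Fib w f).
Proof.
move=> mf; rewrite (_ : on_Fib w f = f \_ (Fib w)); first exact/(measurable_restrictT _ (mF w)).
apply/funext => x; rewrite patchE; case: ifPn => [/set_mem xF|/negP xF].
  by rewrite on_FibE.
by rewrite on_Fib_out// => xF'; apply: xF; rewrite inE.
Qed.

Lemma wexp_on_Fib w f : wexp (nu w) (on_Fib w (h w)) f = N w (f * on_Fib w (h w)).
Proof.
rewrite /wexp /integ [RHS]Rintegral_mkcond; apply: eq_Rintegral => x _.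
rewrite patchE; case: ifPn => [_|/negP xF]; first by rewrite mulrC.
by rewrite on_Fib_out ?mul0r// => xF'; apply: xF; rewrite inE.
Qed.

Section OrbitClt.
Variables (w0 : Omega) (v : nat -> X -> R) (S V : nat -> R) (p A c : R) (n0 : nat).
Local Notation w_ j := (iter j theta w0).
Hypothesis w0G : Good w0.
Hypothesis S0 : forall j, 0 <= S j.
Hypothesis V0 : forall j, 0 <= V j.
Hypothesis vS : forall j x, Fib (w_ j) x -> `|v j x| <= S j.
Hypothesis vV : forall j, holder dist alpha (Fib (w_ j)) (V j) (v j).
Hypothesis N_vh : forall j, N (w_ j) (v j * h (w_ j)) = 0.
Hypothesis p16 : 16 < p.
Hypothesis A1 : 1 <= A.
Hypothesis S_growth : forall n j, (j < n)%N -> S j <= A * n%:R `^ p^-1.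
Hypothesis c_growth : forall n j, (j < n)%N ->
  cS (w_ j) * S j + cV (w_ j) * V j <= A * n%:R `^ (3 / p) * kappa (w_ j).
Hypothesis c0 : 0 < c.
Hypothesis c1 : c <= 1.
Hypothesis var_growth : forall n, (n0 <= n)%N ->
  c ^+ 2 * n%:R <= N w0 (birkhoff w0 v n * birkhoff w0 v n * on_Fib w0 (h w0)).

Let Var n := N w0 (birkhoff w0 v n * birkhoff w0 v n * on_Fib w0 (h w0)).

Let wG j : Good (w_ j). Proof. exact: Good_iter. Qed.
Let v_hol j : hol (w_ j) (v j).
Proof. by apply/(in_holderP alpha Hmetric); split; [exists (S j); exact: vS|exists (V j)]. Qed.

Let char_bound n (t z : R) : (0 < n)%N -> `|t| * (A * n%:R `^ (3 / p)) <= 1 / 16 ->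
  `|wexp (nu w0) (on_Fib w0 (h w0)) (fun x => cos (t * on_Fib w0 (birkhoff w0 v n) x - z)) -
    cos z * expR (- (t ^+ 2 * Var n / 2))| <=
  expR (- (t ^+ 2 * Var n / 2)) *
  ((1 + 200 * `|t| ^+ 3 * (A * n%:R `^ p^-1) * (A * n%:R `^ (3 / p)) ^+ 2) ^+ n - 1).
Proof.
move=> n_gt0 tA; have p0 : 0 < p by apply: lt_trans p16; rewrite ltr0n.
(* [orbit_char_bound] asks for constants valid at all times, while the growth hypotheses cover j < n
   only. Setting the observable to 0 from time n on does not change S_n. *)
pose v' j := if (j < n)%N then v j else 0.
pose S' j := if (j < n)%N then S j else 0.
pose V' j := if (j < n)%N then V j else 0.
have bE : birkhoff w0 v' n = birkhoff w0 v n.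
  by apply/funext => y; apply: eq_bigr => j _; rewrite /v' ltn_ord.
have n1 : 1 <= n%:R :> R by rewrite ler1n.
have P1 : 1 <= n%:R `^ p^-1 :> R by rewrite -[leLHS](powRr0 n%:R) ler_powR// invr_ge0 ltW.
have P3 : n%:R `^ p^-1 <= n%:R `^ (3 / p) :> R.
  by rewrite ler_powR// -[leLHS]mul1r ler_wpM2r ?invr_ge0 ?(ltW p0)// ler1n.
have A0 : 0 <= A by exact: le_trans ler01 A1.
have k0 j : 0 <= kappa (w_ j) by case/andP: (kappa01 (wG j)).
have S'0 j : 0 <= S' j by rewrite /S'; case: ifP.
have V'0 j : 0 <= V' j by rewrite /V'; case: ifP.
have v'S j x : Fib (w_ j) x -> `|v' j x| <= S' j.
  by rewrite /v' /S'; case: ifP => _; [exact: vS|rewrite fct_pointwise normr0].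
have v'V j : holder dist alpha (Fib (w_ j)) (V' j) (v' j).
  rewrite /v' /V'; case: ifP => _; first exact: vV.
  by move=> x y _ _; rewrite !fct_pointwise subrr normr0 mul0r.
have N_v'h j : N (w_ j) (v' j * h (w_ j)) = 0.
  rewrite /v'; case: ifP => _; first exact: N_vh.
  rewrite -[RHS](N_cst 0 (wG j)); apply: eq_N => x _.
  by rewrite !fct_pointwise mul0r.
have S'_le j : S' j <= A * n%:R `^ p^-1.
  by rewrite /S'; case: ifP => [|_]; [exact: S_growth|rewrite mulr_ge0// powR_ge0].
have c'_le j : cS (w_ j) * S' j + cV (w_ j) * V' j <= A * n%:R `^ (3 / p) * kappa (w_ j).
  rewrite /S' /V'; case: ifP => [|_]; first exact: c_growth.
  by rewrite !mulr0 addr0 mulr_ge0// mulr_ge0// powR_ge0.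
have s1 : 1 <= A * n%:R `^ p^-1 by rewrite -[leLHS]mulr1 ler_pM.
have sA : A * n%:R `^ p^-1 <= A * n%:R `^ (3 / p) by rewrite ler_wpM2l.
have := orbit_char_bound w0G S'0 V'0 v'S v'V N_v'h S'_le c'_le s1 sA n z tA.
rewrite bE -/(Var n); congr (`|_ - _| <= _).
rewrite wexp_on_Fib; apply: eq_N => x xF.
by rewrite !fct_pointwise /= !fct_pointwise /= (on_FibE (birkhoff w0 v n) xF).
Qed.

Lemma orbit_clt : exists (C : R) (M : nat), forall n, (M <= n)%N -> forall z : R,
  `|integ nu w0 ([set x | birkhoff w0 v n x <= z * Num.sqrt (Var n)] `&` Fib w0) (h w0) - Phi z|
  <= C * n%:R `^ (- (2^-1 - 8 / p)).
Proof.
have hC := cone_h w0G; have hH := cone_holder w0G hC.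
have [K hK] := hol_bounded hH.
have bB n : exists B : R, forall x, Fib w0 x -> `|birkhoff w0 v n x| <= B.
  by have [_] := bmeas_birkhoff v_hol n.
have [B BP] := choice bB.
have h1 : wexp (nu w0) (on_Fib w0 (h w0)) (fun=> 1) = 1.
  by rewrite wexp_on_Fib -[RHS](N_h w0G); apply: eq_N => x xF;
    rewrite fct_pointwise on_FibE// mul1r.
have h_ge0 x : 0 <= on_Fib w0 (h w0) x.
  have [xF|xF] := pselect (Fib w0 x); last by rewrite on_Fib_out.
  by rewrite on_FibE// (cone_ge0 w0G hC xF).
have h_le x : on_Fib w0 (h w0) x <= `|K|.
  have [xF|xF] := pselect (Fib w0 x); last by rewrite on_Fib_out.
  by rewrite on_FibE// (le_trans (ler_norm _))// (le_trans (hK x xF))// ler_norm.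
have mh : measurable_fun setT (on_Fib w0 (h w0)).
  by apply: measurable_on_Fib; exact: hol_measurable.
have mZ n : measurable_fun setT (on_Fib w0 (birkhoff w0 v n)).
  by apply: measurable_on_Fib; case: (bmeas_birkhoff v_hol n).
have ZB n x : `|on_Fib w0 (birkhoff w0 v n) x| <= `|B n|.
  have [xF|xF] := pselect (Fib w0 x); last by rewrite on_Fib_out// normr0.
  by rewrite on_FibE// (le_trans (BP n x xF))// ler_norm.
have [C [M CM]] := clt_rate mh h_ge0 h_le h1 mZ ZB p16 A1 c0 c1 var_growth char_bound.
exists C, M => n nM z; apply: le_trans (CM n nM z); rewrite le_eqVlt; apply/orP; left.
apply/eqP; congr (`|_ - _|); rewrite /wexp /integ [LHS]Rintegral_mkcond.
apply: eq_Rintegral => x _; rewrite patchE; have [xF|xF] := pselect (Fib w0 x); last first.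
  by rewrite on_Fib_out// mul0r memNset// => -[].
rewrite (on_FibE (birkhoff w0 v n) xF) (on_FibE (h w0) xF); case: ifPn => [/set_mem[/= -> _]|/negP xA]; first by rewrite mulr1.
case: leP => [le|]; last by rewrite mulr0.
by exfalso; apply: xA; rewrite inE.
Qed.

End OrbitClt.
Section GibbsClt.
Variables (u : Omega -> X -> R) (S V : Omega -> R) (p A sigma : R) (w0 : Omega).
Local Notation w_ j := (iter j theta w0).
Local Notation ut := (ut E nu h u).
Local Notation muf := (muf E nu h).
Local Notation Snu := (Snu theta T u).
Local Notation Snut := (Snut theta E T nu h u).
Local Notation sig2 := (sig2 theta E T nu h u).
Hypothesis w0G : Good w0.
Hypothesis u_hol : forall w, hol w (u w).
Hypothesis S0 : forall w, Good w -> 0 <= S w.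
Hypothesis V0 : forall w, Good w -> 0 <= V w.
Hypothesis utS : forall w x, Good w -> Fib w x -> `|ut w x| <= S w.
Hypothesis utV : forall w, Good w -> holder dist alpha (Fib w) (V w) (ut w).
Hypothesis p16 : 16 < p.
Hypothesis A1 : 1 <= A.
Hypothesis S_growth : forall n j, (j < n)%N -> S (w_ j) <= A * n%:R `^ p^-1.
Hypothesis c_growth : forall n j, (j < n)%N ->
  cS (w_ j) * S (w_ j) + cV (w_ j) * V (w_ j) <= A * n%:R `^ (3 / p) * kappa (w_ j).
Hypothesis sigma0 : 0 < sigma.
Hypothesis sig2_cvg : (fun n : nat => sig2 w0 n / n%:R) @ \oo --> sigma ^+ 2.

Let v j := ut (w_ j).
Let hF j := on_Fib (w_ j) (h (w_ j)).
Let hF0E x : Fib w0 x -> hF 0 x = h w0 x. Proof. exact: on_FibE. Qed.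
Let wG j : Good (w_ j). Proof. exact: Good_iter. Qed.
Let v_hol j : hol (w_ j) (v j).
Proof.
apply/(in_holderP alpha Hmetric); split; first by exists (S (w_ j)) => x; exact: utS.
by exists (V (w_ j)); [exact: V0|exact: utV].
Qed.

Lemma N_ut_h w : Good w -> N w (ut w * h w) = 0.
Proof.
move=> wG'; have hH := cone_holder wG' (cone_h wG').
transitivity (N w ((- muf w (u w)) *: h w + h w * u w)).
  by apply: eq_N => x xF; rewrite !fct_pointwise /Defs.ut; ring.
rewrite Nlin_hol//; last exact: in_holderM.
by rewrite N_h// mulr1 -[N w (h w * u w)]/(muf w (u w)) addrC subrr.
Qed.

Lemma N_birkhoff0 n : N w0 (birkhoff w0 v n * hF 0) = 0.
Proof.
elim: n => [|n IH].
  rewrite (_ : _ * _ = cst 0) ?(N_cst 0 w0G)//.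
  by apply/funext => y; rewrite !fct_pointwise /birkhoff big_ord0 mul0r.
have bh : bmeas w0 (hF 0).
  by apply: bmeas_hol; apply: hol_on_Fib; apply: cone_holder => //; exact: cone_h.
have bv : bmeas (w_ n) (v n) by exact: bmeas_hol.
transitivity (N w0 (birkhoff w0 v n * hF 0 + (v n \o Tn theta T n w0) * hF 0)).
  by apply: eq_N => y yF; rewrite !fct_pointwise /= birkhoffS; ring.
rewrite ND; last 2 first.
- by apply: bmeasM => //; exact: bmeas_birkhoff.
- by apply: bmeasM => //; exact: bmeas_compTn.
rewrite IH add0r N_h_comp// -[RHS](N_ut_h (wG n)); apply: eq_N => y yF.
by rewrite !fct_pointwise on_FibE.
Qed.

(** The centred sum has zero mean by [N_birkhoff0], so the constant by which it differs from S_n u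
    is the mean of S_n u. *)
Lemma sig2E n : sig2 w0 n = N w0 (birkhoff w0 v n * birkhoff w0 v n * hF 0).
Proof.
pose c := \sum_(j < n) muf (w_ j) (u (w_ j)).
have SE x : Snu w0 n x = birkhoff w0 v n x + c.
  rewrite /Defs.Snu /birkhoff -big_split/=; apply: eq_bigr => j _.
  by rewrite /v /Defs.ut subrK.
have bh : bmeas w0 (hF 0).
  by apply: bmeas_hol; apply: hol_on_Fib; apply: cone_holder => //; exact: cone_h.
have mc : muf w0 (Snu w0 n) = c.
  transitivity (N w0 (c *: hF 0 + birkhoff w0 v n * hF 0)).
    by apply: eq_N => x xF; rewrite /= !fct_pointwise (hF0E xF) SE; ring.
  rewrite ND; last 2 first.
  - exact: bmeasZ.
  - by apply: bmeasM => //; exact: bmeas_birkhoff.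
  rewrite N_birkhoff0 addr0 N_Z// (_ : N w0 (hF 0) = 1) ?mulr1//.
  by rewrite -[RHS](N_h w0G); apply: eq_N => x xF; exact: on_FibE.
rewrite /Defs.sig2 mc; apply: eq_N => x xF.
by rewrite /= !fct_pointwise (hF0E xF) SE; ring.
Qed.

Lemma gibbs_clt : exists (C : R) (M : nat), forall n, (M <= n)%N -> forall t : R,
  `|mu E nu h w0 [set x | Snut w0 n x <= t * Num.sqrt (sig2 w0 n)] - Phi t| <=
  C * n%:R `^ (- (2^-1 - 8 / p)).
Proof.
(* A constant strictly below sigma, so that convergence of the variances gives c^2 n <= Var S_n
   eventually; the minimum provides c <= 1, which [orbit_clt] asks for. *)
pose c := Num.min 1 (sigma / 2).
have c0 : 0 < c by rewrite lt_min ltr01 divr_gt0.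
have c1 : c <= 1 by rewrite ge_min lexx.
have [n0 Hn0] : exists n0, forall n, (n0 <= n)%N ->
    c ^+ 2 * n%:R <= N w0 (birkhoff w0 v n * birkhoff w0 v n * hF 0).
  have lt : c ^+ 2 < sigma ^+ 2.
    rewrite ltrXn2r ?nnegrE ?ltW//; apply: le_lt_trans (_ : c <= sigma / 2) _.
      by rewrite ge_min lexx orbT.
    by rewrite gtr_pMr// invf_lt1// ltr1n.
  have : \forall n \near \oo, c ^+ 2 < sig2 w0 n / n%:R.
    exact: (cvgr_gt _ sig2_cvg).
  move=> [n0 _ Hn0]; exists (maxn n0 1) => n; rewrite geq_max => /andP[nn n1].
  by rewrite -sig2E -ler_pdivlMr ?ltr0n// ltW//; exact: Hn0.
have [C [M CM]] := @orbit_clt w0 v (fun j => S (w_ j)) (fun j => V (w_ j)) p A c n0 w0G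
  (fun j => S0 (wG j)) (fun j => V0 (wG j)) (fun j x => utS (wG j)) (fun j => utV (wG j))
  (fun j => N_ut_h (wG j)) p16 A1 S_growth c_growth c0 c1 Hn0.
by exists C, M => n nM t; rewrite sig2E; exact: CM.
Qed.

End GibbsClt.
End Dynamics.
(** * Growth along almost every orbit *)

Section AlmostEverywhereOrbit.
Context {R : realType} {dO : measure_display} {Omega : measurableType dO}.
Variables (P : probability Omega R) (theta thinv : Omega -> Omega).
Hypothesis Htheta : invertible_mpt_ergodic P theta thinv.

Lemma ae_comp_mpt (f : Omega -> Omega) (Q : Omega -> Prop) :
  measurable_fun setT f -> (forall A, measurable A -> P (f @^-1` A) = P A) ->
  {ae P, forall w, Q w} -> {ae P, forall w, Q (f w)}.
Proof.
move=> mf Pf [A [mA PA QA]]; exists (f @^-1` A); split.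
- by rewrite -[_ @^-1` _]setTI; exact: mf.
- by rewrite Pf.
- by move=> w /= Qw; apply: QA.
Qed.

Lemma ae_iter_mpt (f : Omega -> Omega) (Q : Omega -> Prop) n :
  measurable_fun setT f -> (forall A, measurable A -> P (f @^-1` A) = P A) ->
  {ae P, forall w, Q w} -> {ae P, forall w, Q (iter n f w)}.
Proof.
move=> mf Pf; elim: n Q => //= n IH Q aeQ.
exact: (IH (fun w => Q (f w)) (ae_comp_mpt mf Pf aeQ)).
Qed.

Lemma ae_orbit (Q : Omega -> Prop) : {ae P, forall w, Q w} ->
  {ae P, forall w, forall n m, Q (iter n theta (iter m thinv w))}.
Proof.
case: Htheta => [[mt mtv] tK tvK Pt _] aeQ.
have Ptv A : measurable A -> P (thinv @^-1` A) = P A.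
  move=> mA; rewrite -Pt; last by rewrite -[_ @^-1` _]setTI; exact: mtv.
  by congr (P _); apply/seteqP; split=> w /=; rewrite tK.
apply: ae_foralln => n; apply: ae_foralln => m.
exact: (@ae_iter_mpt thinv (fun w => Q (iter n theta w)) m mtv Ptv (ae_iter_mpt n mt Pt aeQ)).
Qed.

Lemma iter_theta_measure n A : measurable A ->
  measurable (iter n theta @^-1` A) /\ P (iter n theta @^-1` A) = P A.
Proof.
case: Htheta => [[mt _] _ _ Pt _] mA; elim: n => [//|n [mI PI]].
have -> : iter n.+1 theta @^-1` A = theta @^-1` (iter n theta @^-1` A).
  by apply/seteqP; split=> w; rewrite /preimage/mkset iterSr.
by rewrite Pt//; split => //; rewrite -[_ @^-1` _]setTI; exact: mt.
Qed.

(** The bound by m strengthens the induction: when the last indicator is 1, the sum is at most m + 1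
    < x. *)
Lemma sum_indic_le (x : R) m : 0 <= x ->
  \sum_(n < m) (n.+1%:R < x)%R%:R <= Num.min x m%:R :> R.
Proof.
move=> x0; elim: m => [|m IH]; first by rewrite big_ord0 le_min x0 lexx.
rewrite big_ord_recr/=; move: IH; rewrite !le_min => /andP[s1 s2].
have m1 : m.+1%:R = m%:R + 1 :> R by rewrite -natr1.
by case: ltP => h; rewrite ?m1 ?addr0 in h *; apply/andP; split; move: s1 s2 h;
  move: (\sum_(_ < _) _) => s; rewrite /=; lra.
Qed.

(** Borel-Cantelli: by invariance P (f o theta^n > n + 1) = P (f > n + 1), and these probabilities
    sum to at most the integral of f. *)
Lemma ae_orbit_le (f : Omega -> R) : measurable_fun setT f -> (forall w, 0 <= f w) ->
  (\int[P]_w (f w)%:E < +oo)%E ->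
  {ae P, forall w, exists N, forall n, (N <= n)%N -> f (iter n theta w) <= n.+1%:R}.
Proof.
move=> mf f0 foo.
pose G n := [set w | n.+1%:R < f w].
have mG n : measurable (G n).
  rewrite (_ : G n = f @^-1` `]n.+1%:R, +oo[); first by rewrite -[_ @^-1` _]setTI; exact: mf.
  by apply/seteqP; split=> w /=; rewrite in_itv/= andbT.
pose F n := iter n theta @^-1` (G n).
have mF n : measurable (F n) by have [] := iter_theta_measure n (mG n).
have sumF : (\sum_(n <oo) P (F n) < +oo)%E.
  apply: le_lt_trans foo.
  have -> : (\sum_(n <oo) P (F n) = \sum_(n <oo) \int[P]_w (\1_(G n) w)%:E)%E.
    apply: eq_eseriesr => n _; rewrite integral_indic// setIT.
    by have [_ ->] := iter_theta_measure n (mG n).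
  rewrite -integral_nneseries//; last first.
    by move=> n; apply/measurable_EFinP; exact: measurable_indic.
  apply: ge0_le_integral => //.
  - by move=> w _; apply: nneseries_ge0 => n _ _; rewrite lee_fin.
  - apply: ge0_emeasurable_sum => // n _.
    by apply/measurable_EFinP; exact: measurable_indic.
  - exact/measurable_EFinP.
  move=> w _; apply: lime_le; first by apply: is_cvg_nneseries => n _ _; rewrite lee_fin.
  apply: nearW => m; rewrite sumEFin lee_fin big_mkord.
  apply: le_trans (_ : _ <= \sum_(n < m) (n.+1%:R < f w)%R%:R) _.
    apply: ler_sum => n _; rewrite indicE; case: (ltP n.+1%:R (f w)) => h.
      by rewrite mem_set.
    by rewrite memNset// /G /= ltNge h.
  by apply: le_trans (sum_indic_le m (f0 w)) _; rewrite ge_min lexx.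
have := lim_sup_set_cvg0 mF sumF => L0.
exists (lim_sup_set F); split => //.
  by apply: bigcap_measurable => // k _; exact: bigcup_measurable.
move=> w /= nw N _; apply: contrapT => h; apply: nw; exists N => n Nn.
by rewrite leNgt; apply/negP => lt; apply: h; exists n.
Qed.

(** [ae_orbit_le] for |f|^p covers all but finitely many points of the orbit; [C] absorbs the values
    at the others. *)
Lemma ae_orbit_growth (f : Omega -> R) (p : R) : 0 < p -> inLp P p f ->
  {ae P, forall w, exists2 C : R, 1 <= C &
    forall n j, (j < n)%N -> `|f (iter j theta w)| <= C * n%:R `^ p^-1}.
Proof.
move=> p0 [mf foo].
have mfp : measurable_fun setT (fun w => `|f w| `^ p).
  by apply: (measurableT_comp (measurable_powR p)); exact: measurableT_comp.
have := ae_orbit_le mfp (fun w => powR_ge0 _ _) foo.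
apply: filterS => w [N HN].
exists (1 + \sum_(j < N) `|f (iter j theta w)|); first by rewrite lerDl sumr_ge0.
move=> n j jn; have n1 : 1 <= n%:R :> R by rewrite ler1n (leq_trans _ jn).
have s0 : 0 <= \sum_(j < N) `|f (iter j theta w)| by rewrite sumr_ge0.
have P1 : 1 <= n%:R `^ p^-1 :> R by rewrite -[leLHS](powRr0 n%:R) ler_powR// invr_ge0 ltW.
have [jN|Nj] := ltnP j N.
  apply: (@le_trans _ _ (1 + \sum_(j < N) `|f (iter j theta w)|)).
    rewrite (bigD1 (Ordinal jN))//= addrCA lerDl addr_ge0// sumr_ge0//.
  by rewrite ler_peMr// addr_ge0.
have h := HN j Nj.
apply: (@le_trans _ _ (n%:R `^ p^-1)); last by rewrite ler_peMl ?powR_ge0// lerDl.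
have -> : `|f (iter j theta w)| = (`|f (iter j theta w)| `^ p) `^ p^-1.
  by rewrite -powRrM mulfV ?gt_eqF// powRr1.
apply: ge0_ler_powR; rewrite ?nnegrE ?powR_ge0 ?invr_ge0 ?(ltW p0)//.
by apply: le_trans h _; rewrite ler_nat.
Qed.

End AlmostEverywhereOrbit.
(** The tangent of exp at q x, evaluated at 0 and at x and averaged with weights 1 - q and q. *)
Lemma expR_convex_le {R : realType} (q x : R) : 0 <= q <= 1 ->
  expR (q * x) <= 1 - q + q * expR x.
Proof.
move=> /andP[q0 q1]; set y := q * x.
have h1 : expR y * (1 - y) <= 1.
  by have := ler_wpM2l (expR_ge0 y) (expR_ge1Dx (- y)); rewrite expRxMexpNx_1.
have h2 : expR y * (1 + (x - y)) <= expR x.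
  have -> : expR x = expR y * expR (x - y) by rewrite -expRD; congr expR; ring.
  by rewrite ler_wpM2l ?expR_ge0// expR_ge1Dx.
have h3 := ler_wpM2l q0 h2.
have q1' : 0 <= 1 - q by rewrite subr_ge0.
have h4 := ler_wpM2l q1' h1.
apply: le_trans (_ : _ <= (1 - q) * (expR y * (1 - y)) + q * (expR y * (1 + (x - y)))) _.
  by rewrite le_eqVlt; apply/orP; left; apply/eqP; rewrite /y; ring.
by rewrite mulr1 in h4; exact: lerD.
Qed.

(** * The cones of settings A and B *)

Section ExpCone.
Context {R : realType} {dX : measure_display} {X : measurableType dX}.
Variables (dist : X -> X -> R) (alpha : R).
Implicit Types (A : set X) (f g psi : X -> R) (b S V a : R).
Hypothesis hdist0 : forall x y, 0 <= dist x y `^ alpha.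
Hypothesis hdist1 : forall x y, dist x y `^ alpha <= 1.
Hypothesis hdistC : forall x y, dist x y `^ alpha = dist y x `^ alpha.
Local Notation dl x y := (dist x y `^ alpha).

(** For b = gamma_w^alpha this is the cone C_w of setting A; on a nonempty set Hölder regularity
    follows, see [exp_cone_holder]. *)
Definition exp_cone b A f := (forall x, A x -> 0 <= f x) /\
  (forall x x', A x -> A x' -> f x <= expR (b * dl x x') * f x').

Lemma eq_exp_cone b A f g : (forall x, A x -> f x = g x) -> exp_cone b A f -> exp_cone b A g.
Proof.
move=> fg [f0 fb]; split=> [x Ax|x x' Ax Ax']; first by rewrite -fg// f0.
by rewrite -!fg// fb.
Qed.

Lemma exp_coneD b A f g : exp_cone b A f -> exp_cone b A g -> exp_cone b A (f + g).
Proof.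
move=> [f0 fb] [g0 gb]; split=> [x Ax|x x' Ax Ax']; rewrite !fct_pointwise.
  by rewrite addr_ge0 ?f0 ?g0.
by rewrite mulrDr lerD ?fb ?gb.
Qed.

Lemma exp_coneZ b A a f : 0 <= a -> exp_cone b A f -> exp_cone b A (a *: f).
Proof.
move=> a0 [f0 fb]; split=> [x Ax|x x' Ax Ax']; rewrite !fct_pointwise.
  by rewrite mulr_ge0 ?f0.
by rewrite mulrCA ler_wpM2l ?fb.
Qed.

Lemma exp_cone_cvg b A (f_ : nat -> X -> R) f : (forall n, exp_cone b A (f_ n)) ->
  (forall x, A x -> f_ ^~ x @ \oo --> f x) -> exp_cone b A f.
Proof.
move=> fC ff; split=> [x Ax|x x' Ax Ax'].
  rewrite -(cvg_lim (@Rhausdorff R) (ff x Ax)); apply: limr_ge.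
    by apply/cvg_ex; exists (f x); exact: ff.
  by apply: nearW => n; apply: (proj1 (fC n)).
have c' : (fun n => expR (b * dl x x') * f_ n x') @ \oo --> expR (b * dl x x') * f x'.
  by apply: cvgM; [exact: cvg_cst|exact: ff].
by apply: (ler_cvg_to (ff x Ax) c'); apply: nearW => n; apply: (proj2 (fC n)).
Qed.

Lemma exp_cone_one b A : 0 <= b -> exp_cone b A (one (R := R)).
Proof.
move=> b0; split=> [x _|x x' _ _]; rewrite /one ?mulr1 ?ler01//.
by rewrite -expR0 ler_expR mulr_ge0.
Qed.

Lemma exp_cone_harnack b A f x x' : 0 <= b -> exp_cone b A f -> A x -> A x' ->
  f x <= expR b * f x'.
Proof.
move=> b0 [f0 fb] Ax Ax'; apply: le_trans (fb x x' Ax Ax') _.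
by rewrite ler_wpM2r ?f0// ler_expR ler_piMr.
Qed.

Lemma exp_cone_le b b' A f : b <= b' -> exp_cone b A f -> exp_cone b' A f.
Proof.
move=> bb [f0 fb]; split=> // x x' Ax Ax'; apply: le_trans (fb _ _ Ax Ax') _.
by rewrite ler_wpM2r ?f0// ler_expR ler_wpM2r.
Qed.

Lemma exp_cone_holder b A f x0 : 0 <= b -> A x0 -> exp_cone b A f ->
  bounded_on A f /\ exists2 V : R, 0 <= V & holder dist alpha A V f.
Proof.
move=> b0 Ax0 fC; have [f0 fb] := fC.
have fB x : A x -> f x <= expR b * f x0 by move=> Ax; exact: exp_cone_harnack fC _ _.
have B0 : 0 <= expR b * f x0 by rewrite mulr_ge0 ?expR_ge0 ?f0.
split; first by exists (expR b * f x0) => x Ax; rewrite ger0_norm ?f0 ?fB.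
exists (b * expR b * (expR b * f x0)); first by rewrite !mulr_ge0 ?expR_ge0 ?f0.
have key x y : A x -> A y -> f x - f y <= b * expR b * (expR b * f x0) * dl x y.
  move=> Ax Ay; set t := b * dl x y.
  have t0 : 0 <= t by rewrite mulr_ge0.
  have tb : t <= b by rewrite ler_piMr.
  have e1 : expR t - 1 <= t * expR b.
    have h1 : expR t * (1 - t) <= 1.
      by have := ler_wpM2l (expR_ge0 t) (expR_ge1Dx (- t)); rewrite expRxMexpNx_1.
    have h2 : t * expR t <= t * expR b by rewrite ler_wpM2l// ler_expR.
    by move: h1 h2; rewrite mulrBr mulr1 [expR t * t]mulrC; move: (t * expR t) => *; lra.
  apply: le_trans (_ : _ <= (expR t - 1) * f y) _.
    by rewrite mulrBl mul1r lerB// fb.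
  apply: le_trans (ler_wpM2r (f0 _ Ay) e1) _.
  apply: le_trans (ler_wpM2l _ (fB _ Ay)) _; first by rewrite mulr_ge0 ?expR_ge0.
  by rewrite le_eqVlt; apply/orP; left; apply/eqP; rewrite /t; ring.
move=> x y Ax Ay; rewrite ler_norml; apply/andP; split; last exact: key.
by rewrite lerNl opprB hdistC key.
Qed.

(** Adding K + V / b raises the function above V / b. With t = b d^alpha, its variation V d^alpha is
    then at most t times its values, hence at most exp t - 1 times them. *)
Lemma exp_cone_span b A f V K : 0 < b -> (forall x, A x -> `|f x| <= K) -> 0 <= V ->
  holder dist alpha A V f -> exp_cone b A (f + (K + V / b) *: one (R := R)).
Proof.
move=> b0 fK V0 fV.
have lo x : A x -> V / b <= f x + (K + V / b).
  by move=> Ax; have := fK x Ax; rewrite ler_norml => /andP[]; move: (V / b) => *; lra.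
have Vb : 0 <= V / b by rewrite divr_ge0// ltW.
split=> [x Ax|x x' Ax Ax']; rewrite !fct_pointwise /one mulr1.
  exact: le_trans Vb (lo x Ax).
set t := b * dl x x'; have t0 : 0 <= t by rewrite mulr_ge0// ltW.
have h1 : f x - f x' <= t * (V / b).
  apply: le_trans (ler_norm _) _; apply: le_trans (fV x x' Ax Ax') _.
  by rewrite le_eqVlt; apply/orP; left; apply/eqP; rewrite /t; field; rewrite gt_eqF.
have h2 := ler_wpM2l t0 (lo x' Ax').
have h3 : t <= expR t - 1 by rewrite lerBrDl expR_ge1Dx.
have h4 := ler_wpM2r (le_trans Vb (lo x' Ax')) h3.
move: h1 h2 h4; rewrite mulrBl mul1r; move: (t * (V / b)) (expR t * _) (t * (_ + _)) => a1 a2 a3.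
by move: (V / b) => a4; lra.
Qed.

Lemma exp_cone_sub b q A f g a : 0 < b -> 0 <= q < 1 -> 0 <= a ->
  exp_cone (q * b) A f -> exp_cone (q * b) A g ->
  (forall x x', A x -> A x' -> a * g x <= f x') ->
  exp_cone b A (f - ((1 - q) / (1 + q) * a) *: g).
Proof.
move=> b0 /andP[q0 q1] a0 [f0 fb] [g0 gb] agf; set k := (1 - q) / (1 + q).
have q1' : 0 < 1 + q by rewrite ltr_pwDl.
have k0 : 0 <= k by rewrite divr_ge0 ?subr_ge0 ?ltW.
have k1 : k <= 1 by rewrite ler_pdivrMr// mul1r; lra.
split=> [x Ax|x x' Ax Ax']; rewrite !fct_pointwise.
  rewrite subr_ge0 -mulrA; apply: le_trans (agf x x Ax Ax).
  by rewrite ler_piMl// mulr_ge0 ?g0.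
set t := b * dl x x'.
have t0 : 0 <= t by rewrite mulr_ge0// ltW.
have qt : q * b * dl x x' = q * t by rewrite /t; ring.
have h1 := fb x x' Ax Ax'; have h2 := gb x' x Ax' Ax.
rewrite hdistC in h2; rewrite qt in h1 h2.
(* k is chosen so that k (e^t - e^{-qt}) <= e^t - e^{qt}, by convexity of exp. *)
have hk : k * (expR t - expR (- (q * t))) <= expR t - expR (q * t).
  have lam : 0 <= k <= 1 by rewrite k0.
  have := expR_convex_le (- ((1 + q) * t)) lam.
  have -> : k * - ((1 + q) * t) = - ((1 - q) * t) by rewrite /k; field; rewrite gt_eqF.
  move=> /(ler_wpM2l (expR_ge0 t)).
  rewrite mulrDr [expR t * (k * _)]mulrCA -!expRD.
  have -> : t - (1 - q) * t = q * t by ring.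
  have -> : t - (1 + q) * t = - (q * t) by ring.
  by move: (expR (q * t)) (expR (- (q * t))) => *; lra.
have h3 : expR (- (q * t)) * g x' <= g x.
  by rewrite -(ler_pM2l (expR_gt0 (q * t))) mulrA expRxMexpNx_1 mul1r.
have ag := ler_wpM2l k0 (agf x' x' Ax' Ax').
have E0 : 0 <= expR t - expR (- (q * t)).
  by rewrite subr_ge0 ler_expR (le_trans _ t0)// oppr_le0 mulr_ge0.
have h4 := ler_wpM2l E0 ag.
have h5 := ler_wpM2r (f0 _ Ax') hk.
have h6 := ler_wpM2l (mulr_ge0 k0 a0) h3.
apply: le_trans (_ : _ <= expR (q * t) * f x' - k * a * (expR (- (q * t)) * g x')) _.
  by rewrite lerB.
move: h4 h5; have -> : (expR t - expR (- (q * t))) * (k * (a * g x')) =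
  expR t * (k * a * g x') - k * a * (expR (- (q * t)) * g x') by ring.
have -> : (expR t - expR (- (q * t))) * (k * f x') = k * (expR t - expR (- (q * t))) * f x' by ring.
rewrite mulrBl mulrBr => h4 h5; have := le_trans h4 h5; rewrite [in X in _ -> X]mulrBr.
move: (expR t * (k * a * g x')) (k * a * (expR (- (q * t)) * g x')) (expR t * f x')
  (expR (q * t) * f x') => *; lra.
Qed.

End ExpCone.

Section ExpTransfer.
Context {R : realType} {dO : measure_display} {Omega : measurableType dO}.
Context {dX : measure_display} {X : measurableType dX}.
Variables (theta : Omega -> Omega) (E : set (Omega * X)) (T : Omega -> X -> X)
  (phi : Omega -> X -> R) (dist : X -> X -> R) (alpha : R).
Local Notation Fib := (Fib E).
Local Notation Lop := (Lop E T phi).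
Local Notation dl x y := (dist x y `^ alpha).
Hypothesis hdist0 : forall x y, 0 <= dl x y.
Hypothesis hdist1 : forall x y, dl x y <= 1.
Hypothesis hdistC : forall x y, dl x y = dl y x.
Variables (w : Omega) (I : set nat) (y : nat -> X -> X) (D b H b' : R) (x0 : X).
Hypothesis ybr : branches theta E T phi w I y D.
Hypothesis b0 : 0 < b.
Hypothesis H0 : 0 <= H.
Hypothesis Hb' : H + 1 < b'.
Hypothesis x0F : Fib w x0.
Hypothesis y_contr : forall x x' i, Fib (theta w) x -> Fib (theta w) x' -> I i ->
  dl (y i x) (y i x') <= b^-1 * dl x x'.
Hypothesis y_phi : forall x x' i, Fib (theta w) x -> Fib (theta w) x' -> I i ->
  `|phi w (y i x) - phi w (y i x')| <= H * dl x x'.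
Implicit Types (f g psi : X -> R).

Let Fb x i : Fib (theta w) x -> I i -> Fib w (y i x). Proof. exact: (Fib_branch ybr). Qed.

Let cone_bounded f : exp_cone dist alpha b (Fib w) f -> bounded_on (Fib w) f.
Proof. by move=> fC; case: (exp_cone_holder hdist0 hdist1 hdistC (ltW b0) x0F fC). Qed.

(** The potential contributes H, and the cone constant b times the contraction 1 / b contributes
    1. *)
Lemma exp_bweight_le f x x' i : exp_cone dist alpha b (Fib w) f ->
  Fib (theta w) x -> Fib (theta w) x' -> I i ->
  bweight phi w y f x i <= expR ((H + 1) * dl x x') * bweight phi w y f x' i.
Proof.
move=> [f0 fb] xF xF' Ii; rewrite /bweight.
have h1 : expR (phi w (y i x)) <= expR (H * dl x x') * expR (phi w (y i x')).
  rewrite -expRD ler_expR; have := y_phi xF xF' Ii; rewrite ler_norml => /andP[_].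
  by rewrite lerBlDr.
have h2 : f (y i x) <= expR (dl x x') * f (y i x').
  apply: le_trans (fb _ _ (Fb xF Ii) (Fb xF' Ii)) _.
  apply: ler_wpM2r; first exact/f0/Fb.
  rewrite ler_expR -[leRHS]mul1r -(divff (lt0r_neq0 b0)) -mulrA ler_wpM2l ?(ltW b0)//.
  exact: y_contr.
have -> : (H + 1) * dl x x' = H * dl x x' + dl x x' by ring.
rewrite expRD mulrACA; apply: ler_pM => //; rewrite ?expR_ge0//.
exact/f0/Fb.
Qed.

Lemma exp_cone_Lop f : exp_cone dist alpha b (Fib w) f ->
  exp_cone dist alpha (H + 1) (Fib (theta w)) (Lop w f).
Proof.
move=> fC; have fbd := cone_bounded fC; have [f0 fb] := fC.
have b00 : bounded_on (Fib w) (0 : X -> R) by exists 0 => z _; rewrite normr0.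
split=> [x xF|x x' xF xF'].
  by rewrite -(Lop0 ybr xF); apply: (le_Lop ybr) => // z zF; exact: f0.
rewrite -(LopZ_branch ybr)//; apply: (le_Lop_branch ybr) => //; first exact: bounded_onZ.
move=> i Ii; apply: le_trans (exp_bweight_le fC xF xF' Ii) _.
by rewrite /bweight fct_pointwise mulrCA.
Qed.

Lemma exp_cone_mul f psi S V : exp_cone dist alpha b (Fib w) f -> 0 <= S -> 0 <= V ->
  (forall z, Fib w z -> `|psi z| <= S) -> holder dist alpha (Fib w) V psi ->
  exp_cone dist alpha b' (Fib (theta w))
    ((2 / (1 - (H + 1) / b') * S + b^-1 / (b' - 1 - H) * V) *: Lop w f + Lop w (psi * f)).
Proof.
move=> fC S0 V0 psiS psiV; have fbd := cone_bounded fC; have [f0 fb] := fC.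
have pbd : bounded_on (Fib w) psi by exists S.
have pfb : bounded_on (Fib w) (psi * f) by exact: bounded_onM.
have b'0 : 0 < b' by apply: le_lt_trans Hb'; rewrite addr_ge0.
set q := (H + 1) / b'.
have q0 : 0 <= q by rewrite divr_ge0 ?addr_ge0// ltW.
have q1 : q < 1 by rewrite ltr_pdivrMr// mul1r.
have [Lf0 Lfb] := exp_cone_Lop fC.
set c := 2 / (1 - q) * S + b^-1 / (b' - 1 - H) * V.
have cV0 : 0 <= b^-1 / (b' - 1 - H).
  by rewrite divr_ge0 ?invr_ge0 ?(ltW b0)// -addrA -opprD subr_ge0 addrC ltW.
have cS1 : 1 <= 2 / (1 - q) by rewrite ler_pdivlMr ?subr_gt0// mul1r; move: q0; lra.
have Sc : S <= c.
  by apply: (@le_trans _ _ (2 / (1 - q) * S)); [rewrite ler_peMl|rewrite lerDl mulr_ge0].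
have lin x k g : Fib (theta w) x -> bounded_on (Fib w) g ->
    Lop w (k *: f + g) x = k * Lop w f x + Lop w g x.
  by move=> xF gb; exact: (Lop_linear ybr).
have cE x : Fib (theta w) x ->
    (c *: Lop w f + Lop w (psi * f)) x = Lop w (c *: f + psi * f) x.
  by move=> xF; rewrite !fct_pointwise lin.
split=> [x xF|x x' xF xF'].
  rewrite cE//; have b00 : bounded_on (Fib w) (0 : X -> R) by exists 0 => z _; rewrite normr0.
  rewrite -(Lop0 ybr xF); apply: (le_Lop ybr) => //.
    by apply: bounded_onD => //; exact: bounded_onZ.
  move=> z zF; rewrite !fct_pointwise -mulrDl mulr_ge0 ?f0//.
  by have := psiS z zF; rewrite ler_norml => /andP[]; move: Sc; lra.
set d := dl x x'; set t := b' * d.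
have d0 : 0 <= d := hdist0 x x'.
have t0 : 0 <= t by rewrite mulr_ge0// ltW.
have qt : (H + 1) * d = q * t by rewrite /q /t; field; rewrite gt_eqF.
have et1 : t <= expR t - 1 by rewrite lerBrDl expR_ge1Dx.
have conv : (1 - q) * (expR t - 1) <= expR t - expR (q * t).
  have := @expR_convex_le R q t; rewrite q0 (ltW q1) => /(_ isT); lra.
(* The room between the cone constants b' and H + 1 is exp t - exp (q t), at least (1 - q) (exp t -
   1) and so at least (1 - q) t = (b' - 1 - H) d. The first form pays for 2 S (exp t - 1), the
   second for the Hölder term; this is the origin of the two constants in [c]. *)
have K : (V * (b^-1 * d) + 2 * S * (expR t - 1)) <= c * (expR t - expR (q * t)).
  rewrite /c [leRHS]mulrDl [leLHS]addrC; apply: lerD.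
    have -> : 2 / (1 - q) * S * (expR t - expR (q * t)) =
      2 * S * ((expR t - expR (q * t)) / (1 - q)) by field; rewrite gt_eqF// subr_gt0.
    rewrite ler_wpM2l ?mulr_ge0//= ler_pdivlMr ?subr_gt0//.
    by rewrite mulrC.
  have h0 : (1 - q) * t <= expR t - expR (q * t).
    by apply: le_trans conv; rewrite ler_wpM2l// subr_ge0 ltW.
  have qb : (1 - q) * t = (b' - 1 - H) * d by rewrite /q /t; field; rewrite gt_eqF.
  have bH : 0 < b' - 1 - H by rewrite -addrA -opprD subr_gt0 addrC.
  have -> : V * (b^-1 * d) = b^-1 / (b' - 1 - H) * V * ((1 - q) * t).
    by rewrite qb; field; rewrite !gt_eqF.
  by rewrite ler_wpM2l// mulr_ge0.
(* branchwise, with p, p' the weights of f and s, s' the values of psi: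
   s p - e^t s' p' = (s - s') p' + s (p - p') - (e^t - 1) s' p' *)
have key : Lop w (psi * f) x <= expR t * Lop w (psi * f) x' +
    (V * (b^-1 * d) + 2 * S * (expR t - 1)) * Lop w f x'.
  set k := V * (b^-1 * d) + 2 * S * (expR t - 1).
  have -> : expR t * Lop w (psi * f) x' + k * Lop w f x' =
      Lop w (k *: f + expR t *: (psi * f)) x'.
    rewrite lin//; last exact: bounded_onZ.
    by rewrite (LopZ_branch ybr)// addrC.
  apply: (le_Lop_branch ybr) => //.
    by apply: bounded_onD; exact: bounded_onZ.
  move=> i Ii; have yF := Fb xF Ii; have yF' := Fb xF' Ii.
  have p1 := exp_bweight_le fC xF xF' Ii; have p2 := exp_bweight_le fC xF' xF Ii.
  rewrite (hdistC x' x) in p2; rewrite -/d qt in p1 p2.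
  have P0 z j : Fib w (y j z) -> 0 <= bweight phi w y f z j.
    by move=> zF; rewrite /bweight mulr_ge0 ?expR_ge0 ?f0.
  move: p1 p2 (P0 x i yF) (P0 x' i yF').
  have -> : bweight phi w y (psi * f) x i = psi (y i x) * bweight phi w y f x i.
    by rewrite /bweight !fct_pointwise; ring.
  have -> : bweight phi w y (k *: f + expR t *: (psi * f)) x' i =
     (k + expR t * psi (y i x')) * bweight phi w y f x' i.
    by rewrite /bweight !fct_pointwise; ring.
  have s1 := psiS _ yF; have s2 := psiS _ yF'.
  have s3 : `|psi (y i x) - psi (y i x')| <= V * (b^-1 * d).
    apply: le_trans (psiV _ _ yF yF') _; rewrite ler_wpM2l//.
    exact: y_contr.
  have eqt : expR (q * t) <= expR t by rewrite ler_expR ler_piMl// ltW.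
  have eq1 : 1 <= expR (q * t) by rewrite -expR0 ler_expR mulr_ge0.
  move: (bweight phi w y f x i) (bweight phi w y f x' i) => p p' h1 h2 p0 p'0.
  move: (psi (y i x)) (psi (y i x')) s1 s2 s3 => s s' s1 s2 s3.
  have a1 : (s - s') * p' <= V * (b^-1 * d) * p'.
    by rewrite ler_wpM2r// (le_trans (ler_norm _)).
  have a2 : s * (p - p') <= S * ((expR t - 1) * p').
    apply: le_trans (ler_norm _) _; rewrite normrM; apply: ler_pM => //.
    have e1 : expR (q * t) * p' <= expR t * p' by rewrite ler_wpM2r.
    rewrite ler_norml; apply/andP; split; last by move: h1 e1; rewrite mulrBl mul1r; lra.
    have : p' - p <= (expR (q * t) - 1) * p'.
      have [pp|pp] := leP p' p.
        by apply: le_trans (_ : 0 <= _); [rewrite subr_le0|rewrite mulr_ge0// subr_ge0].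
      apply: le_trans (_ : _ <= (expR (q * t) - 1) * p) _.
        by move: h2; rewrite mulrBl mul1r; lra.
      by rewrite ler_wpM2l ?subr_ge0// ltW.
    by move: e1; rewrite !mulrBl !mul1r; lra.
  have a3 : - ((expR t - 1) * s' * p') <= S * ((expR t - 1) * p').
    have -> : - ((expR t - 1) * s' * p') = - s' * ((expR t - 1) * p') by ring.
    apply: ler_wpM2r; first exact: mulr_ge0 (le_trans t0 et1) p'0.
    by move: s2; rewrite ler_norml => /andP[]; lra.
  have -> : s * p = expR t * s' * p' + ((s - s') * p' + s * (p - p') - (expR t - 1) * s' * p').
    by ring.
  rewrite [leRHS]mulrDl [leRHS]addrC lerD2l /k.
  apply: le_trans (lerD (lerD a1 a2) a3) _.
  by rewrite le_eqVlt; apply/orP; left; apply/eqP; ring.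
have L1 := Lfb x x' xF xF'; rewrite -/d qt in L1.
have c0 : 0 <= c by exact: le_trans Sc.
have L2 := ler_wpM2l c0 L1; have L3 := ler_wpM2r (Lf0 _ xF') K.
rewrite !fct_pointwise [leRHS]mulrDr.
apply: le_trans (lerD L2 key) _; move: L3.
have -> : c * (expR t - expR (q * t)) * Lop w f x' =
  expR t * (c * Lop w f x') - c * (expR (q * t) * Lop w f x') by ring.
by move: (_ * Lop w f x') (expR t * (c * _)) (c * (_ * _)) (expR t * Lop w (psi * f) x') => *; lra.
Qed.

End ExpTransfer.

(** * The cones of setting B *)

Section LipCone.
Context {R : realType} {dX : measure_display} {X : measurableType dX}.
Variables (dist : X -> X -> R) (alpha : R).
Implicit Types (A : set X) (f g psi : X -> R) (k S V a : R).
Hypothesis hdist0 : forall x y, 0 <= dist x y `^ alpha.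
Hypothesis hdist1 : forall x y, dist x y `^ alpha <= 1.
Local Notation dl x y := (dist x y `^ alpha).

(** This is v(f) <= k inf f with the infimum replaced by an arbitrary point z. Nonnegativity in
    place of positivity makes the cone closed under pointwise limits. *)
Definition lip_cone k A f := (forall x, A x -> 0 <= f x) /\
  (forall x x' z, A x -> A x' -> A z -> `|f x - f x'| <= k * dl x x' * f z).

Lemma eq_lip_cone k A f g : (forall x, A x -> f x = g x) -> lip_cone k A f -> lip_cone k A g.
Proof.
move=> fg [f0 fb]; split=> [x Ax|x x' z Ax Ax' Az]; first by rewrite -fg// f0.
by rewrite -!fg// fb.
Qed.

Lemma lip_coneD k A f g : lip_cone k A f -> lip_cone k A g -> lip_cone k A (f + g).
Proof.
move=> [f0 fb] [g0 gb]; split=> [x Ax|x x' z Ax Ax' Az]; rewrite !fct_pointwise.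
  by rewrite addr_ge0 ?f0 ?g0.
by rewrite mulrDr opprD addrACA ler_normD_le ?fb ?gb.
Qed.

Lemma lip_coneZ k A a f : 0 <= a -> lip_cone k A f -> lip_cone k A (a *: f).
Proof.
move=> a0 [f0 fb]; split=> [x Ax|x x' z Ax Ax' Az]; rewrite !fct_pointwise.
  by rewrite mulr_ge0 ?f0.
by rewrite -mulrBr normrM ger0_norm// mulrCA ler_wpM2l ?fb.
Qed.

Lemma lip_cone_cvg k A (f_ : nat -> X -> R) f : (forall n, lip_cone k A (f_ n)) ->
  (forall x, A x -> f_ ^~ x @ \oo --> f x) -> lip_cone k A f.
Proof.
move=> fC ff; split=> [x Ax|x x' z Ax Ax' Az].
  rewrite -(cvg_lim (@Rhausdorff R) (ff x Ax)); apply: limr_ge.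
    by apply/cvg_ex; exists (f x); exact: ff.
  by apply: nearW => n; apply: (proj1 (fC n)).
have c1 : (fun n => `|f_ n x - f_ n x'|) @ \oo --> `|f x - f x'|.
  by apply: cvg_norm; apply: cvgB; exact: ff.
have c2 : (fun n => k * dl x x' * f_ n z) @ \oo --> k * dl x x' * f z.
  by apply: cvgM; [exact: cvg_cst|exact: ff].
by apply: (ler_cvg_to c1 c2); apply: nearW => n; apply: (proj2 (fC n)).
Qed.

Lemma lip_cone_one k A : 0 <= k -> lip_cone k A (one (R := R)).
Proof.
move=> k0; split=> [x _|x x' z _ _ _]; rewrite /one ?ler01//.
by rewrite subrr normr0 mulr1 mulr_ge0.
Qed.

Lemma lip_cone_harnack k A f x x' : 0 <= k -> lip_cone k A f -> A x -> A x' ->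
  f x <= (1 + k) * f x'.
Proof.
move=> k0 [f0 fb] Ax Ax'; have := fb x x' x' Ax Ax' Ax'.
rewrite ler_norml => /andP[_]; rewrite lerBlDr => h; apply: le_trans h _.
by rewrite mulrDl mul1r addrC lerD2l ler_wpM2r ?f0// ler_piMr.
Qed.

Lemma lip_cone_holder k A f x0 : 0 <= k -> A x0 -> lip_cone k A f ->
  bounded_on A f /\ exists2 V : R, 0 <= V & holder dist alpha A V f.
Proof.
move=> k0 Ax0 fC; have [f0 fb] := fC; split.
  exists ((1 + k) * f x0) => x Ax; rewrite ger0_norm ?f0//.
  exact: lip_cone_harnack fC _ _.
exists (k * f x0); first by rewrite mulr_ge0 ?f0.
by move=> x y Ax Ay; rewrite mulrAC fb.
Qed.

Lemma lip_cone_span k A f V K : 0 < k -> (forall x, A x -> `|f x| <= K) -> 0 <= V ->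
  holder dist alpha A V f -> lip_cone k A (f + (K + V / k) *: one (R := R)).
Proof.
move=> k0 fK V0 fV.
have lo x : A x -> V / k <= f x + (K + V / k).
  by move=> Ax; have := fK x Ax; rewrite ler_norml => /andP[]; move: (V / k) => *; lra.
have Vk : 0 <= V / k by rewrite divr_ge0// ltW.
split=> [x Ax|x x' z Ax Ax' Az]; rewrite !fct_pointwise /one mulr1.
  exact: le_trans Vk (lo x Ax).
have -> : f x + (K + V / k) - (f x' + (K + V / k)) = f x - f x' by ring.
apply: le_trans (fV x x' Ax Ax') _.
have := ler_wpM2l (mulr_ge0 (ltW k0) (hdist0 x x')) (lo z Az); apply: le_trans.
by rewrite le_eqVlt; apply/orP; left; apply/eqP; field; rewrite gt_eqF.
Qed.

(** At each point the claim reduces to z (f + c a g) <= f - c a g with c = (1 - z) / 2. As a g <= f,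
    it follows from c (1 + z) <= 1 - z. *)
Lemma lip_cone_sub k z A f g a : 0 <= k -> 0 <= z < 1 -> 0 <= a ->
  lip_cone (z * k) A f -> lip_cone (z * k) A g ->
  (forall x x', A x -> A x' -> a * g x <= f x') ->
  lip_cone k A (f - ((1 - z) / 2 * a) *: g).
Proof.
move=> k0 /andP[z0 z1] a0 [f0 fb] [g0 gb] agf; set c := (1 - z) / 2.
have c0 : 0 <= c by rewrite /c; lra.
have c1 : c <= 1 by rewrite /c; lra.
split=> [x Ax|x x' y Ax Ax' Ay]; rewrite !fct_pointwise.
  rewrite subr_ge0 -mulrA; apply: le_trans (agf x x Ax Ax).
  by rewrite ler_piMl// mulr_ge0 ?g0.
have -> : f x - c * a * g x - (f x' - c * a * g x') =
  (f x - f x') + - (c * a * (g x - g x')) by ring.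
have ca : 0 <= c * a by exact: mulr_ge0.
have h1 : `|- (c * a * (g x - g x'))| <= c * a * (z * k * dl x x' * g y).
  by rewrite normrN normrM (ger0_norm ca) ler_wpM2l// gb.
apply: le_trans (ler_normD_le (fb x x' y Ax Ax' Ay) h1) _.
have kd : 0 <= k * dl x x' by exact: mulr_ge0.
have -> : z * k * dl x x' * f y + c * a * (z * k * dl x x' * g y) =
  k * dl x x' * (z * f y + z * (c * (a * g y))) by ring.
apply: (ler_wpM2l kd); rewrite -(mulrA c); have h := agf y y Ay Ay.
have h2 := ler_wpM2l c0 h; have zc := ler_wpM2l z0 h2.
have cz : c * f y + z * (c * f y) <= (1 - z) * f y.
  have e : (1 - z) * f y - (c * f y + z * (c * f y)) = (1 - z) * (1 - z) / 2 * f y.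
    by rewrite /c; field.
  have : 0 <= (1 - z) * (1 - z) / 2 * f y by rewrite !mulr_ge0 ?f0 ?subr_ge0 ?ltW.
  rewrite -e; lra.
rewrite mulrBl mul1r in cz; move: h2 zc cz; move: (c * (a * g y)) (c * f y) => *; lra.
Qed.

End LipCone.

Lemma rsum_index_iota {R : realType} (d : nat) (a : nat -> R) :
  rsum [set i | (1 <= i <= d)%N] a = \sum_(1 <= i < d.+1) a i.
Proof.
have IE : [set i | (1 <= i <= d)%N] = [set` index_iota 1 d.+1].
  by apply/seteqP; split=> i /=; rewrite mem_index_iota ltnS.
have fin : finite_set [set i | (1 <= i <= d)%N] by rewrite IE.
rewrite /rsum !esum_fset//; last 2 first.
- by move=> i _; rewrite lee_fin le_max lexx orbT.
- by move=> i _; rewrite lee_fin le_max lexx orbT.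
rewrite IE -!fsbig_seq ?iota_uniq// !sumEFin/= -sumrB.
by apply: eq_bigr => i _; rewrite /Num.max; case: ifP; case: ifP; lra.
Qed.
Lemma expR_diff_le {R : realType} (a b M : R) : a <= M -> b <= M ->
  `|expR a - expR b| <= expR M * `|a - b|.
Proof.
wlog ab : a b / b <= a.
  move=> H aM bM; have [ba|/ltW ab] := leP b a; first exact: H.
  by rewrite distrC (distrC a); exact: H.
move=> aM bM; rewrite !ger0_norm ?subr_ge0 ?ler_expR//.
have h : expR a * (1 + (b - a)) <= expR b.
  have -> : expR b = expR a * expR (b - a) by rewrite -expRD; congr expR; ring.
  by rewrite ler_wpM2l ?expR_ge0// expR_ge1Dx.
apply: le_trans (_ : _ <= expR a * (a - b)) _.
  by move: h; rewrite mulrDr mulr1 !mulrBr; move: (expR a * b) (expR a * a) => *; lra.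
by rewrite ler_wpM2r ?subr_ge0// ler_expR.
Qed.

Section LipTransfer.
Context {R : realType} {dO : measure_display} {Omega : measurableType dO}.
Context {dX : measure_display} {X : measurableType dX}.
Variables (theta : Omega -> Omega) (E : set (Omega * X)) (T : Omega -> X -> X)
  (phi : Omega -> X -> R) (dist : X -> X -> R) (alpha : R).
Local Notation Fib := (Fib E).
Local Notation Lop := (Lop E T phi).
Local Notation dl x y := (dist x y `^ alpha).
Hypothesis hdist0 : forall x y, 0 <= dl x y.
Hypothesis hdist1 : forall x y, dl x y <= 1.
Variables (w : Omega) (n : nat) (y : nat -> X -> X) (D : R) (l : nat -> R)
  (a s H M m : R).
Local Notation I := [set i | (1 <= i <= n)%N].
Hypothesis ybr : branches theta E T phi w I y D.
Hypothesis n0 : (0 < n)%N.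
Hypothesis s0 : 0 < s.
Hypothesis s1 : s < 1.
Hypothesis H0 : 0 <= H.
Hypothesis l0 : forall i, 0 <= l i.
Hypothesis suml : \sum_(1 <= i < n.+1) l i = n%:R * a.
Hypothesis as_ : expR (M - m) * a = s.
Hypothesis phi_le : forall x, Fib w x -> phi w x <= M.
Hypothesis phi_ge : forall x, Fib w x -> m <= phi w x.
Hypothesis y_contr : forall x x' i, Fib (theta w) x -> Fib (theta w) x' -> I i ->
  dl (y i x) (y i x') <= l i * dl x x'.
Hypothesis y_phi : forall x x' i, Fib (theta w) x -> Fib (theta w) x' -> I i ->
  `|phi w (y i x) - phi w (y i x')| <= H * dl x x'.
Implicit Types (f g psi : X -> R).
Local Notation cone f := (lip_cone dist alpha s^-1 (Fib w) f).
Local Notation bw := (bweight phi w y).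
(** This is zeta_w / s_{theta w}. The summand 1 is s^-1 exp (M - m) a, the averaged contraction of
    the branches; the other one comes from the variation of phi. *)
Let Z := 1 + (1 + s^-1) * (expR (M - m) * H).

Let Fb x i : Fib (theta w) x -> I i -> Fib w (y i x). Proof. exact: (Fib_branch ybr). Qed.
Let nR : 0 < n%:R :> R. Proof. by rewrite ltr0n. Qed.
Let si0 : 0 < s^-1. Proof. by rewrite invr_gt0. Qed.

Lemma Lop_sum x f : Fib (theta w) x -> Lop w f x = \sum_(1 <= i < n.+1) bw f x i.
Proof. by move=> xF; rewrite -rsum_index_iota /Defs.Lop /rsum !(esum_branch ybr). Qed.

Let ler_sumI (F G : nat -> R) : (forall i, I i -> F i <= G i) ->
  \sum_(1 <= i < n.+1) F i <= \sum_(1 <= i < n.+1) G i.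
Proof.
by move=> FG; rewrite !big_nat; apply: ler_sum => i; rewrite ltnS; exact: FG.
Qed.

(** An upper bound for the average of f over the preimages of z, because phi >= m. The cone
    inequality on the fibre is applied with each preimage of z as third point; averaging over them
    expresses the bound through L f z. *)
Let ave f z := expR (- m) * Lop w f z / n%:R.

Let le_ave f z c k : cone f -> Fib (theta w) z -> 0 <= k ->
  (forall j, I j -> c <= k * f (y j z)) -> c <= k * ave f z.
Proof.
move=> [f0 _] zF k0 cf.
have h1 : \sum_(1 <= j < n.+1) c <= \sum_(1 <= j < n.+1) k * (expR (- m) * bw f z j).
  apply: ler_sumI => j Ij; apply: le_trans (cf j Ij) _; rewrite ler_wpM2l//.
  rewrite /bweight mulrA -expRD ler_peMl ?f0//; first exact: Fb.
  by rewrite -expR0 ler_expR addrC subr_ge0 phi_ge//; exact: Fb.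
move: h1; rewrite sumr_const_nat subn1 /= -mulr_sumr -mulr_sumr -Lop_sum// => h1.
by rewrite /ave mulrA ler_pdivlMr// mulr_natr.
Qed.

Let ave_ge0 f z : cone f -> Fib (theta w) z -> 0 <= ave f z.
Proof.
move=> fC zF; rewrite -[leRHS]mul1r; apply: le_ave => // j Ij.
by rewrite mul1r; apply: (proj1 fC); exact: Fb.
Qed.

Let f_le_ave f x z i : cone f -> Fib (theta w) x -> Fib (theta w) z -> I i ->
  f (y i x) <= (1 + s^-1) * ave f z.
Proof.
move=> fC xF zF Ii; apply: le_ave => //; first by rewrite addr_ge0// ltW.
by move=> j Ij; apply: (lip_cone_harnack hdist1 (ltW si0) fC); exact: Fb.
Qed.

Let bw_diff f x x' z i : cone f -> Fib (theta w) x -> Fib (theta w) x' ->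
  Fib (theta w) z -> I i ->
  `|bw f x i - bw f x' i| <=
  expR M * dl x x' * ave f z * (s^-1 * l i + H * (1 + s^-1)).
Proof.
move=> fC xF xF' zF Ii; have yF := Fb xF Ii; have yF' := Fb xF' Ii.
rewrite /bweight; have -> : expR (phi w (y i x)) * f (y i x) - expR (phi w (y i x')) * f (y i x') =
  expR (phi w (y i x)) * (f (y i x) - f (y i x')) +
  (expR (phi w (y i x)) - expR (phi w (y i x'))) * f (y i x') by ring.
have a0 := ave_ge0 fC zF.
have h1 : `|f (y i x) - f (y i x')| <= s^-1 * (l i * dl x x') * ave f z.
  apply: le_ave => //; first by rewrite !mulr_ge0// ltW.
  move=> j Ij; apply: le_trans (proj2 fC _ _ _ yF yF' (Fb zF Ij)) _.
  apply: ler_wpM2r; first by apply: (proj1 fC); exact: Fb.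
  by rewrite ler_wpM2l ?(ltW si0)// y_contr.
have h2 : `|expR (phi w (y i x)) - expR (phi w (y i x'))| <= expR M * (H * dl x x').
  apply: le_trans (expR_diff_le (phi_le yF) (phi_le yF')) _.
  by rewrite ler_wpM2l ?expR_ge0// y_phi.
have h3 : f (y i x') <= (1 + s^-1) * ave f z by exact: f_le_ave.
have f0 : 0 <= f (y i x') by exact: (proj1 fC).
apply: le_trans (_ : _ <= expR M * (s^-1 * (l i * dl x x') * ave f z) +
    expR M * (H * dl x x') * ((1 + s^-1) * ave f z)) _; last first.
  by rewrite le_eqVlt; apply/orP; left; apply/eqP; ring.
apply: ler_normD_le; rewrite normrM; apply: ler_pM => //.
  by rewrite ger0_norm ?expR_ge0// ler_expR phi_le.
by rewrite ger0_norm.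
Qed.

Let sum_bw_diff f x x' z : cone f -> Fib (theta w) x -> Fib (theta w) x' -> Fib (theta w) z ->
  \sum_(1 <= i < n.+1) `|bw f x i - bw f x' i| <= Z * dl x x' * Lop w f z.
Proof.
move=> fC xF xF' zF.
apply: le_trans (ler_sumI (fun i Ii => bw_diff fC xF xF' zF Ii)) _.
rewrite -mulr_sumr big_split/= -mulr_sumr suml sumr_const_nat subn1/= -mulr_natl.
rewrite le_eqVlt; apply/orP; left; apply/eqP.
have e1 : expR M * expR (- m) = expR (M - m) by rewrite -expRD.
rewrite /ave /Z -e1.
have e2 : expR M * expR (- m) * a = s by rewrite e1.
transitivity (dl x x' * Lop w f z *
  (s^-1 * (expR M * expR (- m) * a) + expR M * expR (- m) * (H * (1 + s^-1)))).
  by field; rewrite !gt_eqF.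
by rewrite e2; field; rewrite gt_eqF.
Qed.

Let Lop_ge0 f x : cone f -> Fib (theta w) x -> 0 <= Lop w f x.
Proof.
move=> fC xF; rewrite Lop_sum// big_nat; apply: sumr_ge0 => i; rewrite ltnS => Ii.
by rewrite /bweight mulr_ge0 ?expR_ge0//; apply: (proj1 fC); exact: Fb.
Qed.

Lemma lip_cone_Lop f : cone f -> lip_cone dist alpha Z (Fib (theta w)) (Lop w f).
Proof.
move=> fC; split=> [x xF|x x' z xF xF' zF]; first exact: Lop_ge0.
apply: le_trans (sum_bw_diff fC xF xF' zF).
by rewrite !Lop_sum// -sumrB; exact: ler_norm_sum.
Qed.

(** The sum is at least (c - S) L f, and its variation at most (c Z + S Z + 2 V) d^alpha L f. With z
    = Z s', membership requires c (1 - z) >= S (1 + z) + 2 s' V; the choice of c gives c (1 - z) = 2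
    S + 2 s' V. *)
Lemma lip_cone_mul f psi S V s' : cone f -> 0 <= S -> 0 <= V -> 0 < s' -> Z * s' < 1 ->
  (forall x, Fib w x -> `|psi x| <= S) -> holder dist alpha (Fib w) V psi ->
  lip_cone dist alpha s'^-1 (Fib (theta w))
    ((2 / (1 - Z * s') * S + 2 * s' / (1 - Z * s') * V) *: Lop w f + Lop w (psi * f)).
Proof.
move=> fC S0 V0 s'0 Zs1 psiS psiV; set z := Z * s' in Zs1 *.
have Z1 : 1 <= Z.
  by rewrite lerDl mulr_ge0 ?addr_ge0 ?(ltW si0)// mulr_ge0 ?expR_ge0.
have z0 : 0 <= z by rewrite mulr_ge0 ?(ltW s'0)// (le_trans ler01).
have z1 : 0 < 1 - z by rewrite subr_gt0.
set c := _ * S + _ * V.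
have cE : c * (1 - z) = 2 * S + 2 * s' * V by rewrite /c; field; rewrite gt_eqF.
have Sc : S <= c.
  rewrite -(ler_pM2r z1) cE; have := mulr_ge0 (ltW s'0) V0; have := mulr_ge0 S0 z0.
  by rewrite mulrBr mulr1 -mulrA; move: (s' * V) (S * z) => *; lra.
have bwM x i : bw (psi * f) x i = psi (y i x) * bw f x i.
  by rewrite /bweight !fct_pointwise; ring.
have bw0 x i : Fib (theta w) x -> I i -> 0 <= bw f x i.
  by move=> xF Ii; rewrite /bweight mulr_ge0 ?expR_ge0//; apply: (proj1 fC); exact: Fb.
have lo u : Fib (theta w) u -> (c - S) * Lop w f u <= c * Lop w f u + Lop w (psi * f) u.
  move=> uF; rewrite mulrBl lerD2l !Lop_sum// -mulNr mulr_sumr; apply: ler_sumI => i Ii.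
  rewrite bwM; apply: ler_wpM2r; first exact: bw0.
  by have := psiS _ (Fb uF Ii); rewrite ler_norml => /andP[].
split=> [x xF|x x' u xF xF' uF]; rewrite ![(c *: Lop w f + Lop w (psi * f)) _]fct_pointwise
    ![(c *: Lop w f) _]fct_pointwise.
  by apply: le_trans (lo x xF); apply: mulr_ge0; [rewrite subr_ge0|exact: Lop_ge0].
have d0 := hdist0 x x'; set d := dl x x' in d0 *.
have L0 := Lop_ge0 fC uF.
have psi_part : `|Lop w (psi * f) x - Lop w (psi * f) x'| <= (S * Z + 2 * V) * d * Lop w f u.
  have step i : I i -> `|bw (psi * f) x i - bw (psi * f) x' i| <=
      S * `|bw f x i - bw f x' i| + V * d * (expR M * ((1 + s^-1) * ave f u)) * l i.
    move=> Ii; have yF := Fb xF Ii; have yF' := Fb xF' Ii; rewrite !bwM.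
    have -> : psi (y i x) * bw f x i - psi (y i x') * bw f x' i =
      psi (y i x) * (bw f x i - bw f x' i) + (psi (y i x) - psi (y i x')) * bw f x' i by ring.
    have -> : V * d * (expR M * ((1 + s^-1) * ave f u)) * l i =
      V * (l i * d) * (expR M * ((1 + s^-1) * ave f u)) by ring.
    apply: ler_normD_le; rewrite normrM; apply: ler_pM => //; first exact: psiS.
      by apply: le_trans (psiV _ _ yF yF') _; rewrite ler_wpM2l// y_contr.
    rewrite ger0_norm ?bw0// /bweight; apply: ler_pM; rewrite ?expR_ge0//.
    - exact: (proj1 fC).
    - by rewrite ler_expR phi_le.
    - exact: f_le_ave.
  rewrite !Lop_sum// -sumrB; apply: le_trans (ler_norm_sum _ _ _) _.
  apply: le_trans (ler_sumI step) _.
  rewrite big_split/= -!mulr_sumr suml.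
  have h1 := ler_wpM2l S0 (sum_bw_diff fC xF xF' uF).
  apply: le_trans (lerD h1 (lexx _)) _.
  have e1 : expR M * expR (- m) = expR (M - m) by rewrite -expRD.
  have -> : V * d * (expR M * ((1 + s^-1) * ave f u)) * (n%:R * a) =
      V * d * (1 + s) * Lop w f u.
    transitivity (V * d * (1 + s^-1) * (expR M * expR (- m) * a) * Lop w f u).
      by rewrite /ave; field; rewrite !gt_eqF.
    by rewrite e1 as_; field; rewrite gt_eqF.
  rewrite -/d -Lop_sum//; have h2 : V * d * (1 + s) * Lop w f u <= V * d * 2 * Lop w f u.
    apply: ler_wpM2r => //; apply: ler_wpM2l; first exact: mulr_ge0.
    by have := s1; lra.
  have -> : (S * Z + 2 * V) * d * Lop w f u = S * (Z * d * Lop w f u) + V * d * 2 * Lop w f u by ring.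
  by rewrite lerD2l.
have f_part : `|c * (Lop w f x - Lop w f x')| <= c * (Z * d * Lop w f u).
  have c0 : 0 <= c by exact: le_trans Sc.
  by rewrite normrM ger0_norm// ler_wpM2l//; exact: (proj2 (lip_cone_Lop fC)).
have -> : c * Lop w f x + Lop w (psi * f) x - (c * Lop w f x' + Lop w (psi * f) x') =
  c * (Lop w f x - Lop w f x') + (Lop w (psi * f) x - Lop w (psi * f) x').
  by move: (Lop w f x) (Lop w f x') (Lop w (psi * f) x) (Lop w (psi * f) x') => *; ring.
apply: le_trans (ler_normD_le f_part psi_part) _.
have k0 : 0 <= s'^-1 * d by rewrite mulr_ge0// invr_ge0 ltW.
apply: le_trans (ler_wpM2l k0 (lo u uF)).
have -> : c * (Z * d * Lop w f u) + (S * Z + 2 * V) * d * Lop w f u =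
  s'^-1 * d * ((c * z + S * z + 2 * s' * V) * Lop w f u).
  by rewrite /z; field; rewrite gt_eqF.
apply: ler_wpM2l => //; apply: ler_wpM2r => //.
have := mulr_ge0 S0 (ltW z1); move: cE; rewrite !mulrBr !mulr1.
by move: (c * z) (S * z) (2 * s' * V) => *; lra.
Qed.

End LipTransfer.

(** * Cost against contraction under the bound on E *)

Section RealCosh.
Context {R : realType}.
Implicit Types (x c d : R).

Lemma expR_le_cosh x : expR x / 2 <= cosh x.
Proof. by rewrite /cosh ler_wpM2r// lerDl expR_ge0. Qed.

Lemma cosh_ge0 x : 0 <= cosh x.
Proof. by apply: le_trans (expR_le_cosh x); rewrite divr_ge0 ?expR_ge0. Qed.

(** A finite bound on E excludes the conventional value +oo of D and of the quotient in c0, so q < 1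
    or zeta < 1, and positive denominators, come with it. *)
Lemma Edef_le_fin (c0 D : \bar R) (C : R) : (0 <= c0)%E -> (Edef c0 D <= C%:E)%E ->
  exists c d, [/\ c0 = c%:E, D = d%:E & c * (1 + cosh (7 * d / 2)) <= C].
Proof.
case: D => [d| |] //= c00.
have p : 0 < 1 + cosh (7 * d / 2) by rewrite ltr_pwDl// cosh_ge0.
case: c0 c00 => [c| |] //= c00; last by rewrite mulyr gtr0_sg// mul1e.
by rewrite lee_fin => h; exists c, d.
Qed.

End RealCosh.

Lemma ediv_ge0 {R : realType} (a b : R) : 0 <= a -> (0 <= ediv a b)%E.
Proof. by move=> a0; rewrite /ediv; case: ifP => // b0; rewrite lee_fin divr_ge0// ltW. Qed.

(** The factor cosh (7 D / 2) pays for the ratio of cost to contraction. With Q = (1 + q) / (1 - q),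
    D is at least H + 1 + 2 ln Q, so cosh (7 D / 2) >= exp (H + 1)^2 Q^2 / 2. The cost is at most c0
    Q and the contraction is 1 / (Q exp (H + 1)^2), so their ratio is at most 2 c0 cosh (7 D / 2) <=
    2 C. *)
Lemma settingA_const {R : realType} (S V b b' H C : R) (q := (H + 1) * b'^-1)
    (Ht := b^-1 * V + H) : 0 <= S -> 0 <= V -> 0 < b -> 0 < b' -> 0 <= H ->
  (Edef ((3 * S)%:E + ediv Ht (b' - 1 - Ht))
     (if (q < 1)%R then (b' + 2 * ln ((1 + q) / (1 - q)))%:E else +oo) <= C%:E)%E ->
  [/\ H + 1 < b', S <= C &
    2 / (1 - q) * S + b^-1 / (b' - 1 - H) * V <=
    2 * C * ((1 - q) / (1 + q) / expR (H + 1) ^+ 2)].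
Proof.
move=> S0 V0 b0 b'0 H0 EC.
have Ht0 : 0 <= Ht by rewrite addr_ge0// mulr_ge0// invr_ge0 ltW.
have q0 : 0 <= q by rewrite mulr_ge0 ?addr_ge0// invr_ge0 ltW.
have c00 : (0 <= (3 * S)%:E + ediv Ht (b' - 1 - Ht))%E.
  by rewrite adde_ge0 ?ediv_ge0// lee_fin mulr_ge0.
have [c [d [cE dE cC]]] := Edef_le_fin c00 EC.
move: dE; case: ifP => // q1 [dE].
move: cE; rewrite /ediv; case: ifP => // HtP [cE].
have q1' : 0 < 1 - q by rewrite subr_gt0.
have Hb : H + 1 < b'.
  have : 0 <= b^-1 * V by rewrite mulr_ge0// invr_ge0 ltW.
  by move: HtP; rewrite /Ht; move: (b^-1 * V) => v; lra.
set r := Ht / (b' - 1 - Ht) in cE.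
have r0 : 0 <= r by rewrite divr_ge0// ltW.
set Q := (1 + q) / (1 - q).
have Q1 : 1 <= Q by rewrite ler_pdivlMr// mul1r; move: q0; lra.
have Q0 : 0 < Q by exact: lt_le_trans ltr01 Q1.
have lnQ : 0 <= ln Q by rewrite ln_ge0.
have ch : expR (H + 1) ^+ 2 * Q ^+ 2 / 2 <= cosh (7 * d / 2).
  apply: le_trans (expR_le_cosh _); rewrite ler_wpM2r//.
  have -> : expR (H + 1) ^+ 2 * Q ^+ 2 = expR (2 * (H + 1) + 2 * ln Q).
    by rewrite [RHS]expRD !expRM_natl lnK.
  by rewrite ler_expR -dE -/Q; move: Hb H0 lnQ; lra.
have cc : 0 <= c by rewrite -cE addr_ge0// mulr_ge0.
have ch0 := cosh_ge0 (7 * d / 2).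
have cC1 : c <= C by apply: le_trans cC; rewrite ler_peMr// lerDl.
split => //; first by apply: le_trans cC1; rewrite -cE; move: S0 r0; lra.
have Vr : b^-1 / (b' - 1 - H) * V <= r.
  rewrite /r mulrAC; apply: ler_pM.
  - by rewrite mulr_ge0// invr_ge0 ltW.
  - by rewrite invr_ge0; move: Hb; lra.
  - by rewrite lerDl.
  rewrite lef_pV2 ?posrE//; last by move: Hb; lra.
  by rewrite lerD2l lerN2 lerDr mulr_ge0// invr_ge0 ltW.
set e := expR (H + 1) ^+ 2.
have e0 : 0 < e by rewrite exprn_gt0// expR_gt0.
have i1 : 1 <= (1 - q)^-1 by rewrite invf_ge1//; move: q0; lra.
apply: (@le_trans _ _ (c / (1 - q))).
  rewrite -cE [leRHS]mulrDl; apply: lerD; last by apply: le_trans Vr _; rewrite ler_peMr.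
  rewrite mulrAC; apply: ler_wpM2r; first exact: le_trans ler01 i1.
  by move: S0; lra.
have h1 : c * (e * Q ^+ 2 / 2) <= C.
  by apply: le_trans cC; rewrite ler_wpM2l// (le_trans ch)// lerDr.
have qq : 0 < 1 + q by rewrite ltr_pwDl.
have -> : 2 * C * ((1 - q) / (1 + q) / e) = C * (2 / (Q * e)).
  by rewrite /Q; field; rewrite !gt_eqF.
apply: le_trans (ler_wpM2r _ h1); last first.
  by apply: divr_ge0 => //; apply: mulr_ge0; exact: ltW.
have -> : c * (e * Q ^+ 2 / 2) * (2 / (Q * e)) = c * Q by field; rewrite !gt_eqF.
by apply: ler_wpM2l => //; rewrite /Q ler_peMl ?lerDl// (le_trans ler01).
Qed.
(** Here cosh is used to control 1 / (1 - z), while the image Harnack constant 1 + Z is only known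
    to be at most 2 / s'. The factor (6 / s')^2, the square of M at theta w, is left to the moment
    assumptions; together with S it produces the exponent 3/p. *)
Lemma settingB_const {R : realType} (S V s s' H F eps C : R)
    (Z := 1 + (1 + s^-1) * (expR eps * H)) (z := s' * (1 + (1 + s^-1) * expR eps * H)) :
  0 <= S -> 0 <= V -> 0 < s -> 0 < s' -> s' < 1 -> 0 <= H -> 0 <= F -> eps <= 2 * F ->
  (Edef (ediv (32 * s' * (1 + 2 * s^-1) * expR (S + 2 * F) * (S + V) * (1 + H)) (1 - z))
     (if (z < 1)%R then (2 * ln ((1 + z) / (1 - z)) + 2 * ln (1 + z * s^-1))%:E else +oo)
   <= C%:E)%E ->
  Z * s' < 1 /\
  2 / (1 - Z * s') * S + 2 * s' / (1 - Z * s') * V <=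
  (4 * S + C) * (6 * s'^-1) ^+ 2 * ((1 - Z * s') / 2 / (1 + Z) ^+ 2).
Proof.
move=> S0 V0 s0 s'0 s'1 H0 F0 epsF EC.
have zE : z = Z * s' by rewrite /z /Z; ring.
have si0 : 0 < s^-1 by rewrite invr_gt0.
have Z1 : 1 <= Z by rewrite lerDl mulr_ge0 ?addr_ge0 ?(ltW si0)// mulr_ge0 ?expR_ge0.
have z0 : 0 <= z by rewrite zE mulr_ge0 ?(ltW s'0)// (le_trans ler01).
(* Y dominates Z, so s' Y >= z and c0 controls z (S + V) / (1 - z). *)
set Y := (1 + 2 * s^-1) * expR (S + 2 * F) * (1 + H).
have YE : 32 * s' * (1 + 2 * s^-1) * expR (S + 2 * F) * (S + V) * (1 + H) =
  32 * s' * Y * (S + V) by rewrite /Y; ring.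
rewrite YE in EC.
have e1 : 1 <= expR (S + 2 * F) by rewrite -[leLHS]expR0 ler_expR addr_ge0// mulr_ge0.
have eF : expR eps <= expR (S + 2 * F).
  by rewrite ler_expR; move: epsF S0; lra.
have ZY : Z <= Y.
  rewrite /Z /Y; set e := expR (S + 2 * F) in e1 eF *.
  have h1 : expR eps * H <= e * H by rewrite ler_wpM2r.
  have h2 : (1 + s^-1) * (expR eps * H) <= (1 + 2 * s^-1) * (e * H).
    apply: ler_pM => //; first by rewrite addr_ge0// ltW.
      by rewrite mulr_ge0 ?expR_ge0.
    by rewrite lerD2l ler_peMl ?(ltW si0)// ler1n.
  have h3 : 1 <= (1 + 2 * s^-1) * e.
    rewrite -[leLHS]mul1r; apply: ler_pM => //; rewrite lerDl mulr_ge0// ltW//.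
  have -> : (1 + 2 * s^-1) * e * (1 + H) = (1 + 2 * s^-1) * e + (1 + 2 * s^-1) * (e * H) by ring.
  exact: lerD.
have Y1 : 1 <= Y by exact: le_trans ZY.
have Y0 : 0 <= Y by exact: le_trans Y1.
have SV0 : 0 <= S + V by exact: addr_ge0.
have num0 : 0 <= 32 * s' * Y * (S + V).
  by apply: mulr_ge0 => //; apply: mulr_ge0 => //; apply: mulr_ge0 => //; exact: ltW.
have [c [d [cE dE cC]]] := Edef_le_fin (ediv_ge0 _ num0) EC.
move: dE; case: ifP => // z1 [dE].
have z1' : 0 < 1 - z by rewrite subr_gt0.
move: cE; rewrite /ediv z1' => -[cE].
set Q := (1 + z) / (1 - z) in dE.
have Q1 : 1 <= Q by rewrite ler_pdivlMr// mul1r; move: z0; lra.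
have Q0 : 0 < Q by exact: lt_le_trans ltr01 Q1.
have lnQ : 0 <= ln Q by rewrite ln_ge0.
have lnz : 0 <= ln (1 + z * s^-1) by rewrite ln_ge0// lerDl mulr_ge0// ltW.
have ch : (1 - z)^-1 / 2 <= cosh (7 * d / 2).
  apply: le_trans (expR_le_cosh _); rewrite ler_wpM2r//.
  apply: (@le_trans _ _ Q); first by rewrite /Q ler_peMl ?lerDl// invr_ge0 ltW.
  by rewrite -[leLHS]lnK// ler_expR -dE; move: lnQ lnz; lra.
have cc : 0 <= c by rewrite -cE divr_ge0// ltW.
have cC1 : c <= C by apply: le_trans cC; rewrite ler_peMr// lerDl cosh_ge0.
have C0 : 0 <= C by exact: le_trans cC1.
have cC2 : c * ((1 - z)^-1 / 2) <= C.
  by apply: le_trans cC; rewrite ler_wpM2l// (le_trans ch)// lerDr.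
have i1 : 1 <= (1 - z)^-1 by rewrite invf_ge1//; move: z0; lra.
have main : (S + V * s') * ((1 - z)^-1) ^+ 2 <= 4 * S + C.
  have Vs' : V * s' <= V by rewrite ler_piMr// ltW.
  have Vs0 : 0 <= V * s' by rewrite mulr_ge0// ltW.
  (* For z >= 1/2, c0 dominates (S + V) / (1 - z) and cosh supplies the second factor 1 / (1 - z).
     For z < 1/2 the square is at most 4, but s' may be small: c0 then controls s' V only, and the
     term 4 S remains. *)
  have [zh|zh] := leP (1 / 2) z.
    have sY : 1 / 2 <= s' * Y.
      by apply: le_trans zh _; rewrite zE mulrC ler_wpM2l// ltW.
    have h1 : 16 * (S + V) <= 32 * s' * Y * (S + V).
      apply: ler_wpM2r => //; rewrite -mulrA; move: sY; move: (s' * Y) => *; lra.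
    have h2 : 16 * (S + V) * (1 - z)^-1 <= c.
      by rewrite -cE ler_wpM2r// (le_trans ler01).
    have h3 : 16 * (S + V) * (1 - z)^-1 * ((1 - z)^-1 / 2) <= C.
      apply: le_trans cC2; rewrite ler_wpM2r//.
      by rewrite divr_ge0// (le_trans ler01).
    apply: (@le_trans _ _ C); last by rewrite lerDr mulr_ge0.
    apply: le_trans h3.
    have -> : 16 * (S + V) * (1 - z)^-1 * ((1 - z)^-1 / 2) = 8 * (S + V) * (1 - z)^-1 ^+ 2 by field; rewrite gt_eqF.
    by rewrite ler_wpM2r ?sqr_ge0//; move: Vs' S0 V0; lra.
  have i2 : (1 - z)^-1 <= 2.
    by rewrite -[leRHS]invrK lef_pV2 ?posrE ?invr_gt0//; move: zh; lra.
  have h1 : 32 * (s' * V) <= c.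
    apply: (@le_trans _ _ (32 * s' * Y * (S + V))).
      rewrite -(mulrA (32 * s')) -(mulrA 32) ler_wpM2l// ler_wpM2l ?(ltW s'0)//.
      by rewrite -[leLHS]mul1r; apply: ler_pM => //; rewrite lerDr.
    by rewrite -cE ler_peMr.
  have i3 : (1 - z)^-1 ^+ 2 <= 4.
    have -> : 4 = 2 ^+ 2 :> R by rewrite -natrX.
    by rewrite lerXn2r// nnegrE// (le_trans ler01).
  have h2 := ler_wpM2l (addr_ge0 S0 Vs0) i3.
  apply: le_trans h2 _; move: h1 cC1 Vs0; rewrite [s' * V]mulrC.
  by move: (V * s') => *; lra.
rewrite -zE; split => //.
have Zs : Z <= s'^-1 by rewrite -[leRHS]mul1r ler_pdivlMr// -zE ltW.
have s'i : 1 <= s'^-1 by rewrite invf_ge1// ltW.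
have Z0 : 0 <= Z by exact: le_trans Z1.
have Z2 : (1 + Z) ^+ 2 <= (2 * s'^-1) ^+ 2.
  apply: lerXn2r; rewrite ?nnegrE; first exact: addr_ge0.
    by rewrite mulr_ge0// (le_trans ler01).
  by move: Zs s'i; move: (Z) => *; lra.
have Zp : 0 < (1 + Z) ^+ 2 by rewrite exprn_gt0// ltr_pwDl// (le_trans ler01).
set k := (1 - z) / 2 / (1 + Z) ^+ 2.
have k0 : 0 <= k by rewrite divr_ge0 ?(ltW Zp)// divr_ge0 ?(ltW z1').
have -> : 2 / (1 - z) * S + 2 * s' / (1 - z) * V =
    4 * ((S + V * s') * (1 - z)^-1 ^+ 2 * (1 + Z) ^+ 2) * k.
  by rewrite /k; field; rewrite !gt_eqF// ltr_pwDl// (le_trans ler01).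
apply: ler_wpM2r => //.
have SC : 0 <= 4 * S + C by rewrite addr_ge0// mulr_ge0.
have h := ler_pM _ (ltW Zp) main Z2.
apply: (@le_trans _ _ (4 * ((4 * S + C) * (2 * s'^-1) ^+ 2))).
  rewrite ler_wpM2l//; apply: h.
  by rewrite mulr_ge0 ?sqr_ge0// addr_ge0// mulr_ge0// ltW.
have -> : 4 * ((4 * S + C) * (2 * s'^-1) ^+ 2) = (4 * S + C) * (16 * s'^-1 ^+ 2) by ring.
rewrite exprMn ler_wpM2l// ler_wpM2r ?sqr_ge0// -natrX ler_nat//.
Qed.
(** * The limit theorem in settings A and B *)

Section Settings.
Context {R : realType} {dO : measure_display} {Omega : measurableType dO}
  (P : probability Omega R) (theta thinv : Omega -> Omega)
  {dX : measure_display} {X : measurableType dX} (dist : X -> X -> R) (alpha : R)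
  (E : set (Omega * X)) (T : Omega -> X -> X) (phi u : Omega -> X -> R)
  (nu : Omega -> probability X R) (h : Omega -> X -> R) (p sigma : R).
Hypothesis Htheta : invertible_mpt_ergodic P theta thinv.
Hypothesis Hmetric : is_metric dist.
Hypothesis HborelX : @measurable _ X = <<s dopen dist >>.
Hypothesis Hdiam : forall x y, dist x y <= 1.
Hypothesis Halpha : 0 < alpha <= 1.
Hypothesis HEmeas : measurable E.
Hypothesis HTfib : forall w x, Fib E w x -> Fib E (theta w) (T w x).
Hypothesis HTmeas : measurable_fun E (fun wx => T wx.1 wx.2).
Hypothesis Hphibdd : forall w, bounded_on (Fib E w) (phi w).
Hypothesis Hu : forall w, in_holder dist alpha (Fib E w) (u w).
Hypothesis Hgibbs : {ae P, forall w, gibbs_char theta thinv E T phi nu h dist alpha w}.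
Hypothesis Hp : 16 < p.
Hypothesis sigma0 : 0 < sigma.
Hypothesis Hsigma : {ae P, forall w,
  (fun n : nat => sig2 theta E T nu h u w n / n%:R) @ \oo --> sigma ^+ 2}.
Local Notation Fib := (Fib E).
Local Notation dl x y := (dist x y `^ alpha).
Local Notation hol w f := (in_holder dist alpha (Fib w) f).
Local Notation ut := (ut E nu h u).
Local Notation suput := (suput E nu h u).

Let a0 : 0 < alpha. Proof. by case/andP: Halpha. Qed.
Let hdist0 x y : 0 <= dl x y. Proof. exact: powR_ge0. Qed.
Let hdist1 x y : dl x y <= 1. Proof. exact: (hdist_le1 Hmetric). Qed.
Let hdistC' x y : dl x y = dl y x. Proof. exact: (hdistC alpha Hmetric). Qed.
Let thetaK : cancel theta thinv. Proof. by case: Htheta. Qed.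
Let thinvK : cancel thinv theta. Proof. by case: Htheta. Qed.
Let p0 : 0 < p. Proof. by apply: lt_trans Hp; rewrite ltr0n. Qed.

Let dl_le (c : R) x x' z z' : 0 <= c -> dist x x' <= c * dist z z' ->
  dl x x' <= c `^ alpha * dl z z'.
Proof.
have d0 t t' : 0 <= dist t t' by case: Hmetric.
move=> c0 le; rewrite -powRM//; apply: ge0_ler_powR; rewrite ?nnegrE ?mulr_ge0//.
exact: ltW.
Qed.

Let powRV (c : R) : 0 <= c -> c^-1 `^ alpha = (c `^ alpha)^-1.
Proof. by move=> c0; rewrite -[c^-1]powR_inv1// -powRrM mulN1r powRN. Qed.

Let ut_bounded w : bounded_on (Fib w) (ut w).
Proof.
case: (Hu w) => [[K uK] _]; exists (K + `|muf E nu h w (u w)|) => x xF.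
by rewrite /Defs.ut; apply: ler_normD_le; [exact: uK|rewrite normrN].
Qed.

Let ut_suput w x : Fib w x -> `|ut w x| <= suput w.
Proof. exact: le_supabs. Qed.

Let suput0 w : 0 <= suput w. Proof. exact: supabs_ge0. Qed.

Let ut_holder w : 0 <= vu E dist alpha u w /\ holder dist alpha (Fib w) (vu E dist alpha u w) (ut w).
Proof.
have [v0 uv] := holder_fine Hmetric (proj2 (Hu w)).
split=> // x y xF yF; have -> : ut w x - ut w y = u w x - u w y by rewrite /Defs.ut; ring.
exact: uv.
Qed.

(** Over an empty fibre all variances are 0, against sigma > 0. *)
Lemma ae_Fib_neq0 : {ae P, forall w, Fib w !=set0}.
Proof.
apply: filterS Hsigma => w Hw; apply: contrapT => /set0P/negP; rewrite negbK => /eqP F0.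
have s0 n : sig2 theta E T nu h u w n = 0.
  by rewrite /sig2 /muf /integ F0 integral_set0.
have : (fun n : nat => sig2 theta E T nu h u w n / n%:R) @ \oo --> (0 : R).
  by apply: cvg_near_cst; apply: nearW => n; rewrite s0 mul0r.
move=> /(cvg_unique (@Rhausdorff R) Hw)/eqP; rewrite sqrf_eq0 => /eqP s.
by move: sigma0; rewrite s ltxx.
Qed.

(** These points run through the two-sided orbit with repetitions, which makes stability under both
    maps immediate. *)
Definition orbit_good (Q : Omega -> Prop) w := forall n m, Q (iter n theta (iter m thinv w)).

Lemma orbit_good_self Q w : orbit_good Q w -> Q w. Proof. by move=> /(_ 0%N 0%N). Qed.

Lemma orbit_good_theta Q w : orbit_good Q w -> orbit_good Q (theta w).
Proof.
move=> H n [|m]; first by rewrite -iterSr; exact: (H n.+1 0%N).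
by rewrite iterSr thetaK; exact: H.
Qed.

Lemma orbit_good_thinv Q w : orbit_good Q w -> orbit_good Q (thinv w).
Proof. by move=> H n m; rewrite -iterSr; exact: (H n m.+1). Qed.

Definition clt_rate_at w := exists (C : R) (N : nat), forall n, (N <= n)%N -> forall t : R,
  `| mu E nu h w [set x | Snut theta E T nu h u w n x
                            <= t * Num.sqrt (sig2 theta E T nu h u w n)] - Phi t |
  <= C * n%:R `^ (- (2^-1 - 8 / p)).

Lemma clt_settingA (gamma H D : Omega -> R) :
  settingA theta E T phi dist alpha P gamma H D ->
  ess_bounded P (EA theta E nu h dist alpha u gamma H) ->
  {ae P, forall w, clt_rate_at w}.
Proof.
move=> [_ _ _ aeA] [C aeE].
pose b := gA alpha gamma.
pose Q w := [/\ gibbs_char theta thinv E T phi nu h dist alpha w, Fib w !=set0,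
  [/\ 1 < gamma w, 0 <= H w, H w <= gamma (theta w) `^ alpha - 1,
    (forall x, Fib (theta w) x ->
       (esum (preim E T w x) (fun y => (expR (phi w y))%:E) <= (D w)%:E)%E) &
    exists (I : set nat) (y : nat -> X -> X),
      (forall x, Fib (theta w) x ->
         [/\ (forall i, I i -> preim E T w x (y i x)),
             (forall i j, I i -> I j -> y i x = y j x -> i = j) &
             (forall z, preim E T w x z -> exists2 i, I i & z = y i x)]) /\
      (forall x x' i, Fib (theta w) x -> Fib (theta w) x' -> I i ->
         dist (y i x) (y i x') <= (gamma w)^-1 * dist x x' /\
         `|phi w (y i x) - phi w (y i x')| <= H w * dist x x' `^ alpha)] &
  (EA theta E nu h dist alpha u gamma H w <= C%:E)%E].
have aeQ : {ae P, forall w, Q w}.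
  by apply: filterS2 (filterI Hgibbs ae_Fib_neq0) (filterI aeA aeE) => w [? ?] [? ?].
apply: filterS2 Hsigma (ae_orbit Htheta aeQ) => w sig_cvg Qw.
pose Good := orbit_good Q.
have GQ v : Good v -> Q v by exact: orbit_good_self.
have Gth v : Good v -> Good (theta v) by exact: orbit_good_theta.
have b1 v : Good v -> 1 < b v.
  move=> /GQ[_ _ [g1 _ _ _ _] _]; rewrite /b /gA.
  have -> : 1 = 1 `^ alpha :> R by rewrite powR1.
  by apply: gt0_ltr_powR; rewrite // nnegrE ?ltW// (lt_trans ltr01).
have b0 v : Good v -> 0 < b v by move=> /b1; exact: lt_trans.
have H0 v : Good v -> 0 <= H v by move=> /GQ[_ _ [_ + _ _ _] _].
have consts v : Good v -> [/\ H v + 1 < b (theta v), suput v <= C &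
    2 / (1 - qA theta alpha gamma H v) * suput v +
      (b v)^-1 / (b (theta v) - 1 - H v) * vu E dist alpha u v <=
    2 * C * ((1 - qA theta alpha gamma H v) / (1 + qA theta alpha gamma H v) /
      expR (H v + 1) ^+ 2)].
  move=> vG; have [_ _ _ EC] := GQ v vG.
  exact: (settingA_const (suput0 v) (proj1 (ut_holder v)) (b0 _ vG) (b0 _ (Gth _ vG)) (H0 _ vG) EC).
have q01 v : Good v -> 0 <= qA theta alpha gamma H v < 1.
  move=> vG; have [Hb _ _] := consts v vG; have b'0 := b0 _ (Gth _ vG).
  rewrite /qA -/(b (theta v)) divr_ge0 ?addr_ge0 ?H0 ?ltW//=.
  by rewrite ltr_pdivrMr// mul1r.
have qk0 v : Good v ->
    0 <= (1 - qA theta alpha gamma H v) / (1 + qA theta alpha gamma H v).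
  move=> vG; have /andP[q0 q1] := q01 v vG.
  by apply: divr_ge0; [rewrite subr_ge0 ltW|rewrite addr_ge0].
have br v : Good v -> exists I y, [/\ branches theta E T phi v I y (D v),
    (forall x x' i, Fib (theta v) x -> Fib (theta v) x' -> I i ->
       dl (y i x) (y i x') <= (b v)^-1 * dl x x') &
    (forall x x' i, Fib (theta v) x -> Fib (theta v) x' -> I i ->
       `|phi v (y i x) - phi v (y i x')| <= H v * dl x x')].
  move=> /GQ[_ _ [g1 _ _ Dx [I [y [y1 y2]]]] _]; exists I, y; split.
  - by split.
  - move=> x x' i xF x'F Ii; have [y2' _] := y2 x x' i xF x'F Ii.
    have g0 : 0 <= gamma v by rewrite ltW// (lt_trans ltr01).
    by rewrite /b /gA -powRV//; apply: dl_le; rewrite ?invr_ge0.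
  - by move=> x x' i xF x'F Ii; have [_ +] := y2 x x' i xF x'F Ii.
pose cone v := exp_cone dist alpha (b v) (Fib v).
have cone_C v f x0 : Good v -> Fib v x0 -> cone v f -> hol v f.
  move=> vG x0F fC; apply/(in_holderP alpha Hmetric).
  exact: (exp_cone_holder hdist0 hdist1 hdistC' (ltW (b0 v vG)) x0F fC).
have coneL v f : Good v -> cone v f ->
    exp_cone dist alpha (H v + 1) (Fib (theta v)) (Lop E T phi v f).
  move=> vG fC; have [I [y [ybr y1 y2]]] := br v vG; have [_ [x0 x0F] _ _] := GQ v vG.
  exact: (exp_cone_Lop hdist0 hdist1 hdistC' ybr (b0 v vG) x0F y1 y2 fC).
have H10 v : Good v -> 0 <= H v + 1 by move=> vG; rewrite addr_ge0// H0.
have Hq v : Good v -> qA theta alpha gamma H v * b (theta v) = H v + 1.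
  by move=> vG; rewrite /qA divfK//; exact: (lt0r_neq0 (b0 _ (Gth _ vG))).
have wG : Good w by exact: Qw.
(* In setting A both growth bounds hold with constants: c0 >= 3 sup |ut| bounds S by C, and
   [settingA_const] bounds the ratio of cost to contraction by 2 C. The powers of n in [gibbs_clt]
   are at least 1. *)
have C1 : 1 <= Num.max 1 (2 * C) by rewrite le_max lexx.
have nP (n j : nat) (r : R) : (j < n)%N -> 0 <= r -> 1 <= n%:R `^ r :> R.
  move=> jn r0; rewrite -[leLHS](powRr0 n%:R) ler_powR// ler1n.
  exact: leq_ltn_trans jn.
have Gi j : Good (iter j theta w) by elim: j => [|j IH]; [exact: wG|exact: (Gth _ IH)].
apply: (@gibbs_clt _ _ _ _ _ theta thinv E T phi nu h dist alpha
  Hmetric HborelX Hdiam Halpha HEmeas HTfib HTmeas thetaK thinvK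
  Good cone (fun v => expR (b v)) Gth _ _ _ _ _ _ _ _ _ _ _ _ _ _
  (fun v => (1 - qA theta alpha gamma H v) / (1 + qA theta alpha gamma H v))
  (fun v => expR (H v + 1)) (fun v => 2 / (1 - qA theta alpha gamma H v))
  (fun v => (b v)^-1 / (b (theta v) - 1 - H v)) _ _ _ _ _ _ _
  u suput (vu E dist alpha u) p (Num.max 1 (2 * C)) sigma w wG Hu _ _ _ _ Hp C1 _ _
  sigma0 sig_cvg).
- by move=> v; exact: orbit_good_thinv.
- by move=> v /GQ[].
- by move=> v /GQ[].
- by move=> v /br[I [y [ybr _ _]]]; exists I, y, (D v).
- by move=> v f g; exact: eq_exp_cone.
- by move=> v f g _; exact: exp_coneD.
- by move=> v a f _; exact: exp_coneZ.
- by move=> v f_ f _; exact: exp_cone_cvg.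
- by move=> v f vG fC; have [_ [x0 x0F] _ _] := GQ v vG; exact: cone_C x0F fC.
- by move=> v f x _ [f0 _]; exact: f0.
- by move=> v f x x' vG fC; apply: (exp_cone_harnack hdist1 (ltW (b0 v vG)) fC).
- move=> v f vG /(in_holderP alpha Hmetric)[[K fK] [V V0 fV]].
  by exists (K + V / b v); exact: (exp_cone_span hdist0 (b0 v vG) fK V0 fV).
- by move=> v vG; apply: exp_cone_one; [|exact: ltW (b0 v vG)].
- move=> v f vG fC; have [Hb _ _] := consts v vG.
  exact: (exp_cone_le hdist0 (ltW Hb) (coneL v f vG fC)).
- move=> v f x x' vG fC xF xF'.
  exact: (exp_cone_harnack hdist1 (H10 v vG) (coneL v f vG fC) xF xF').
- move=> v f g a vG fC gC a0' agf.
  apply: (exp_cone_sub hdist0 hdistC' (b0 _ (Gth _ vG)) (q01 v vG) a0' _ _ agf).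
    by rewrite Hq//; exact: coneL.
  by rewrite Hq//; exact: coneL.
- move=> v f psi S V vG fC S0 V0 psiS psiV; have [I [y [ybr y1 y2]]] := br v vG.
  have [_ [x0 x0F] _ _] := GQ v vG; have [Hb _ _] := consts v vG.
  exact: (exp_cone_mul hdist0 hdist1 hdistC' ybr (b0 v vG) (H0 v vG) Hb x0F y1 y2 fC S0 V0 psiS psiV).
- move=> v vG; have /andP[q0 q1] := q01 v vG; rewrite qk0//=.
  by rewrite ler_pdivrMr ?ltr_pwDl// mul1r; move: q0; lra.
- by move=> v vG; rewrite -[leLHS]expR0 ler_expR H10.
- move=> v vG; have /andP[q0 q1] := q01 v vG; rewrite ler_pdivlMr ?subr_gt0// mul1r; move: q0; lra.
- move=> v vG; have [Hb _ _] := consts v vG; rewrite divr_ge0 ?invr_ge0 ?(ltW (b0 v vG))//.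
  by move: Hb; lra.
- by move=> v _; exact: suput0.
- by move=> v _; case: (ut_holder v).
- by move=> v x _; exact: ut_suput.
- by move=> v _; case: (ut_holder v).
- move=> n j jn; have [_ SC _] := consts _ (Gi j).
  have C0 : 0 <= C by apply: le_trans SC; exact: suput0.
  apply: le_trans SC _; apply: (@le_trans _ _ (Num.max 1 (2 * C))).
    by rewrite le_max; apply/orP; right; rewrite ler_peMl// ler1n.
  by rewrite ler_peMr ?(le_trans ler01)// (nP _ _ _ jn)// invr_ge0 ltW.
- move=> n j jn; have [_ _ cC] := consts _ (Gi j); apply: le_trans cC _.
  rewrite /kappa; apply: ler_wpM2r.
    by apply: divr_ge0 (qk0 _ (Gi j)) _; rewrite exprn_ge0 ?expR_ge0.
  apply: (@le_trans _ _ (Num.max 1 (2 * C))); first by rewrite le_max lexx orbT.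
  by rewrite ler_peMr ?(le_trans ler01)// (nP _ _ _ jn)// divr_ge0 ?ltW.
Qed.

Lemma finite_branches w (n : nat) (y : nat -> X -> X) (M : R) :
  (forall x, Fib (theta w) x ->
    [/\ (forall i, (1 <= i <= n)%N -> preim E T w x (y i x)),
       (forall i j, (1 <= i <= n)%N -> (1 <= j <= n)%N -> y i x = y j x -> i = j) &
       (forall z, preim E T w x z -> exists2 i, (1 <= i <= n)%N & z = y i x)]) ->
  (forall x, Fib w x -> phi w x <= M) ->
  branches theta E T phi w [set i | (1 <= i <= n)%N] y (n%:R * expR M).
Proof.
move=> yP phiM; split => // x xF; have [h1 h2 h3] := yP x xF.
rewrite (@reindex_esum _ _ _ [set i | (1 <= i <= n)%N] _ (y ^~ x)); last first.
  split => //.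
  - by move=> i j; rewrite !inE; exact: h2.
  - by move=> z /h3[i Ii ->]; exists i.
have IE : [set i | (1 <= i <= n)%N] = [set` index_iota 1 n.+1].
  by apply/seteqP; split=> i /=; rewrite mem_index_iota ltnS.
have fin : finite_set [set i | (1 <= i <= n)%N] by rewrite IE.
rewrite esum_fset//.
rewrite IE -fsbig_seq ?iota_uniq// sumEFin lee_fin.
apply: (@le_trans _ _ (\sum_(1 <= i < n.+1) expR M)).
  rewrite !big_nat; apply: ler_sum => i; rewrite ltnS => Ii.
  by rewrite ler_expR phiM//; case: (h1 i Ii).
by rewrite sumr_const_nat subn1/= mulr_natl.
Qed.

Lemma le_bigmax_nat (F : nat -> R) n j : (1 <= j <= n)%N ->
  F j <= \big[Num.max/0]_(1 <= i < n.+1) F i.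
Proof. by move=> jn; rewrite le_bigmax_seq// mem_index_iota ltnS. Qed.

Lemma clt_settingB (l sg : Omega -> R) (q d : Omega -> nat) (y : Omega -> nat -> X -> X) :
  settingB theta E T phi dist alpha P l sg q d y ->
  ess_bounded P (EB theta E phi nu h dist alpha u l sg q d y) ->
  inLp P p (MB E phi alpha l sg q d) -> inLp P p suput ->
  {ae P, forall w, clt_rate_at w}.
Proof.
move=> [_ _ _ _ aeB] [C aeE] MLp SLp.
pose s := sB E phi alpha l sg q d.
pose Hb := HB theta E phi dist alpha d y.
pose eps := epsB E phi.
pose inner w := [/\ 1 <= l w /\ 1 < sg w, (0 < q w)%N /\ (q w < d w)%N,
  (forall x, Fib (theta w) x ->
     [/\ (forall i, (1 <= i <= d w)%N -> preim E T w x (y w i x)),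
         (forall i j, (1 <= i <= d w)%N -> (1 <= j <= d w)%N ->
            y w i x = y w j x -> i = j) &
         (forall z, preim E T w x z ->
            exists2 i, (1 <= i <= d w)%N & z = y w i x)]),
  (forall x x', Fib (theta w) x -> Fib (theta w) x' ->
     (forall i, (1 <= i <= q w)%N ->
        dist (y w i x) (y w i x') <= l w * dist x x') /\
     (forall i, (q w < i <= d w)%N ->
        dist (y w i x) (y w i x') <= (sg w)^-1 * dist x x')) &
  [/\ (forall i, (1 <= i <= d w)%N ->
         (holv dist alpha (Fib (theta w)) (fun x => phi w (y w i x)) < +oo)%E),
      s w < 1 &
      expR (eps w) * Hb w <= ((s (theta w))^-1 - 1) / (1 + (s w)^-1)]].
pose Q w := [/\ gibbs_char theta thinv E T phi nu h dist alpha w, Fib w !=set0,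
  inner w & (EB theta E phi nu h dist alpha u l sg q d y w <= C%:E)%E].
have aeQ : {ae P, forall w, Q w}.
  by apply: filterS2 (filterI Hgibbs ae_Fib_neq0) (filterI aeB aeE) => w [? ?] [? ?].
apply: filterS3 (filterI Hsigma (ae_orbit Htheta aeQ)) (ae_orbit_growth Htheta p0 MLp)
  (ae_orbit_growth Htheta p0 SLp) => w [sig_cvg Qw] [C1 C11 MC] [C2 C21 SC].
pose Good := orbit_good Q.
have GQ v : Good v -> Q v by exact: orbit_good_self.
have Gth v : Good v -> Good (theta v) by exact: orbit_good_theta.
pose L v i := if (i <= q v)%N then l v `^ alpha else (sg v `^ alpha)^-1.
have L0 v i : Good v -> 0 <= L v i.
  by move=> _; rewrite /L; case: ifP => _; rewrite ?invr_ge0 powR_ge0.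
have d0 v : Good v -> (0 < d v)%N by move=> /GQ[_ _ [_ [_ qd] _ _ _] _]; exact: leq_ltn_trans qd.
have sumL v : Good v -> \sum_(1 <= i < (d v).+1) L v i = (d v)%:R * aB alpha l sg q d v.
  move=> vG; have [_ _ [_ [q0 qd] _ _ _] _] := GQ v vG.
  rewrite /aB mulrC divfK ?pnatr_eq0 -?lt0n ?d0//.
  rewrite (@big_cat_nat _ _ _ (q v).+1)//=; last by rewrite ltnS ltnW.
  congr (_ + _).
    rewrite (eq_big_nat _ _ (F2 := fun=> l v `^ alpha)).
      by rewrite sumr_const_nat subn1/= mulr_natl.
    by move=> i /andP[_]; rewrite ltnS /L => ->.
  rewrite (eq_big_nat _ _ (F2 := fun=> (sg v `^ alpha)^-1)).
    by rewrite sumr_const_nat subSS mulr_natl.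
  by move=> i /andP[qi _]; rewrite /L leqNgt qi.
have a_gt0 v : Good v -> 0 < aB alpha l sg q d v.
  move=> vG; have [_ _ [[l1 _] [q0 qd] _ _ _] _] := GQ v vG.
  rewrite /aB divr_gt0 ?ltr0n ?d0// ltr_wpDr ?mulr_ge0 ?invr_ge0 ?powR_ge0//.
  by rewrite mulr_gt0 ?ltr0n// powR_gt0// (lt_le_trans ltr01).
have s0 v : Good v -> 0 < s v by move=> vG; rewrite /s /sB mulr_gt0 ?expR_gt0 ?a_gt0.
have s1 v : Good v -> s v < 1 by move=> /GQ[_ _ [_ _ _ _ [_ + _]] _].
have si0 v : Good v -> 0 < (s v)^-1 by move=> vG; rewrite invr_gt0 s0.
have Hb0 v : 0 <= Hb v by exact: bigmax_ge_id.
have phi_le v x : Fib v x -> phi v x <= supE (Fib v) (phi v).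
  move=> xF; have [K phiK] := Hphibdd v; apply: sup_upper_bound; last by exists x.
  split; first by exists (phi v x), x.
  by exists K => _ [z zF <-]; rewrite (le_trans (ler_norm _))// phiK.
have phi_ge v x : Fib v x -> infE (Fib v) (phi v) <= phi v x.
  move=> xF; have [K phiK] := Hphibdd v; apply: ge_inf; last by exists x.
  by exists (- K) => _ [z zF <-]; have := phiK z zF; rewrite ler_norml => /andP[].
have br v : Good v -> branches theta E T phi v [set i | (1 <= i <= d v)%N] (y v)
    ((d v)%:R * expR (supE (Fib v) (phi v))).
  by move=> /GQ[_ _ [_ _ yP _ _] _]; exact: finite_branches yP (phi_le v).
have y1 v x x' i : Good v -> Fib (theta v) x -> Fib (theta v) x' -> (1 <= i <= d v)%N ->
    dl (y v i x) (y v i x') <= L v i * dl x x'.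
  move=> /GQ[_ _ [[l1 sg1] _ _ yc _] _] xF xF' /andP[i1 id]; have [c1 c2] := yc x x' xF xF'.
  rewrite /L; case: ifPn => [iq|]; first by apply: dl_le; [exact: le_trans l1|rewrite c1// i1].
  rewrite -ltnNge => qi; have sg0 : 0 <= sg v by exact: le_trans ler01 (ltW sg1).
  by rewrite -powRV//; apply: dl_le; [rewrite invr_ge0|rewrite c2// qi].
have y2 v x x' i : Good v -> Fib (theta v) x -> Fib (theta v) x' -> (1 <= i <= d v)%N ->
    `|phi v (y v i x) - phi v (y v i x')| <= Hb v * dl x x'.
  move=> /GQ[_ _ [_ _ _ _ [hv _ _]] _] xF xF' id.
  have [h0 hP] := holder_fine Hmetric (hv i id).
  apply: le_trans (hP x x' xF xF') _; rewrite ler_wpM2r//.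
  exact: (le_bigmax_nat (fun i => fine (holv dist alpha (Fib (theta v)) (fun x => phi v (y v i x))))).
pose Z v := 1 + (1 + (s v)^-1) * (expR (eps v) * Hb v).
have Z0 v : Good v -> 0 <= Z v.
  move=> vG; rewrite addr_ge0// mulr_ge0//; first by rewrite addr_ge0// ltW// si0.
  by rewrite mulr_ge0 ?expR_ge0.
pose V v := fine (holv dist alpha (Fib v) (ut v)).
have VE v : V v = vu E dist alpha u v by rewrite /V /vu holvB_cst.
have V0 v : 0 <= V v by rewrite VE; case: (ut_holder v).
have eps_le v : Good v -> eps v <= 2 * supabs (Fib v) (phi v).
  move=> vG; have [_ [x0 x0F] _ _] := GQ v vG.
  have B x : Fib v x -> `|phi v x| <= supabs (Fib v) (phi v) by exact: le_supabs.
  rewrite mulr2n mulrDl mul1r /eps /epsB; apply: lerD.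
    apply: ge_sup; first by exists (phi v x0), x0.
    by move=> _ [x xF <-]; rewrite (le_trans (ler_norm _))// B.
  rewrite lerNl; apply: lb_le_inf; first by exists (phi v x0), x0.
  by move=> _ [x xF <-]; have := B x xF; rewrite ler_norml => /andP[].
have consts v : Good v -> Z v * s (theta v) < 1 /\
    2 / (1 - Z v * s (theta v)) * suput v + 2 * s (theta v) / (1 - Z v * s (theta v)) * V v <=
    (4 * suput v + C) * (6 * (s (theta v))^-1) ^+ 2 *
      ((1 - Z v * s (theta v)) / 2 / (1 + Z v) ^+ 2).
  move=> vG; have [_ _ _ EC] := GQ v vG.
  exact: (settingB_const (suput0 v) (V0 v) (s0 _ vG) (s0 _ (Gth _ vG)) (s1 _ (Gth _ vG))
    (Hb0 v) (supabs_ge0 _ _) (eps_le v vG) EC).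

have kg v : Good v -> 0 < 1 - Z v * s (theta v).
  by move=> vG; rewrite subr_gt0; case: (consts v vG).
have zs01 v : Good v -> 0 <= Z v * s (theta v) < 1.
  by move=> vG; rewrite mulr_ge0 ?Z0 ?(ltW (s0 _ (Gth _ vG)))//; case: (consts v vG).
have as_ v : expR (supE (Fib v) (phi v) - infE (Fib v) (phi v)) * aB alpha l sg q d v = s v.
  by [].
pose cone v := lip_cone dist alpha (s v)^-1 (Fib v).
have cone_C v f x0 : Good v -> Fib v x0 -> cone v f -> hol v f.
  move=> vG x0F fC; apply/(in_holderP alpha Hmetric).
  exact: (lip_cone_holder hdist1 (ltW (si0 v vG)) x0F fC).
have Ll0 v : Good v -> forall i, 0 <= L v i by move=> vG i; exact: L0.
have coneL v f : Good v -> cone v f -> lip_cone dist alpha (Z v) (Fib (theta v)) (Lop E T phi v f).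
  move=> vG fC; have [_ [x0 x0F] _ _] := GQ v vG.
  exact: (lip_cone_Lop hdist0 hdist1 (br v vG) (d0 v vG) (s0 v vG) (Ll0 v vG) (sumL v vG)
    (as_ v) (@phi_le v) (@phi_ge v) (fun x x' i => @y1 v x x' i vG)
    (fun x x' i => @y2 v x x' i vG) fC).
have Zle v : Good v -> Z v <= (s (theta v))^-1.
  move=> vG; rewrite -[leRHS]mul1r ler_pdivlMr ?(s0 _ (Gth _ vG))//.
  by case: (consts v vG) => /ltW.

have wG : Good w by exact: Qw.
have Gi j : Good (iter j theta w) by elim: j => [|j IH]; [exact: wG|exact: (Gth _ IH)].
(* Read off from [settingB_const]: 4 S + C is at most (4 C2 + |C|) n^(1/p) along the orbit, and 6 /
   s_{theta w}, which enters squared, at most 2 C1 n^(1/p). *)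
pose A := 4 * C1 ^+ 2 * (4 * C2 + `|C|).
have C10 : 0 < C1 by exact: lt_le_trans C11.
have AC2 : C2 <= A.
  apply: (@le_trans _ _ (4 * C2 + `|C|)); first by have := normr_ge0 C; move: C21; lra.
  rewrite /A ler_peMl ?addr_ge0 ?mulr_ge0 ?(le_trans ler01 C21)//.
  by have := exprn_ege1 2 C11; lra.
have P1 (n j : nat) : (j < n)%N -> 1 <= n%:R `^ p^-1 :> R.
  move=> jn; rewrite -[leLHS](powRr0 n%:R) ler_powR ?invr_ge0 ?(ltW p0)// ler1n.
  exact: leq_ltn_trans jn.
(* s is taken one step ahead, at time j + 1 <= n, hence the growth bound for n + 1; the factor 2
   comes from (n + 1)^(1/p) <= (2 n)^(1/p) <= 2 n^(1/p). *)
have sG n j : (j < n)%N -> 6 * (s (theta (iter j theta w)))^-1 <= 2 * C1 * n%:R `^ p^-1.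
  move=> jn; have := MC n.+1 j.+1 jn; rewrite /MB -/(s _) iterS.
  have si := si0 _ (Gth _ (Gi j)); rewrite ger0_norm ?mulr_ge0 ?(ltW si)// => h1.
  apply: le_trans h1 _; rewrite [2 * C1]mulrC -mulrA ler_wpM2l ?(ltW C10)//.
  apply: (@le_trans _ _ ((2 * n%:R) `^ p^-1)).
    apply: ge0_ler_powR; rewrite ?nnegrE ?invr_ge0 ?(ltW p0)//.
    by rewrite -natrM ler_nat mul2n -addnn -addn1 leq_add2l; exact: leq_ltn_trans jn.
  rewrite powRM// ler_wpM2r ?powR_ge0//.
  rewrite -[leRHS]powRr1// ler_powR ?ler1n// invf_le1// ltW//.
  by apply: lt_trans Hp; rewrite ltr1n.
apply: (@gibbs_clt _ _ _ _ _ theta thinv E T phi nu h dist alpha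
  Hmetric HborelX Hdiam Halpha HEmeas HTfib HTmeas thetaK thinvK
  Good cone (fun v => 1 + (s v)^-1) Gth _ _ _ _ _ _ _ _ _ _ _ _ _ _
  (fun v => (1 - Z v * s (theta v)) / 2)
  (fun v => 1 + Z v) (fun v => 2 / (1 - Z v * s (theta v)))
  (fun v => 2 * s (theta v) / (1 - Z v * s (theta v))) _ _ _ _ _ _ _
  u suput V p A sigma w wG Hu _ _ _ _ Hp (le_trans C21 AC2) _ _
  sigma0 sig_cvg).
- by move=> v; exact: orbit_good_thinv.
- by move=> v /GQ[].
- by move=> v /GQ[].
- move=> v vG; exists [set i | (1 <= i <= d v)%N], (y v), ((d v)%:R * expR (supE (Fib v) (phi v))).
  exact: br.
- by move=> v f g; exact: eq_lip_cone.
- by move=> v f g _; exact: lip_coneD.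
- by move=> v a f _; exact: lip_coneZ.
- by move=> v f_ f _; exact: lip_cone_cvg.
- by move=> v f vG fC; have [_ [x0 x0F] _ _] := GQ v vG; exact: cone_C x0F fC.
- by move=> v f x _ [f0 _]; exact: f0.
- by move=> v f x x' vG fC; apply: (lip_cone_harnack hdist1 (ltW (si0 v vG)) fC).
- move=> v f vG /(in_holderP alpha Hmetric)[[K fK] [W W0 fW]].
  by exists (K + W / (s v)^-1); exact: (lip_cone_span hdist0 (si0 v vG) fK W0 fW).
- by move=> v vG; apply: lip_cone_one; [|exact: ltW (si0 v vG)].
- move=> v f vG fC; have [f0 fb] := coneL v f vG fC; split => // x x' z xF xF' zF.
  apply: le_trans (fb x x' z xF xF' zF) _; apply: ler_wpM2r; first exact: f0.
  by apply: ler_wpM2r; [exact: hdist0|exact: Zle].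
- move=> v f x x' vG fC xF xF'.
  exact: (lip_cone_harnack hdist1 (Z0 v vG) (coneL v f vG fC) xF xF').
- move=> v f g a vG fC gC a0' agf.
  have Ze : Z v = Z v * s (theta v) * (s (theta v))^-1.
    by rewrite mulfK// (lt0r_neq0 (s0 _ (Gth _ vG))).
  apply: (lip_cone_sub hdist0 (ltW (si0 _ (Gth _ vG))) (zs01 v vG) a0' _ _ agf).
    by rewrite -Ze; exact: coneL.
  by rewrite -Ze; exact: coneL.
- move=> v f psi S W vG fC S0 W0 psiS psiV; have [Hz _] := consts v vG.
  exact: (lip_cone_mul hdist0 hdist1 (br v vG) (d0 v vG) (s0 v vG) (s1 v vG) (Hb0 v)
    (Ll0 v vG) (sumL v vG)
    (as_ v) (@phi_le v) (@phi_ge v) (fun x x' i => @y1 v x x' i vG)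
    (fun x x' i => @y2 v x x' i vG) fC S0 W0 (s0 _ (Gth _ vG)) Hz psiS psiV).
- by move=> v vG; have /andP[] := zs01 v vG; move: (Z v * _) => z z0 z1; lra.
- by move=> v vG; rewrite lerDl Z0.
- move=> v vG; have /andP[z0 z1] := zs01 v vG; rewrite ler_pdivlMr ?kg// mul1r.
  by move: z0; move: (Z v * _) => *; lra.
- by move=> v vG; rewrite divr_ge0 ?(ltW (kg v vG))// mulr_ge0// ltW// s0//; exact: Gth.
- by move=> v _; exact: suput0.
- by move=> v _; exact: V0.
- by move=> v x _; exact: ut_suput.
- by move=> v _; rewrite VE; case: (ut_holder v).
- move=> n j jn; have := SC n j jn; rewrite ger0_norm ?suput0// => h1.
  by apply: le_trans h1 _; rewrite ler_wpM2r ?powR_ge0.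
- move=> n j jn; have [_ cC] := consts _ (Gi j); apply: le_trans cC _.
  rewrite /kappa; apply: ler_wpM2r.
    by rewrite divr_ge0 ?sqr_ge0// divr_ge0// ltW// kg.
  set r := n%:R `^ p^-1; have r1 : 1 <= r by exact: P1 jn.
  have -> : n%:R `^ (3 / p) = r ^+ 3 by rewrite mulrC powRrM powR_mulrn ?powR_ge0.
  have r0 : 0 <= r by exact: le_trans r1.
  have -> : A * r ^+ 3 = (4 * C2 + `|C|) * r * (2 * C1 * r) ^+ 2 by rewrite /A; ring.
  have S1 := SC n j jn; rewrite ger0_norm ?suput0// -/r in S1.
  have S2 := suput0 (iter j theta w).
  have [SC0|SC0] := leP 0 (4 * suput (iter j theta w) + C); last first.
    apply: (@le_trans _ _ 0); first by rewrite nmulr_rle0// sqr_ge0.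
    by rewrite mulr_ge0 ?sqr_ge0// mulr_ge0// addr_ge0// mulr_ge0// (le_trans ler01).
  apply: ler_pM => //; first exact: sqr_ge0.
    rewrite [leRHS]mulrDl; apply: lerD; first by rewrite -mulrA ler_wpM2l.
    by apply: le_trans (ler_norm _) _; rewrite ler_peMr.
  rewrite lerXn2r ?nnegrE ?sG// mulr_ge0 ?(ltW (si0 _ (Gth _ (Gi j))))//.
  by rewrite mulr_ge0 ?(ltW C10).
Qed.

End Settings.

Theorem mainTheorem7
  (R : realType)
  (dO : measure_display) (Omega : measurableType dO) (P : probability Omega R)
  (theta thinv : Omega -> Omega)
  (dX : measure_display) (X : measurableType dX) (dist : X -> X -> R)
  (alpha : R)
  (E : set (Omega * X)) (T : Omega -> X -> X) (phi : Omega -> X -> R)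
  (u : Omega -> X -> R)
  (nu : Omega -> probability X R) (h : Omega -> X -> R)
  (p : R)
  (* standing setup *)
  (Htheta : invertible_mpt_ergodic P theta thinv)
  (Hmetric : is_metric dist)
  (HborelX : @measurable _ X = <<s dopen dist >>)
  (HXcompact : dcompact dist setT)
  (Hdiam : forall x y, dist x y <= 1)
  (Halpha : 0 < alpha <= 1)
  (HEmeas : measurable E)
  (HEfib : forall w, dcompact dist (Fib E w))
  (HTfib : forall w x, Fib E w x -> Fib E (theta w) (T w x))
  (HTmeas : measurable_fun E (fun wx => T wx.1 wx.2))
  (Hphimeas : measurable_fun E (fun wx => phi wx.1 wx.2))
  (Hphibdd : forall w, bounded_on (Fib E w) (phi w))
  (Humeas : measurable_fun E (fun wx => u wx.1 wx.2))
  (Hu : forall w, in_holder dist alpha (Fib E w) (u w))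
  (* nu = the measures nu_omega, h = the densities h_omega (mu_omega = h_omega nu_omega) *)
  (Hgibbs : {ae P, forall w, gibbs_char theta thinv E T phi nu h dist alpha w})
  (* Setting A with (a), (b), (c), or Setting B with (a), (c) *)
  (Hp : 16 < p)
  (Hsetting :
     (exists gamma H D : Omega -> R,
        settingA theta E T phi dist alpha P gamma H D /\
        hypsA theta E nu h dist alpha u P gamma H D p) \/
     (exists (l sg : Omega -> R) (q d : Omega -> nat) (y : Omega -> nat -> X -> X),
        settingB theta E T phi dist alpha P l sg q d y /\
        hypsB theta E phi nu h dist alpha u P l sg q d y p))
  (* (d) *)
  (Hsigma : exists2 sigma : R, 0 < sigma &
     {ae P, forall w,
        (fun n : nat => sig2 theta E T nu h u w n / n%:R) @ \oo --> sigma ^+ 2}) :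
  {ae P, forall w,
     exists (C : R) (N : nat), forall n : nat, (N <= n)%N ->
       forall t : R,
         `| mu E nu h w [set x | Snut theta E T nu h u w n x
                                   <= t * Num.sqrt (sig2 theta E T nu h u w n)]
            - Phi t |
         <= C * (n%:R `^ (- (2^-1 - 8 / p)))}.
Proof.
have [sigma sigma0 Hs] := Hsigma.
case: Hsetting => [[gamma [H [D [sA hA]]]]|[l [sg [q [d [y [sB hB]]]]]]].
  have [EA_bd _ _ _ _] := hA.
  exact: (clt_settingA Htheta Hmetric HborelX Hdiam Halpha HEmeas HTfib HTmeas Hu
    Hgibbs Hp sigma0 Hs sA EA_bd).
have [EB_bd _ _ MLp SLp] := hB.
exact: (clt_settingB Htheta Hmetric HborelX Hdiam Halpha HEmeas HTfib HTmeas Hphibdd Hu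
    Hgibbs Hp sigma0 Hs sB EB_bd MLp SLp).
Qed.
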